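(* Let $(\nu_n)_{n\ge 1}$ be a spherical model satisfying the following assumption: there exist a deterministic sequence $(a_n)_n$ of nonzero real numbers and constants $d_1,d_2,\alpha>0$, $\rho_0\in(0,1)$ such that, for every $n$ and every $\rho\in(0,\rho_0)$, $$\nu_n\left(\left|\frac{\|b_1^{(n)}\|^2}{a_n}-1\right|\ge\rho\right)\le d_1e^{-nd_2\rho^\alpha}.$$ For a codimension $g=g(n)\in\{0,\dots,n-1\}$, let $b_1^{(n)},\dots,b_{n-g}^{(n)}$ be a random basis with codimension $g$, i.e. $n-g$ independent random vectors of $\mathbb{R}^n$ with common distribution $\nu_n$. Let $s\in(0,1)$. (i) If $g=g(n)$ tends to infinity as $n\to\infty$, then the probability that the random basis is $s$-reduced tends to $1$. (ii) If $g$ is constant, then the probability that the random basis is $s$-reduced converges, as $n\to\infty$, to a constant in $(0,1)$ (depending on $s$ and $g$). (iii) If $g$ is constant, the index of worst local reduction $\mathcal{I}_n^g$ converges in distribution as $n\to\infty$.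
   Context: Spherical model: a sequence $(\nu_n)_{n\ge1}$ where each $\nu_n$ is a probability distribution on $\mathbb{R}^n$ that is invariant by rotation and satisfies $\nu_n(\{0\})=0$. In the assumption, $b_1^{(n)}$ denotes a random vector with distribution $\nu_n$. Independent vectors $b_1^{(n)},\dots,b_p^{(n)}$ ($p\le n$) with distribution $\nu_n$ are a.s. linearly independent. Gram--Schmidt: for a linearly independent system $b_1^{(n)},\dots,b_p^{(n)}$ of $\mathbb{R}^n$ (codimension $g=n-p$), set $\widehat b_1^{(n)}=b_1^{(n)}$ and $\widehat b_j^{(n)}=b_j^{(n)}-\sum_{i=1}^{j-1}\frac{\langle b_j^{(n)},\widehat b_i^{(n)}\rangle}{\|\widehat b_i^{(n)}\|^2}\widehat b_i^{(n)}$ for $2\le j\le p$ (no normalization). $s$-reduced (also called LLL($s$)-reduced): the system is $s$-reduced iff $\|\widehat b_{i+1}^{(n)}\|^2/\|\widehat b_i^{(n)}\|^2>s^2$ for all $1\le i\le p-1$. Reduction level: $\mathcal{M}_n^g:=\min_{i\in\{1,\dots,n-(g+1)\}}\|\widehat b_{i+1}^{(n)}\|^2/\|\widehat b_i^{(n)}\|^2$. Index of worst local reduction: $\mathcal{I}_n^g:=\min\{i:\ \|\widehat b_{n-i}^{(n)}\|^2/\|\widehat b_{n-i-1}^{(n)}\|^2=\mathcal{M}_n^g\}$, where $i$ ranges over the indices $g\le i\le n-2$ for which the ratio is defined. *)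

(* Defs.v *)
From HB Require Import structures.
From mathcomp Require Import all_boot all_order all_algebra.
From mathcomp Require Import all_classical all_reals all_analysis.

Set Implicit Arguments.
Unset Strict Implicit.
Unset Printing Implicit Defensive.

Import Order.TTheory GRing.Theory Num.Theory.
Import numFieldNormedType.Exports.

Local Open Scope classical_set_scope.
Local Open Scope ring_scope.

(* R^n is 'rV[R]_n with its Borel sigma-algebra, presented as the one generated
   by the coordinates, exactly as the library does for n.-tuple R. *)
Definition rV_display : measure_display.
Proof. exact: default_measure_display. Qed.

Section measurable_rV.
Context {R : realType}.
Variable n : nat.

Let coors : 'I_n -> 'rV[R]_n -> measurableTypeR R := fun i x => x ord0 i.

Let rV_set0 : g_sigma_preimage coors set0.
Proof. exact: sigma_algebra0. Qed.

Let rV_setC A : g_sigma_preimage coors A -> g_sigma_preimage coors (~` A).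
Proof. exact: sigma_algebraC. Qed.

Let rV_bigcup (F : _^nat) : (forall i, g_sigma_preimage coors (F i)) ->
  g_sigma_preimage coors (\bigcup_i (F i)).
Proof. exact: sigma_algebra_bigcup. Qed.

HB.instance Definition _ := @isMeasurable.Build
  rV_display 'rV[R]_n (g_sigma_preimage coors) rV_set0 rV_setC rV_bigcup.

End measurable_rV.

(* The norm `|x| of the library on 'rV[R]_n is the sup norm, hence these. *)
Definition dotv (R : realType) (n : nat) (x y : 'rV[R]_n) : R :=
  \sum_(i < n) x ord0 i * y ord0 i.

Definition sqnorm (R : realType) (n : nat) (x : 'rV[R]_n) : R := dotv x x.

Section gram_schmidt.
Context {R : realType} {n : nat}.
Implicit Type b : seq 'rV[R]_n.

(* Division by 0 being 0, the formulas below are total; they are only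
   meaningful for a linearly independent system. *)
Definition gram_schmidt b : seq 'rV[R]_n :=
  foldl (fun acc v =>
    rcons acc (v - \sum_(w <- acc) (dotv v w / sqnorm w) *: w)) [::] b.

(* Vectors are numbered from 1. *)
Definition bhat b (j : nat) : 'rV[R]_n := nth 0 (gram_schmidt b) j.-1.

Definition gs_ratio b (i : nat) : R :=
  sqnorm (bhat b i.+1) / sqnorm (bhat b i).

Definition s_reduced (s : R) b : Prop :=
  forall i : nat, (1 <= i <= (size b).-1)%N -> s ^+ 2 < gs_ratio b i.

(* The codimension of b is g = n - size b, so that n - (g + 1) is
   (size b).-1; the range of the minimum is nonempty when size b >= 2. *)
Definition reduction_level b : R :=
  \big[Num.min/gs_ratio b 1]_(1 <= i < size b) gs_ratio b i.

(* The least i with g <= i <= n - 2 such that the (n - i - 1)-st ratio attains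
   the minimum (0 when there is no such i, which is the case size b <= 1). *)
Definition worst_index b : nat :=
  head 0%N [seq i <- index_iota (n - size b) n.-1
           | gs_ratio b (n - i - 1) == reduction_level b].

End gram_schmidt.

Definition rotation (R : realType) (n : nat) (Q : 'M[R]_n) : Prop :=
  Q *m Q^T = 1%:M /\ \det Q = 1.

Definition spherical_model (R : realType)
    (nu : forall n : nat, probability 'rV[R]_n R) : Prop :=
  forall n : nat, (0 < n)%N ->
    (forall (Q : 'M[R]_n) (A : set 'rV[R]_n), rotation Q -> measurable A ->
       nu n ((fun x : 'rV[R]_n => x *m Q) @^-1` A) = nu n A)
    /\ nu n [set 0] = 0%E.

Definition norm_concentration (R : realType)
    (nu : forall n : nat, probability 'rV[R]_n R) : Prop :=
  exists (a : nat -> R) (d1 d2 alpha rho0 : R),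
    [/\ (forall n : nat, (0 < n)%N -> a n != 0),
        [/\ 0 < d1, 0 < d2 & 0 < alpha],
        0 < rho0 < 1 &
        forall (n : nat) (rho : R), (0 < n)%N -> 0 < rho < rho0 ->
          (nu n [set x | (rho <= `|sqnorm x / a n - 1|)%R]
           <= (d1 * expR (- (n%:R * d2 * (rho `^ alpha))))%:E)%E].

Section random_basis.
Context {d d' : measure_display} {Omega : measurableType d}
  {T : measurableType d'} {R : realType} (P : probability Omega R).

Definition mutually_independent (p : nat) (X : 'I_p -> {RV P >-> T}) : Prop :=
  forall A : 'I_p -> set T, (forall i, measurable (A i)) ->
    P [set w | forall i, A i (X i w)]
    = (\prod_(i < p) P (X i @^-1` A i))%E.

Definition iid (mu : probability T R) (p : nat) (X : 'I_p -> {RV P >-> T}) :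
    Prop :=
  mutually_independent X /\
  forall (i : 'I_p) (A : set T), measurable A -> distribution P (X i) A = mu A.

End random_basis.

Definition system (R : realType) (n p : nat) (Omega : Type)
    (b : 'I_p -> Omega -> 'rV[R]_n) (w : Omega) : seq 'rV[R]_n :=
  [seq b i w | i <- enum 'I_p].

Definition cvg_in_distribution (R : realType) (d : nat -> measure_display)
    (Omega : forall n : nat, measurableType (d n))
    (P : forall n : nat, probability (Omega n) R)
    (X : forall n : nat, Omega n -> R)
    (mu : probability (measurableTypeR R) R) : Prop :=
  forall f : R -> R, continuous f -> bounded_fun f ->
    (\int[P n]_w (f (X n w))%:E)%E @[n --> \oo] --> (\int[mu]_x (f x)%:E)%E.

(* Main.v *)
Require Import Defs.
From HB Require Import structures.
From mathcomp Require Import all_boot all_order all_algebra.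
From mathcomp Require Import all_classical all_reals all_analysis.
From mathcomp Require Import measurable_realfun.
From mathcomp Require Import ring lra.
From mathcomp Require Import zify.

Set Implicit Arguments.
Unset Strict Implicit.
Unset Printing Implicit Defensive.

Import Order.TTheory GRing.Theory Num.Theory.
Import numFieldNormedType.Exports.

Local Open Scope classical_set_scope.
Local Open Scope ring_scope.

(** For a rotation invariant law, the squared length of the j-th Gram-Schmidt
    vector given the previous ones depends on the subspace they span only
    through its dimension, so these lengths are independent, the j-th one being
    distributed as the squared norm of the last n - j + 1 coordinates.  In polar
    form a rotation invariant vector is its length times the direction of a
    Gaussian vector; as |b|^2 / a_n concentrates, n / a_n times the squared
    length of the last-but-i vector is close in law to a chi-square variable
    with g + i + 1 degrees of freedom, with tails that make the ratios of
    consecutive lengths of high degrees of freedom exceed any t < 1 with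
    summably small failure probability.  Hence only finitely many ratios matter:
    the basis is reduced with probability tending to 1 when g tends to infinity,
    and for constant g the probabilities and the position of the worst ratio
    converge to those of an independent chi-square sequence, ties having
    probability 0. *)

(** The uniform law on the sphere never appears. Spherical and Gaussian laws satisfy one family of
    identities, [tail_invariant], expressing the tail [tsq k.+1] through [tsq k] and an arbitrary
    fixed vector [y]. Drawing [y] from the Gaussian law and exchanging the roles of the two vectors
    shows that [tsq k / tsq 0] has the same law in both cases and is independent of the length.
    Comparing with the Gaussian law costs an error [del n] per marginal event, and about [n] ratios
    are controlled at once, whence the requirement that [n * del n] tend to 0. A ratio is never
    estimated directly: thresholds proportional to the degrees of freedom are put on the two
    lengths, so that a bad ratio forces one of two large deviations. No infinite product measure is
    built: limits are taken along finite prefixes. Events are paired with their strict failure, so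
    as to have two disjoint open sets of total limit mass 1, for which convergence on boxes is
    enough; strict inequalities and cross-multiplied ratios serve this purpose. *)

Lemma integral_prob_cst d (T : measurableType d) (R : realType)
    (P : probability T R) (c : \bar R) : (\int[P]_x cst c x = c)%E.
Proof.
rewrite integral_cst//.
transitivity (c * 1)%E; last exact: mule1.
by congr (_ * _)%E; exact: probability_setT.
Qed.

Lemma measurable_preim d d' (T : measurableType d) (T' : measurableType d')
    (f : T -> T') (B : set T') :
  measurable_fun setT f -> measurable B -> measurable [set t | B (f t)].
Proof. by move=> mf mB; rewrite -[X in measurable X]setTI; exact: mf. Qed.

Lemma le_prob d (T : measurableType d) (R : realType) (P : probability T R)
    (A B : set T) : measurable A -> measurable B -> A `<=` B -> (P A <= P B)%E.
Proof. by move=> mA mB AB; apply: le_measure => //; rewrite inE. Qed.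

Lemma eq_integral_null d (T : measurableType d) (R : realType)
    (P : {measure set T -> \bar R}) (N : set T) (f g : T -> \bar R) :
  measurable N -> P N = 0%E ->
  measurable_fun setT f -> measurable_fun setT g ->
  (forall x, ~ N x -> f x = g x) -> (\int[P]_x f x = \int[P]_x g x)%E.
Proof.
move=> mN PN mf mg fg; apply: ae_eq_integral => //.
exists N; split => // x /= fgx; apply: contrapT => Nx; apply: fgx => _.
exact: fg.
Qed.

Lemma prob_integral d (T : measurableType d) (R : realType) (P : probability T R)
    (A : set T) : measurable A -> P A = (\int[P]_x (\1_A x)%:E)%E.
Proof. by move=> mA; rewrite integral_indic// setIT. Qed.

(** * Measurability of inverses, coordinates and scalar products *)

Section measurability.
Context {R : realType}.

(** Inversion is continuous off 0 only, so the point 0, where its value is 0 by convention, is split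
    off. *)
Lemma measurable_invr : measurable_fun [set: R] (@GRing.inv R).
Proof.
rewrite -(setvU [set 0 : R]); apply/measurable_funU => //; first exact: measurableC.
split; last exact: measurable_fun_set1.
apply: open_continuous_measurable_fun.
  apply: closed_openC; apply: compact_closed; last exact: compact_set1.
  exact: Rhausdorff.
by move=> x; rewrite inE /= => /eqP x0; exact: inv_continuous.
Qed.

Lemma measurable_fun_div d (T : measurableType d) (f g : T -> R) :
  measurable_fun [set: T] f -> measurable_fun [set: T] g ->
  measurable_fun [set: T] (fun t => f t / g t).
Proof.
move=> mf mg; apply: measurable_funM => //.
exact: measurableT_comp measurable_invr mg.
Qed.

Lemma measurable_rV_coord n (i : 'I_n) :
  measurable_fun [set: 'rV[R]_n] (fun x : 'rV[R]_n => x ord0 i : R).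
Proof.
move=> _ Y mY; rewrite setTI; apply: sub_sigma_algebra => /=.
rewrite -bigcup_seq/=; exists i => /=; first by rewrite mem_index_enum.
by exists Y => //; rewrite setTI.
Qed.

Lemma measurable_fun_rV d (T : measurableType d) n (f : T -> 'rV[R]_n) :
  (forall i, measurable_fun [set: T] (fun t => f t ord0 i : R)) ->
  measurable_fun [set: T] f.
Proof.
move=> mf; apply: (measurability
  (\big[setU/set0]_(i < n) preimage_set_system setT
     (fun x : 'rV[R]_n => x ord0 i : measurableTypeR R) measurable)) => //.
move=> _ [A + <-]; rewrite -bigcup_seq => -[i _ [B mB <-]].
by rewrite !setTI; have := mf i measurableT B mB; rewrite setTI.
Qed.

Lemma measurable_dotv d (T : measurableType d) n (f g : T -> 'rV[R]_n) :
  measurable_fun [set: T] f -> measurable_fun [set: T] g ->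
  measurable_fun [set: T] (fun t => dotv (f t) (g t)).
Proof.
move=> mf mg; apply: measurable_sum => i; apply: measurable_funM.
  exact: measurableT_comp (measurable_rV_coord i) mf.
exact: measurableT_comp (measurable_rV_coord i) mg.
Qed.

Lemma measurable_sqnorm d (T : measurableType d) n (f : T -> 'rV[R]_n) :
  measurable_fun [set: T] f -> measurable_fun [set: T] (fun t => sqnorm (f t)).
Proof. by move=> mf; exact: measurable_dotv. Qed.

End measurability.

(** * The Gaussian law *)

Section lebesgue_affine.
Context {R : realType}.
Notation leb := (@lebesgue_measure R).

Let affine (a b : R) : measurableTypeR R -> measurableTypeR R := fun x => (a * x + b)%R.

Let measurable_affine a b : measurable_fun [set: measurableTypeR R] (affine a b).
Proof. by apply: measurable_funD => //; exact: mulrl_measurable. Qed.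

(** Lebesgue measure is characterized by the length of half-open intervals, so the rescaled image
    measure needs testing on these only. *)
Lemma lebesgue_affine (a b : R) (A : set R) : a != 0%R -> measurable A ->
  leb A = (`|a|%:E * leb ((fun x => a * x + b)%R @^-1` A))%E.
Proof.
move=> a0 mA.
have k0 : (0 <= `|a|)%R by [].
pose mu := mscale (NngNum k0) (pushforward leb (affine a b)).
rewrite -[RHS]/(mu (measurable_affine a b) A).
apply: lebesgue_measure_unique => // _ [[u v] /= _ <-].
rewrite [RHS]/mscale /= /pushforward.
(* The first branch is that of a negative slope: the closed and the open end of the interval are
   exchanged, but the length is the same. *)
have [a_gt0|a_lt0|/eqP] := ltrgtP a 0%R; last by rewrite (negbTE a0).
- have -> : affine a b @^-1` `]u, v] = `[(v - b) / a, (u - b) / a[%classic.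
    apply/seteqP; split => x; rewrite /affine /= !in_itv /=.
      by rewrite ler_ndivrMr// ltr_ndivlMr// (mulrC x); lra.
    by rewrite ler_ndivrMr// ltr_ndivlMr// (mulrC x); lra.
  rewrite !lebesgue_measure_itv /= !lte_fin ltr_ndivrMr// divfK// ltrD2r.
  case: ifP => _; rewrite ?mule0// -!EFinB -EFinM.
  by congr EFin; rewrite ltr0_norm//; field.
- have -> : affine a b @^-1` `]u, v] = `](u - b) / a, (v - b) / a]%classic.
    apply/seteqP; split => x; rewrite /affine /= !in_itv /=.
      by rewrite ler_pdivlMr// ltr_pdivrMr// (mulrC x); lra.
    by rewrite ler_pdivlMr// ltr_pdivrMr// (mulrC x); lra.
  rewrite !lebesgue_measure_itv /= !lte_fin ltr_pM2r ?invr_gt0// ltrD2r.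
  case: ifP => _; rewrite ?mule0// -!EFinB -EFinM.
  by congr EFin; rewrite gtr0_norm//; field.
Qed.

Lemma ge0_integral_affine (a b : R) (f : R -> \bar R) : a != 0%R ->
  measurable_fun [set: R] f -> (forall x, 0 <= f x)%E ->
  (\int[leb]_x f x = `|a|%:E * \int[leb]_x f (a * x + b)%R)%E.
Proof.
move=> a0 mf f0.
have k0 : (0 <= `|a|)%R by [].
pose mu := mscale (NngNum k0) (pushforward leb (affine a b)).
rewrite (eq_measure_integral (mu (measurable_affine a b))); last first.
  by move=> A mA _; exact: lebesgue_affine.
rewrite ge0_integral_mscale//; congr (_ * _)%E.
by rewrite ge0_integral_pushforward.
Qed.

End lebesgue_affine.

(** * The one-dimensional normal law and rotations of the plane *)

Section normal_law.
Context {R : realType}.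
Notation leb := (@lebesgue_measure R).
Notation N01 := (@normal_prob R 0 1).

(** Change of measure is available with the Radon-Nikodym derivative; it agrees almost everywhere
    with the explicit density, as both have the same integral over every measurable set. *)
Lemma integral_normal_prob (f : R -> \bar R) :
  measurable_fun [set: R] f -> (forall x, 0 <= f x)%E ->
  (\int[N01]_x f x = \int[leb]_x (f x * (normal_pdf 0 1 x)%:E))%E.
Proof.
move=> mf f0.
rewrite -(Radon_Nikodym_SigmaFinite.change_of_variables (normal_prob_dominates 0 1))//.
apply: ae_eq_integral => //.
- apply: emeasurable_funM => //; apply: (measurable_int leb).
  by apply: Radon_Nikodym_SigmaFinite.f_integrable; exact: normal_prob_dominates.
- apply: emeasurable_funM => //; apply/measurable_EFinP.
  exact: measurable_normal_pdf.
- apply: ae_eqe_mul2l => /=.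
  apply: integral_ae_eq => //=.
  + by apply: Radon_Nikodym_SigmaFinite.f_integrable; exact: normal_prob_dominates.
  + by apply/measurable_EFinP; exact: measurable_normal_pdf.
  + by move=> E _ mE; rewrite -Radon_Nikodym_SigmaFinite.f_integral//; exact: normal_prob_dominates.
Qed.

(** The orthogonal change of variables is factored into affine substitutions in one variable at a
    time, with Tonelli in between; the factors [|t^-1|] and [|t|] cancel. *)
Lemma lebesgue_reflection (c t : R) (F : R * R -> \bar R) :
  c ^+ 2 + t ^+ 2 = 1 ->
  measurable_fun [set: R * R] F -> (forall z, 0 <= F z)%E ->
  (\int[leb]_x \int[leb]_y F (x, y) =
   \int[leb]_x \int[leb]_y F (c * x + t * y, t * x - c * y)%R)%E.
Proof.
(* For [t = 0] the map only changes signs, [c] being 1 or -1; the other case divides by [t]. *)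
move=> ct mF F0; have [t0|t0] := eqVneq t 0.
  have c0 : c != 0.
    by apply/eqP => c0; move: ct; rewrite c0 t0 expr0n/= addr0 => /eqP; rewrite eq_sym oner_eq0.
  have c1 : (`|c|%:E = 1 :> \bar R)%E.
    by congr EFin; apply/eqP; rewrite -(@pexpr_eq1 _ _ 2)// -normrX ger0_norm ?sqr_ge0//; apply/eqP; rewrite -ct t0; ring.
  rewrite (@ge0_integral_affine _ c 0)//; last 2 first.
    by apply: (measurable_fun_fubini_tonelli_F (m2 := leb) F) => //.
    by move=> x; apply: integral_ge0.
  rewrite c1 mul1e; apply: eq_integral => x _.
  rewrite (@ge0_integral_affine _ (- c) 0) ?oppr_eq0//; last first.
    by apply: measurableT_comp => //; exact: measurable_fun_pair.
  by rewrite normrN c1 mul1e; apply: eq_integral => y _; rewrite t0; congr (F (_, _)); ring.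
have tV0 : t^-1 != 0 by rewrite invr_eq0.
transitivity (\int[leb]_x (`|t^-1|%:E * \int[leb]_y F (x, (y - c * x) / t)%R))%E.
  apply: eq_integral => x _.
  rewrite (@ge0_integral_affine _ t^-1 (- (c * x) / t))//; last first.
    by apply: measurableT_comp => //; exact: measurable_fun_pair.
  congr (_ * _)%E; apply: eq_integral => y _; congr (F (_, _)); ring.
pose F1 := fun z : R * R => F (z.1, (z.2 - c * z.1) / t).
have mF1 : measurable_fun [set: R * R] F1.
  apply: measurableT_comp => //; apply: measurable_fun_pair => //=.
  apply: measurable_funM => //; apply: measurable_funB => //.
  by apply: measurable_funM => //.
rewrite ge0_integralZl//; last 2 first.
  by apply: (measurable_fun_fubini_tonelli_F (m2 := leb) F1) => // z; exact: F0.
  by move=> x _; apply: integral_ge0.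
rewrite (fubini_tonelli (m1 := leb) (m2 := leb) F1)//; last by move=> z; exact: F0.
transitivity (`|t^-1|%:E * \int[leb]_y (`|t|%:E * \int[leb]_x F1 (t * x + c * y, y)%R))%E.
  congr (_ * _)%E; apply: eq_integral => x _.
  rewrite [LHS](@ge0_integral_affine _ t (c * x))//; last by move=> ?; exact: F0.
  by apply: measurableT_comp => //; exact: measurable_fun_pair.
pose F2 := fun z : R * R => F1 (t * z.2 + c * z.1, z.1).
have mF2 : measurable_fun [set: R * R] F2.
  apply: measurableT_comp => //; apply: measurable_fun_pair => //=.
  by apply: measurable_funD => //; apply: measurable_funM => //.
rewrite ge0_integralZl//; last 2 first.
  by apply: (measurable_fun_fubini_tonelli_F (m2 := leb) F2) => // z; exact: F0.
  by move=> x _; apply: integral_ge0 => z _; exact: F0.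
rewrite muleA -EFinM -normrM mulVf// normr1 mul1e.
apply: eq_integral => x _; apply: eq_integral => y _.
rewrite /F1 /=; congr (F (_, _)); first ring.
have c2 : c ^+ 2 = 1 - t ^+ 2 by rewrite -ct; ring.
transitivity ((x - c * t * y - c ^+ 2 * x) / t); first by ring.
by rewrite c2; field.
Qed.

(** The product of the two densities is a function of [x ^+ 2 + y ^+ 2], which the reflection
    preserves. *)
Lemma normal_rotation (c t : R) (H : R * R -> \bar R) : c ^+ 2 + t ^+ 2 = 1 ->
  measurable_fun [set: R * R] H -> (forall z, 0 <= H z)%E ->
  (\int[N01]_x \int[N01]_y H (c * x + t * y, x ^+ 2 + y ^+ 2)%R =
   \int[N01]_x \int[N01]_y H (x, x ^+ 2 + y ^+ 2)%R)%E.
Proof.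
move=> ct mH H0.
have dens (K : R * R -> \bar R) : measurable_fun [set: R * R] K ->
    (forall z, 0 <= K z)%E ->
    (\int[N01]_x \int[N01]_y K (x, y) = \int[leb]_x \int[leb]_y
       (K (x, y) * (normal_pdf 0 1 x * normal_pdf 0 1 y)%:E))%E.
  move=> mK K0; rewrite integral_normal_prob//; last 2 first.
    by apply: (measurable_fun_fubini_tonelli_F (m2 := N01) K) => //.
    by move=> x; apply: integral_ge0 => y _; exact: K0.
  apply: eq_integral => x _; rewrite integral_normal_prob//; last first.
    by apply: measurableT_comp => //; exact: measurable_fun_pair.
  rewrite muleC -ge0_integralZl//; last 3 first.
  - apply: emeasurable_funM; first by apply: measurableT_comp => //; exact: measurable_fun_pair.
    by apply/measurable_EFinP; exact: measurable_normal_pdf.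
  - by move=> y _; rewrite mule_ge0// lee_fin normal_pdf_ge0.
  - by rewrite lee_fin normal_pdf_ge0.
  by apply: eq_integral => y _; rewrite EFinM muleCA.
pose K1 := fun z : R * R => H (c * z.1 + t * z.2, z.1 ^+ 2 + z.2 ^+ 2).
pose K2 := fun z : R * R => H (z.1, z.1 ^+ 2 + z.2 ^+ 2).
have mK1 : measurable_fun [set: R * R] K1.
  apply: measurableT_comp => //; apply: measurable_fun_pair => //=.
    by apply: measurable_funD => //; apply: measurable_funM => //.
  by apply: measurable_funD => //; apply: measurable_funX => //.
have mK2 : measurable_fun [set: R * R] K2.
  apply: measurableT_comp => //; apply: measurable_fun_pair => //=.
  by apply: measurable_funD => //; apply: measurable_funX => //.
transitivity (\int[N01]_x \int[N01]_y K1 (x, y))%E; first by [].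
transitivity (\int[N01]_x \int[N01]_y K2 (x, y))%E; last by [].
rewrite (dens _ mK1 (fun=> H0 _)) (dens _ mK2 (fun=> H0 _)).
pose F := fun z : R * R => (K1 z * (normal_pdf 0 1 z.1 * normal_pdf 0 1 z.2)%:E)%E.
rewrite (lebesgue_reflection (F := F) ct); last 2 first.
  apply: emeasurable_funM => //; apply/measurable_EFinP; apply: measurable_funM.
    by apply: measurableT_comp => //; exact: measurable_normal_pdf.
  by apply: measurableT_comp => //; exact: measurable_normal_pdf.
  by move=> z; rewrite mule_ge0 ?H0// lee_fin mulr_ge0// normal_pdf_ge0.
apply: eq_integral => x _; apply: eq_integral => y _.
rewrite /F /K1 /K2 /= !normal_pdfE ?oner_eq0//=.
have e : (c * x + t * y) ^+ 2 + (t * x - c * y) ^+ 2 = x ^+ 2 + y ^+ 2.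
  by rewrite -[RHS]mul1r -ct; ring.
rewrite e; congr (H (_, _) * _)%E.
  by rewrite -[RHS]mul1r -ct; ring.
rewrite /normal_fun !subr0; congr EFin.
set p := normal_peak 1.
rewrite [LHS]mulrACA [RHS]mulrACA -!expRD; congr (_ * expR _).
by rewrite -!mulrDl -!opprD e.
Qed.

(** The vector with coordinates [a] and [b] is its length times a unit vector, to which the previous
    lemma applies; the zero vector is treated apart. *)
Lemma normal_rotation_norm (a b : R) (H : R * R -> \bar R) :
  measurable_fun [set: R * R] H -> (forall z, 0 <= H z)%E ->
  (\int[N01]_x \int[N01]_y H (a * x + b * y, x ^+ 2 + y ^+ 2)%R =
   \int[N01]_x \int[N01]_y H (Num.sqrt (a ^+ 2 + b ^+ 2) * x, x ^+ 2 + y ^+ 2)%R)%E.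
Proof.
move=> mH H0.
have : Num.sqrt (a ^+ 2 + b ^+ 2) ^+ 2 = a ^+ 2 + b ^+ 2.
  by rewrite sqr_sqrtr// addr_ge0 ?sqr_ge0.
move: (Num.sqrt _) => r r2.
have [r0|r0] := eqVneq r 0.
  move: r2; rewrite r0 expr0n => /esym/eqP.
  rewrite (paddr_eq0 (sqr_ge0 a) (sqr_ge0 b)) !sqrf_eq0 => /andP[/eqP a0 /eqP b0].
  apply: eq_integral => x _; apply: eq_integral => y _.
  by rewrite a0 b0 !mul0r addr0.
have e : (a / r) ^+ 2 + (b / r) ^+ 2 = 1.
  by rewrite !expr_div_n -mulrDl -r2 divff// sqrf_eq0.
pose K := fun z : R * R => H (r * z.1, z.2).
have mK : measurable_fun [set: R * R] K.
  by apply: measurableT_comp => //; apply: measurable_fun_pair => //=; apply: measurable_funM.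
have := @normal_rotation (a / r) (b / r) K e mK (fun=> H0 _); rewrite /K /= => <-.
apply: eq_integral => x _; apply: eq_integral => y _; rewrite /K /=.
by congr (H (_, _)); field.
Qed.

(** Parity of the density: the one-dimensional counterpart of the rotation, where the norm of the
    vector is [|a|]. *)
Lemma normal_symmetric (a : R) (H : R * R -> \bar R) :
  measurable_fun [set: R * R] H -> (forall z, 0 <= H z)%E ->
  (\int[N01]_x H (a * x, x ^+ 2)%R = \int[N01]_x H (`|a| * x, x ^+ 2)%R)%E.
Proof.
move=> mH H0; have [a0|a0] := lerP 0 a; first by rewrite ger0_norm.
rewrite ltr0_norm//.
have mK (u : R) : measurable_fun [set: R] (fun x : R => H (u * x, x ^+ 2)).
  by apply: measurableT_comp => //; apply: measurable_fun_pair => //=.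
rewrite integral_normal_prob// integral_normal_prob//.
rewrite (@ge0_integral_affine _ (-1) 0)//; last 2 first.
- by apply: emeasurable_funM => //; apply/measurable_EFinP; exact: measurable_normal_pdf.
- by move=> x; rewrite mule_ge0// lee_fin normal_pdf_ge0.
rewrite normrN1 mul1e; apply: eq_integral => x _.
rewrite !normal_pdfE ?oner_eq0//= /normal_fun addr0 !subr0 !mulN1r !sqrrN.
by rewrite (mulrN a) (mulNr a).
Qed.

End normal_law.

(** * Finite product laws on row vectors *)

Section product_law.
Context {R : realType}.

Definition consrV n (z : R) (x : 'rV[R]_n) : 'rV[R]_n.+1 :=
  \row_i oapp (x ord0) z (unlift ord0 i).

Lemma consrV0 n z (x : 'rV[R]_n) : consrV z x ord0 ord0 = z.
Proof. by rewrite mxE unlift_none. Qed.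

Lemma consrVS n z (x : 'rV[R]_n) i : consrV z x ord0 (lift ord0 i) = x ord0 i.
Proof. by rewrite mxE liftK. Qed.

Lemma consrV_surj n (y : 'rV[R]_n.+1) : y = consrV (y ord0 ord0) (\row_i y ord0 (lift ord0 i)).
Proof.
apply/rowP => i; rewrite mxE; case: unliftP => [j ->|->] //=.
by rewrite mxE.
Qed.

Definition pair_consrV n (p : measurableTypeR R * 'rV[R]_n) : 'rV[R]_n.+1 :=
  consrV p.1 p.2.

Lemma measurable_pair_consrV n : measurable_fun setT (@pair_consrV n).
Proof.
apply: measurable_fun_rV => i; rewrite /pair_consrV.
case: (unliftP ord0 i) => [j ->|->].
  under eq_fun do rewrite consrVS.
  exact: measurableT_comp (measurable_rV_coord j) measurable_snd.
under eq_fun do rewrite consrV0.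
exact: measurable_fst.
Qed.

HB.instance Definition _ n := isMeasurableFun.Build _ _ _ _ (@pair_consrV n)
  (@measurable_pair_consrV n).

Lemma measurable_consrV d (T : measurableType d) n (f : T -> R) (g : T -> 'rV[R]_n) :
  measurable_fun setT f -> measurable_fun setT g ->
  measurable_fun setT (fun t => consrV (f t) (g t)).
Proof.
move=> mf mg.
apply: (@measurableT_comp _ _ _ _ _ _ (@pair_consrV n) _ (fun t => (f t, g t))).
  exact: measurable_pair_consrV.
exact: measurable_fun_pair.
Qed.

(** Recursion on the first coordinate, with the sequence of laws shifted: a statement on [n]
    coordinates becomes an induction with one use of Tonelli, and the remaining coordinates again
    have a law of this form. *)
Fixpoint prodP (lam : nat -> probability (measurableTypeR R) R) n :
    probability 'rV[R]_n R :=
  match n with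
  | 0 => \d_ (0 : 'rV[R]_0)
  | m.+1 => distribution (lam 0%N \x prodP (fun i => lam i.+1) m)%E (@pair_consrV m)
  end.

Lemma prodPS lam n (A : set 'rV[R]_n.+1) : measurable A ->
  prodP lam n.+1 A =
  (\int[lam 0%N]_z prodP (fun i => lam i.+1) n (consrV z @^-1` A))%E.
Proof.
move=> mA; rewrite /= /distribution /pushforward /= /product_measure1.
apply: eq_integral => z _ /=; congr (prodP _ _ _).
by apply/seteqP; split => x; rewrite /xsection /= inE.
Qed.

Lemma ge0_integral_prodP lam n (f : 'rV[R]_n.+1 -> \bar R) :
  measurable_fun setT f -> (forall x, 0 <= f x)%E ->
  (\int[prodP lam n.+1]_x f x =
   \int[lam 0%N]_z \int[prodP (fun i => lam i.+1) n]_x f (consrV z x))%E.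
Proof.
move=> mf f0; rewrite /= ge0_integral_distribution//.
rewrite fubini_tonelli1//=.
by apply: measurableT_comp => //; exact: measurable_pair_consrV.
Qed.

Lemma prodP_coord0 lam n (B : set R) : measurable B ->
  prodP lam n.+1 [set x | B (x ord0 ord0)] = lam 0%N B.
Proof.
move=> mB; rewrite prodPS; last first.
  by apply: measurable_preim => //; exact: measurable_rV_coord.
transitivity (\int[lam 0%N]_z (\1_B z)%:E)%E.
  apply: eq_integral => z _; rewrite indicE.
  have [zB|zB] := boolP (z \in B).
    rewrite (_ : _ @^-1` _ = setT) ?probability_setT//.
    by apply/seteqP; split => // x _ /=; rewrite consrV0; rewrite inE in zB.
  rewrite (_ : _ @^-1` _ = set0) ?measure0//.
  apply/seteqP; split => // x /=; rewrite consrV0; by move: zB; rewrite notin_setE.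
by rewrite integral_indic// setIT.
Qed.

(** With the first coordinate integrated innermost, a set whose sections in that coordinate are null
    is itself null. *)
Lemma prodP_swap lam n (A : set 'rV[R]_n.+1) : measurable A ->
  prodP lam n.+1 A =
  (\int[prodP (fun i => lam i.+1) n]_x lam 0%N [set z | A (consrV z x)])%E.
Proof.
move=> mA; rewrite [LHS]prob_integral//.
rewrite ge0_integral_prodP; last 2 first.
- by apply/measurable_EFinP; exact: measurable_indic.
- by move=> x; rewrite lee_fin.
pose f := fun p : measurableTypeR R * 'rV[R]_n => ((\1_A (consrV p.1 p.2) : R)%:E)%E.
have mf : measurable_fun setT f.
  apply/measurable_EFinP; apply: measurableT_comp; first exact: measurable_indic.
  exact: measurable_consrV.
have f0 p : (0 <= f p)%E by rewrite lee_fin.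
rewrite (@fubini_tonelli _ _ _ _ R (lam 0%N) (prodP (fun i => lam i.+1) n) f mf f0).
apply: eq_integral => x _.
rewrite [RHS]prob_integral//.
by apply: measurable_preim => //; exact: measurable_consrV.
Qed.

End product_law.

(** * Scalar products of the tails of vectors *)

Section tail_dot.
Context {R : realType}.

(** The scalar product after projection on the last [n - k] coordinates. Under a rotation invariant
    law, [tsq k] will have the law of the squared distance to any fixed subspace of dimension [k],
    hence of a Gram-Schmidt squared length. *)
Definition tdot n (k : nat) (x y : 'rV[R]_n) : R :=
  \sum_(i < n | (k <= i)%N) x ord0 i * y ord0 i.

Definition tsq n (k : nat) (x : 'rV[R]_n) : R := tdot k x x.

Lemma tsq0 n (x : 'rV[R]_n) : tsq 0 x = sqnorm x.
Proof. by []. Qed.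

Lemma tdot0_cons n z w (x y : 'rV[R]_n) :
  tdot 0 (consrV z x) (consrV w y) = z * w + tdot 0 x y.
Proof.
rewrite /tdot big_mkcond big_ord_recl /= !consrV0; congr (_ + _).
by rewrite [RHS]big_mkcond; apply: eq_bigr => i _; rewrite !consrVS.
Qed.

Lemma tdotS_cons n k z w (x y : 'rV[R]_n) :
  tdot k.+1 (consrV z x) (consrV w y) = tdot k x y.
Proof.
rewrite /tdot big_mkcond big_ord_recl /= add0r.
rewrite [RHS]big_mkcond; apply: eq_bigr => i _; rewrite !consrVS.
by rewrite /bump leq0n add1n ltnS.
Qed.

Lemma tsq0_cons n z (x : 'rV[R]_n) : tsq 0 (consrV z x) = z ^+ 2 + tsq 0 x.
Proof. by rewrite /tsq tdot0_cons expr2. Qed.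

Lemma tsqS_cons n k z (x : 'rV[R]_n) : tsq k.+1 (consrV z x) = tsq k x.
Proof. exact: tdotS_cons. Qed.

Lemma tsq_ge0 n k (x : 'rV[R]_n) : 0 <= tsq k x.
Proof. by apply: sumr_ge0 => i _; rewrite -expr2 sqr_ge0. Qed.

Lemma tsq_leS n k (x : 'rV[R]_n) : tsq k.+1 x <= tsq k x.
Proof.
rewrite /tsq /tdot [leRHS]big_mkcond [leLHS]big_mkcond /=.
apply: ler_sum => i _; case: ifPn => [/ltnW->//|_].
by case: ifPn => // _; rewrite -expr2 sqr_ge0.
Qed.

Lemma tsq_le0 n k (x : 'rV[R]_n) : tsq k x <= tsq 0 x.
Proof. by elim: k => // k IH; exact: le_trans (tsq_leS _ _) IH. Qed.

Lemma tsq_oversize n k (x : 'rV[R]_n) : (n <= k)%N -> tsq k x = 0.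
Proof.
by move=> nk; rewrite /tsq /tdot big1// => i; rewrite leqNgt (leq_trans _ nk).
Qed.

Lemma measurable_tdot d (T : measurableType d) n k (f g : T -> 'rV[R]_n) :
  measurable_fun setT f -> measurable_fun setT g ->
  measurable_fun setT (fun t => tdot k (f t) (g t)).
Proof.
move=> mf mg; rewrite /tdot.
rewrite (_ : (fun t => _) = fun t => \sum_(i < n)
  (if (k <= i)%N then f t ord0 i * g t ord0 i else 0)); last first.
  by apply/funext => t; rewrite big_mkcond.
apply: measurable_sum => i; case: (k <= i)%N => //; apply: measurable_funM.
  exact: measurableT_comp (measurable_rV_coord i) mf.
exact: measurableT_comp (measurable_rV_coord i) mg.
Qed.

Lemma measurable_tsq d (T : measurableType d) n k (f : T -> 'rV[R]_n) :
  measurable_fun setT f -> measurable_fun setT (fun t => tsq k (f t)).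
Proof. by move=> mf; exact: measurable_tdot. Qed.

End tail_dot.

(** * The standard Gaussian vector *)

Section gaussian.
Context {R : realType}.
Notation N01 := (@normal_prob R 0 1).

Definition gam n : probability 'rV[R]_n R := prodP (fun=> N01) n.

Lemma ge0_integral_gam n (f : 'rV[R]_n.+1 -> \bar R) :
  measurable_fun setT f -> (forall x, 0 <= f x)%E ->
  (\int[gam n.+1]_x f x = \int[N01]_z \int[gam n]_x f (consrV z x))%E.
Proof. by move=> mf f0; rewrite /gam ge0_integral_prodP. Qed.

Lemma gamS n (A : set 'rV[R]_n.+1) : measurable A ->
  gam n.+1 A = (\int[N01]_z gam n (consrV z @^-1` A))%E.
Proof. by move=> mA; rewrite /gam prodPS. Qed.

Lemma gam_coord0 n (B : set R) : measurable B ->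
  gam n.+1 [set x | B (x ord0 ord0)] = N01 B.
Proof. by move=> mB; rewrite /gam prodP_coord0. Qed.

Lemma gamE n : gam n = prodP (fun=> N01) n.
Proof. by []. Qed.

Opaque gam.

(** Rotation invariance of the Gaussian law, tested on one scalar product together with the length.
    In the induction the tail of [y] is first turned to a single axis; a rotation of the plane of
    the first two coordinates then merges the two components. No matrix of size [n] is involved. *)
Lemma gam_dot n (y : 'rV[R]_n.+1) (H : R * R -> \bar R) :
  measurable_fun setT H -> (forall z, 0 <= H z)%E ->
  (\int[gam n.+1]_x H (tdot 0 x y, tsq 0 x) =
   \int[gam n.+1]_x H (Num.sqrt (tsq 0 y) * x ord0 ord0, tsq 0 x)%R)%E.
Proof.
elim: n y H => [|n IH] y H mH H0.
- rewrite (consrV_surj y); move: (y ord0 ord0) (\row_i _) => {}y y'.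
  have tsq_nil (v : 'rV[R]_0) : tsq 0 v = 0 by exact: tsq_oversize.
  rewrite ge0_integral_gam; last 2 first.
    apply: measurableT_comp => //; apply: measurable_fun_pair => //=.
      exact: measurable_tdot.
    exact: measurable_tsq.
    by move=> ?; exact: H0.
  rewrite ge0_integral_gam; last 2 first.
    apply: measurableT_comp => //; apply: measurable_fun_pair => //=.
      apply: measurable_funM => //; exact: measurable_rV_coord.
    exact: measurable_tsq.
    by move=> ?; exact: H0.
  transitivity (\int[N01]_z H (y * z, z ^+ 2)%R)%E.
    apply: eq_integral => z _.
    rewrite (_ : (fun x => _) = cst (H (y * z, z ^+ 2))); last first.
      apply/funext => x; rewrite tdot0_cons tsq0_cons tsq_nil.
      by rewrite /tdot big_ord0 !addr0 mulrC.
    by rewrite integral_prob_cst.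
  rewrite normal_symmetric//; apply: eq_integral => z _.
  rewrite (_ : (fun x => _) = cst (H (`|y| * z, z ^+ 2))); last first.
    by apply/funext => x; rewrite !tsq0_cons !tsq_nil consrV0 !addr0 sqrtr_sqr.
  by rewrite integral_prob_cst.
- rewrite (consrV_surj y); move: (y ord0 ord0) (\row_i _) => {}y y'.
  rewrite ge0_integral_gam; last 2 first.
    apply: measurableT_comp => //; apply: measurable_fun_pair => //=.
      exact: measurable_tdot.
    exact: measurable_tsq.
    by move=> ?; exact: H0.
  rewrite ge0_integral_gam; last 2 first.
    apply: measurableT_comp => //; apply: measurable_fun_pair => //=.
      apply: measurable_funM => //; exact: measurable_rV_coord.
    exact: measurable_tsq.
    by move=> ?; exact: H0.
  (* The coordinates after the second enter through their squared norm only; [K] integrates them out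
     and leaves a function of the plane. *)
  pose K := fun p : R * R => (\int[gam n]_w H (p.1, (p.2 + tsq 0 w)%R))%E.
  have mK : measurable_fun setT K.
    pose F := fun q : (R * R) * 'rV[R]_n => H (q.1.1, q.1.2 + tsq 0 q.2).
    apply: (measurable_fun_fubini_tonelli_F (m2 := gam n) F); last by move=> ?; exact: H0.
    apply: measurableT_comp => //; apply: measurable_fun_pair => /=.
      exact: measurableT_comp.
    apply: measurable_funD; first exact: measurableT_comp.
    exact: measurable_tsq.
  have K0 p : (0 <= K p)%E by apply: integral_ge0 => w _; exact: H0.
  transitivity (\int[N01]_z1 \int[N01]_z2
      K (y * z1 + Num.sqrt (tsq 0 y') * z2, z1 ^+ 2 + z2 ^+ 2)%R)%E.
    apply: eq_integral => z1 _.
    pose H1 := fun p : R * R => H (y * z1 + p.1, z1 ^+ 2 + p.2).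
    have mH1 : measurable_fun setT H1.
      apply: measurableT_comp => //; apply: measurable_fun_pair => //=.
        exact: measurable_funD.
      exact: measurable_funD.
    transitivity (\int[gam n.+1]_x H1 (tdot 0 x y', tsq 0 x))%E.
      by apply: eq_integral => x _; rewrite /H1 /= tdot0_cons tsq0_cons (mulrC y).
    rewrite IH//; last by move=> p; exact: H0.
    rewrite ge0_integral_gam; last 2 first.
      apply: measurableT_comp => //; apply: measurable_fun_pair => //=.
        apply: measurable_funM => //; exact: measurable_rV_coord.
      exact: measurable_tsq.
      by move=> ?; exact: H0.
    apply: eq_integral => z2 _; apply: eq_integral => w _.
    by rewrite /H1 /= consrV0 tsq0_cons addrA.
  rewrite normal_rotation_norm//.
  apply: eq_integral => z1 _.
  rewrite ge0_integral_gam; last 2 first.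
    apply: measurableT_comp => //; apply: measurable_fun_pair => //=.
      under eq_fun do rewrite consrV0.
      exact: measurable_cst.
    by apply: measurable_tsq; apply: measurable_consrV.
    by move=> ?; exact: H0.
  apply: eq_integral => z2 _; apply: eq_integral => w _.
  by rewrite !tsq0_cons consrV0 sqr_sqrtr ?tsq_ge0// addrA.
Qed.

(** The difference [tsq k x - tsq k.+1 x] is the square of the coordinate of index [k]. The rotation
    above is applied to the last [n - k] coordinates while the first [k] are frozen. *)
Lemma gam_tdot n k (y : 'rV[R]_n) (H : R * R * R -> \bar R) : (k < n)%N ->
  measurable_fun setT H -> (forall z, 0 <= H z)%E ->
  (\int[gam n]_x H (tdot k x y ^+ 2, tsq k x, tsq 0 x)%R =
   \int[gam n]_x H (tsq k y * (tsq k x - tsq k.+1 x), tsq k x, tsq 0 x)%R)%E.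
Proof.
elim: k n y H => [|k IH] [|n]// y H kn mH H0.
- pose K := fun p : R * R => H (p.1 ^+ 2, p.2, p.2).
  have mK : measurable_fun setT K.
    apply: measurableT_comp => //; apply: measurable_fun_pair => //=.
    by apply: measurable_fun_pair => //=; apply: measurable_funX.
  have := @gam_dot n y K mK (fun=> H0 _); rewrite /K /= => ->.
  apply: eq_integral => x _; rewrite exprMn sqr_sqrtr ?tsq_ge0//.
  congr (H (_ * _, _, _)); rewrite [in RHS](consrV_surj x) tsq0_cons tsqS_cons.
  by rewrite addrK.
- have mL : measurable_fun setT (fun x : 'rV[R]_n.+1 => H (tdot k.+1 x y ^+ 2, tsq k.+1 x, tsq 0 x)).
    apply: measurableT_comp => //; apply: measurable_fun_pair => //=.
      apply: measurable_fun_pair => //=; last exact: measurable_tsq.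
      by apply: measurable_funX; exact: measurable_tdot.
    exact: measurable_tsq.
  have mr : measurable_fun setT (fun x : 'rV[R]_n.+1 => H (tsq k.+1 y * (tsq k.+1 x - tsq k.+2 x), tsq k.+1 x, tsq 0 x)).
    apply: measurableT_comp => //; apply: measurable_fun_pair => //=.
      apply: measurable_fun_pair => //=; last exact: measurable_tsq.
      apply: measurable_funM => //; apply: measurable_funB; exact: measurable_tsq.
    exact: measurable_tsq.
  rewrite (ge0_integral_gam mL (fun=> H0 _)) (ge0_integral_gam mr (fun=> H0 _)).
  apply: eq_integral => z _.
  rewrite (consrV_surj y); move: (y ord0 ord0) (\row_i _) => w y'.
  pose K := fun p : R * R * R => H (p.1.1, p.1.2, z ^+ 2 + p.2).
  have mK : measurable_fun setT K.
    apply: measurableT_comp => //; apply: measurable_fun_pair => //=.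
      by apply: measurable_fun_pair => //; apply: measurableT_comp.
    by apply: measurable_funD.
  transitivity (\int[gam n]_x K (tdot k x y' ^+ 2, tsq k x, tsq 0 x)%R)%E.
    by apply: eq_integral => x _; rewrite /K /= tdotS_cons tsqS_cons tsq0_cons.
  rewrite (IH n y' K kn mK (fun=> H0 _)).
  by apply: eq_integral => x _; rewrite /K /= !tsqS_cons tsq0_cons.
Qed.

Lemma normal_prob_set1 (a : R) : N01 [set a] = 0%E.
Proof.
have /null_content_dominatesP := normal_prob_dominates (0 : R) 1; apply => //.
exact: lebesgue_measure_set1.
Qed.

Lemma gam_tsq_eq0 n k : (k < n)%N -> gam n [set x | tsq k x = 0] = 0%E.
Proof.
have mtsq0 m j : measurable [set x : 'rV[R]_m | tsq j x = 0].
  by apply: (@measurable_preim _ _ _ _ (fun x => tsq j x) [set 0]) => //; exact: measurable_tsq.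
elim: k n => [|k IH] [|n]// kn.
- apply/eqP; rewrite eq_le measure_ge0 andbT.
  have m0 : measurable [set x : 'rV[R]_n.+1 | x ord0 ord0 = 0].
    apply: (@measurable_preim _ _ _ _ (fun x : 'rV[R]_n.+1 => x ord0 ord0) [set 0]) => //.
    exact: measurable_rV_coord.
  have sub : [set x : 'rV[R]_n.+1 | tsq 0 x = 0] `<=` [set x | x ord0 ord0 = 0].
    move=> x /=; rewrite (consrV_surj x) tsq0_cons consrV0 => /eqP.
    by rewrite paddr_eq0 ?sqr_ge0 ?tsq_ge0// sqrf_eq0 => /andP[/eqP + _].
  apply: (le_trans (le_prob (gam n.+1) (mtsq0 _ _) m0 sub)).
  have := @gam_coord0 n [set 0] (measurable_set1 _).
  by move=> e; rewrite -[leRHS](normal_prob_set1 0) -[leRHS]e.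
- rewrite gamS// -[RHS](integral0 N01 setT).
  apply: eq_integral => z _; rewrite -[RHS](IH n kn); congr (gam n _).
  by apply/funext => x /=; rewrite tsqS_cons.
Qed.

End gaussian.

(** * Rotation invariant laws *)

Section orthogonal.
Context {R : realType}.

Definition orthogonal_family n (W : seq 'rV[R]_n) : bool :=
  pairwise (fun u v => dotv u v == 0) W && all (fun w => sqnorm w != 0) W.

(** For an orthogonal family [W] this is the squared distance from [x] to the span of [W], that is
    the squared length of the next Gram-Schmidt vector. *)
Definition resid n (W : seq 'rV[R]_n) (x : 'rV[R]_n) : R :=
  sqnorm x - \sum_(w <- W) dotv x w ^+ 2 / sqnorm w.

Lemma dotvE n (x y : 'rV[R]_n) : x *m y^T = (dotv x y)%:M.
Proof.
rewrite [LHS]mx11_scalar; congr (_%:M); rewrite mxE.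
by apply: eq_bigr => i _; rewrite mxE.
Qed.

Lemma dotvC n (x y : 'rV[R]_n) : dotv x y = dotv y x.
Proof. by apply: eq_bigr => i _; rewrite mulrC. Qed.

Lemma dotvZl n a (x y : 'rV[R]_n) : dotv (a *: x) y = a * dotv x y.
Proof. by rewrite /dotv mulr_sumr; apply: eq_bigr => i _; rewrite mxE mulrA. Qed.

Lemma dotvZr n a (x y : 'rV[R]_n) : dotv x (a *: y) = a * dotv x y.
Proof. by rewrite dotvC dotvZl dotvC. Qed.

Lemma dotvDl n (x y z : 'rV[R]_n) : dotv (x + y) z = dotv x z + dotv y z.
Proof. by rewrite /dotv -big_split; apply: eq_bigr => i _; rewrite mxE mulrDl. Qed.

Lemma dotvNl n (x y : 'rV[R]_n) : dotv (- x) y = - dotv x y.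
Proof. by rewrite -scaleN1r dotvZl mulN1r. Qed.

Lemma dotvBl n (x y z : 'rV[R]_n) : dotv (x - y) z = dotv x z - dotv y z.
Proof. by rewrite dotvDl dotvNl. Qed.

Lemma dotv_suml n (I : Type) (r : seq I) (F : I -> 'rV[R]_n) z :
  dotv (\sum_(i <- r) F i) z = \sum_(i <- r) dotv (F i) z.
Proof.
elim: r => [|i r IH]; last by rewrite !big_cons dotvDl IH.
by rewrite !big_nil /dotv big1// => i _; rewrite mxE mul0r.
Qed.

Lemma sqnorm_ge0 n (x : 'rV[R]_n) : 0 <= sqnorm x.
Proof. exact: (tsq_ge0 0 x). Qed.

Lemma sqnorm_eq0 n (x : 'rV[R]_n) : (sqnorm x == 0) = (x == 0).
Proof.
apply/idP/eqP => [|->]; last by rewrite /sqnorm /dotv big1// => i _; rewrite mxE mul0r.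
rewrite psumr_eq0 => [/allP x0|i _]; last by rewrite -expr2 sqr_ge0.
apply/rowP => i; rewrite mxE; apply/eqP; rewrite -sqrf_eq0 expr2.
by apply: x0; rewrite mem_index_enum.
Qed.

Lemma sqnorm_mulmx n (Q : 'M[R]_n) (x : 'rV[R]_n) : Q *m Q^T = 1%:M ->
  sqnorm (x *m Q) = sqnorm x.
Proof.
move=> QQ; have := dotvE (x *m Q) (x *m Q).
rewrite trmx_mul mulmxA -(mulmxA x) QQ mulmx1 dotvE => /matrixP /(_ ord0 ord0).
by rewrite !mxE eqxx !mulr1n.
Qed.

Lemma orthogonal_rcons n (W : seq 'rV[R]_n) v :
  orthogonal_family (rcons W v) =
  [&& orthogonal_family W, all (fun u => dotv u v == 0) W & sqnorm v != 0].
Proof.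
rewrite /orthogonal_family pairwise_rcons all_rcons.
case: (pairwise _ W) (all _ W) (all _ W) (_ != 0) => [] [] [] [] //.
Qed.

(** The matrix with rows [W] has rank less than [n], so some nonzero vector is orthogonal to all its
    rows. *)
Lemma orthogonal_extend1 n (W : seq 'rV[R]_n) : (size W < n)%N ->
  orthogonal_family W -> exists v, orthogonal_family (rcons W v).
Proof.
move=> Wn oW.
pose A : 'M[R]_(size W, n) := \matrix_(i < size W) W`_i.
have : kermx A^T != 0.
  rewrite kermx_eq0 /row_free neq_ltn; apply/orP; left.
  by rewrite mxrank_tr (leq_ltn_trans (rank_leq_row _)).
move=> /rowV0Pn[v /sub_kermxP vA v0].
exists v; rewrite orthogonal_rcons oW sqnorm_eq0 v0 andbT /=.
apply/(all_nthP 0) => i iW.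
have /rowP/(_ (Ordinal iW)) := vA; rewrite !mxE => e.
apply/eqP; rewrite dotvC -[RHS]e; apply: eq_bigr => j _.
by rewrite !mxE.
Qed.

Lemma orthogonal_extend n (W : seq 'rV[R]_n) : (size W <= n)%N ->
  orthogonal_family W ->
  exists W', size W' = n /\ orthogonal_family W' /\ take (size W) W' = W.
Proof.
move Em : (n - size W)%N => m; elim: m W Em => [|m IH] W Em Wn oW.
  exists W; split; last by rewrite take_size.
  by apply/eqP; rewrite eqn_leq Wn -subn_eq0 Em.
have Wn' : (size W < n)%N by rewrite -subn_gt0 Em.
have [v ov] := orthogonal_extend1 Wn' oW.
have [||W' [sW' [oW' tW']]] := IH (rcons W v) _ _ ov.
- by rewrite size_rcons subnS Em.
- by rewrite size_rcons.
exists W'; split=> //; split=> //.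
move: tW'; rewrite size_rcons => /(congr1 (take (size W))).
by rewrite -take_min (minn_idPl _)// -cats1 take_size_cat.
Qed.

(** The columns of [Q] are, up to sign, the normalized vectors of an orthogonal basis that extends
    [W]. *)
Lemma orthogonal_frame n (W : seq 'rV[R]_n) : (size W <= n)%N ->
  orthogonal_family W ->
  exists Q : 'M[R]_n, [/\ Q *m Q^T = 1%:M, (size W < n)%N -> \det Q = 1 &
    forall (x : 'rV[R]_n) (i : 'I_n), (i < size W)%N ->
      (x *m Q) ord0 i ^+ 2 = dotv x W`_i ^+ 2 / sqnorm W`_i].
Proof.
move=> Wn oW; have [W' [sW' [oW' tW']]] := orthogonal_extend Wn oW.
have /andP[pW' /allP nzW'] := oW'.
pose u (i : 'I_n) := (Num.sqrt (sqnorm W'`_i))^-1 *: W'`_i.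
have Winz (i : 'I_n) : sqnorm W'`_i != 0 by apply: nzW'; rewrite mem_nth// sW'.
have uu i j : dotv (u i) (u j) = (i == j)%:R.
  rewrite /u dotvZl dotvZr; have [<-|ij] := eqVneq i j.
    rewrite mulrA -invfM -expr2 sqr_sqrtr ?sqnorm_ge0//.
    by rewrite -[dotv _ _]/(sqnorm _) mulVf.
  suff -> : dotv W'`_i W'`_j = 0 by rewrite !mulr0.
  have H (a b : 'I_n) : (a < b)%N -> dotv W'`_a W'`_b = 0.
    by move=> ab; apply/eqP; apply: (pairwiseP 0 pW'); rewrite ?inE ?sW'.
  by have [/H//|/H|/val_inj e] := ltngtP i j; [rewrite dotvC|rewrite e eqxx in ij].
pose M : 'M[R]_n := \matrix_(i < n) u i.
have MM : M *m M^T = 1%:M.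
  apply/matrixP => i j; rewrite !mxE -uu; apply: eq_bigr => k _.
  by rewrite !mxE.
have dM : \det M ^+ 2 = 1 by rewrite expr2 -[X in _ * X]det_tr -det_mulmx MM det1.
(* The last vector is reversed when the determinant is -1; the squared coordinates of the conclusion
   do not see the sign. *)
pose D : 'rV[R]_n := \row_i (if (i == n.-1 :> nat) && (\det M == -1) then -1 else 1).
pose M' := diag_mx D *m M.
have DD : diag_mx D *m diag_mx D = 1%:M.
  rewrite mulmx_diag; apply/matrixP => i j; rewrite !mxE.
  by case: ifP => _; rewrite ?mulrNN ?mulr1.
have MM' : M' *m M'^T = 1%:M.
  rewrite /M' trmx_mul tr_diag_mx -mulmxA (mulmxA M) MM mul1mx.
  exact: DD.
exists M'^T; split.
- by rewrite trmxK; apply: mulmx1C.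
- move=> Wn'; rewrite det_tr /M' det_mulmx det_diag.
  have n0 : (0 < n)%N by apply: leq_ltn_trans Wn'.
  have n1 : (n.-1 < n)%N by rewrite prednK.
  rewrite (bigD1 (Ordinal n1))//= big1 ?mulr1 => [|i]; last first.
    by rewrite mxE -val_eqE /= => /negbTE ->.
  rewrite mxE eqxx /=; move/eqP: dM; rewrite sqrf_eq1 => /orP[|] /eqP ->.
    by case: ifP => [/eqP|]; rewrite ?mulr1// => /eqP; rewrite -addr_eq0 (_ : 1 + 1 = 2%:R)// pnatr_eq0.
  by rewrite eqxx mulrNN mulr1.
- move=> x i iW.
  have -> : (x *m M'^T) ord0 i = D ord0 i * dotv x (u i).
    rewrite /M' mul_diag_mx !mxE mulr_sumr; apply: eq_bigr => j _; rewrite !mxE.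
    by rewrite mulrCA.
  rewrite exprMn (_ : D ord0 i ^+ 2 = 1) ?mul1r; last first.
    by rewrite mxE; case: ifP => _; rewrite ?sqrrN expr1n.
  have WE : W`_i = W'`_i by rewrite -tW' nth_take.
  rewrite /u dotvZr exprMn exprVn sqr_sqrtr ?sqnorm_ge0// WE.
  by rewrite mulrC.
Qed.

(** Pythagoras: once the directions of [W] are the first axes, the coordinates of index at least
    [size W] carry the component orthogonal to [W]. *)
Lemma orthogonal_rotation n (W : seq 'rV[R]_n) : (size W <= n)%N ->
  orthogonal_family W ->
  exists Q : 'M[R]_n, [/\ (size W < n)%N -> rotation Q,
    forall x : 'rV[R]_n, tsq (size W) (x *m Q) = resid W x &
    forall x : 'rV[R]_n, tsq 0 (x *m Q) = tsq 0 x].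
Proof.
move=> Wn oW; have [Q [QQ dQ HQ]] := orthogonal_frame Wn oW.
exists Q; split => [Wn'|x|x]; last by rewrite !tsq0 sqnorm_mulmx.
  by split=> //; exact: dQ.
rewrite /resid -(sqnorm_mulmx _ QQ).
rewrite [sqnorm (x *m Q)](bigID (fun i : 'I_n => (size W <= i)%N))/=.
apply/eqP; rewrite eq_sym subr_eq; apply/eqP; congr (_ + _).
rewrite (big_nth 0) big_mkord.
rewrite (big_ord_widen_cond n xpredT (fun i => dotv x W`_i ^+ 2 / sqnorm W`_i))//.
rewrite (eq_bigl (fun i : 'I_n => (i < size W)%N)); last by move=> i; rewrite ltnNge.
by apply: eq_bigr => i iW; rewrite -expr2 HQ.
Qed.

End orthogonal.

(** * Joint law of a tail and of the whole length under a rotation invariant law *)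

Section tail_invariant.
Context {R : realType}.

Definition rotation_invariant n (nu : probability 'rV[R]_n R) :=
  forall (Q : 'M[R]_n) (A : set 'rV[R]_n), rotation Q -> measurable A ->
    nu ((fun x : 'rV[R]_n => x *m Q) @^-1` A) = nu A.

Lemma measurable_mulmxr n (Q : 'M[R]_n) :
  measurable_fun setT (fun x : 'rV[R]_n => x *m Q).
Proof.
apply: measurable_fun_rV => i.
rewrite (_ : (fun t => _) = fun t : 'rV[R]_n => \sum_j t ord0 j * Q j i); last first.
  by apply/funext => t; rewrite mxE.
apply: measurable_sum => j; apply: measurable_funM => //.
exact: measurable_rV_coord.
Qed.

Lemma ge0_integral_rotation n (nu : probability 'rV[R]_n R) Q (f : 'rV[R]_n -> \bar R) :
  rotation_invariant nu -> rotation Q ->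
  measurable_fun setT f -> (forall x, 0 <= f x)%E ->
  (\int[nu]_x f (x *m Q) = \int[nu]_x f x)%E.
Proof.
move=> inu rQ mf f0; symmetry.
rewrite (eq_measure_integral (pushforward nu (fun x : 'rV[R]_n => x *m Q))); last first.
- by move=> ? A mA _; exact/esym/(inu Q).
- by move=> mQ; rewrite ge0_integral_pushforward.
- exact: measurable_mulmxr.
Qed.

Lemma measurable_resid d (T : measurableType d) n (W : seq 'rV[R]_n) (f : T -> 'rV[R]_n) :
  measurable_fun setT f -> measurable_fun setT (fun t => resid W (f t)).
Proof.
move=> mf; apply: measurable_funB; first exact: measurable_sqnorm.
apply: measurable_sum => w; apply: measurable_funM => //.
by apply: measurable_funX; exact: measurable_dotv.
Qed.

Lemma integral_resid n (nu : probability 'rV[R]_n R) W (H : R * R -> \bar R) :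
  rotation_invariant nu -> (size W <= n)%N -> orthogonal_family W ->
  measurable_fun setT H -> (forall x, 0 <= H x)%E ->
  (\int[nu]_x H (resid W x, tsq 0 x) = \int[nu]_x H (tsq (size W) x, tsq 0 x))%E.
Proof.
move=> inu Wn oW mH H0; have [Q [rQ Q1 Q2]] := orthogonal_rotation Wn oW.
pose f := fun x : 'rV[R]_n => H (tsq (size W) x, tsq 0 x).
have mf : measurable_fun setT f.
  apply: measurableT_comp => //; apply: measurable_fun_pair => //=; exact: measurable_tsq.
transitivity (\int[nu]_x f (x *m Q))%E.
  by apply: eq_integral => x _; rewrite /f Q1 Q2.
(* When [W] is a full basis, [Q] may fail to be a rotation, but [tsq n] vanishes identically. *)
have [Wn'|Wn'] := ltnP (size W) n.
  by rewrite ge0_integral_rotation//; [exact: rQ|move=> x; exact: H0].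
by apply: eq_integral => x _; rewrite /f Q2 !(tsq_oversize _ Wn').
Qed.

(* Both the Gaussian law and the rotation invariant laws have this property, and
   it determines the joint law of (tsq k, tsq 0) from that of tsq 0. *)
Definition tail_invariant n (mu : probability 'rV[R]_n R) :=
  forall k (y : 'rV[R]_n) (H : R * R -> \bar R), (k < n)%N -> tsq k y != 0 ->
    measurable_fun setT H -> (forall x, 0 <= H x)%E ->
    (\int[mu]_x H (tsq k x - tdot k x y ^+ 2 / tsq k y, tsq 0 x)%R =
     \int[mu]_x H (tsq k.+1 x, tsq 0 x))%E.

Lemma tail_invariant_gam n : tail_invariant (gam n : probability 'rV[R]_n R).
Proof.
move=> k y H kn y0 mH H0.
pose K := fun p : R * R * R => H (p.1.2 - p.1.1 / tsq k y, p.2).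
have mK : measurable_fun setT K.
  apply: measurableT_comp => //; apply: measurable_fun_pair => //=.
  apply: measurable_funB; first exact: measurableT_comp.
  by apply: measurable_funM => //; exact: measurableT_comp.
have := @gam_tdot R n k y K kn mK (fun=> H0 _); rewrite /K /= => ->.
by apply: eq_integral => x _; rewrite mulrAC divff// mul1r opprB addrC subrK.
Qed.

(** The first [k] axes, followed by [y] with its first [k] coordinates set to 0, form an orthogonal
    family of size [k.+1]; the squared distance to its span is the first argument of [H] on the
    left-hand side. *)
Lemma tail_invariant_rotation n (nu : probability 'rV[R]_n R) : rotation_invariant nu -> tail_invariant nu.
Proof.
move=> inu k y H kn y0 mH H0.
pose e (i : 'I_k) : 'rV[R]_n := delta_mx ord0 (widen_ord (ltnW kn) i).
pose m : 'rV[R]_n := \row_i (if (k <= i)%N then y ord0 i else 0).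
pose W := rcons [seq e i | i <- enum 'I_k] m.
have sW : size W = k.+1 by rewrite size_rcons size_map size_enum_ord.
have dm x : dotv x m = tdot k x y.
  rewrite /tdot big_mkcond; apply: eq_bigr => i _.
  by rewrite mxE; case: ifP => // _; rewrite mulr0.
have sm : sqnorm m = tsq k y.
  rewrite /sqnorm dm /tsq /tdot; apply: eq_bigr => i ki.
  by rewrite mxE ki.
have de x i : dotv x (e i) = x ord0 (widen_ord (ltnW kn) i).
  rewrite /dotv (bigD1 (widen_ord (ltnW kn) i))//= mxE !eqxx mulr1 big1 ?addr0// => j ji.
  by rewrite mxE (negbTE ji) andbF mulr0.
have se i : sqnorm (e i) = 1 by rewrite /sqnorm de mxE !eqxx.
have oW : orthogonal_family W.
  rewrite orthogonal_rcons sm y0 andbT; apply/andP; split.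
    apply/andP; split; last by apply/allP => _ /mapP[i _ ->]; rewrite se oner_eq0.
    rewrite pairwise_map; have := enum_uniq 'I_k; rewrite uniq_pairwise.
    apply: sub_pairwise => i j /= ij; rewrite de mxE eqxx /=.
    rewrite (_ : (_ == widen_ord _ _) = false)//.
    by rewrite -val_eqE /= eq_sym val_eqE; exact: negbTE.
  apply/allP => _ /mapP[i _ ->]; rewrite dotvC de mxE /=.
  by rewrite leqNgt ltn_ord.
rewrite -[in RHS]sW -(integral_resid inu _ oW mH H0) ?sW//.
apply: eq_integral => x _; congr (H (_, _)).
rewrite /resid /W big_rcons /= dm sm big_map big_enum /=.
rewrite [X in _ = _ - (X + _)](eq_bigr (fun i : 'I_k => x ord0 (widen_ord (ltnW kn) i) ^+ 2)); last first.
  by move=> i _; rewrite de se divr1.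
rewrite opprD addrA; congr (_ - _).
rewrite /sqnorm /dotv (bigID (fun i : 'I_n => (k <= i)%N))/=.
rewrite -[LHS]addr0 -addrA; congr (_ + _).
apply/esym/eqP; rewrite subr_eq0; apply/eqP.
rewrite (eq_bigl (fun i : 'I_n => (i < k)%N)); last by move=> i; rewrite ltnNge.
rewrite (big_ord_narrow (ltnW kn)).
by apply: eq_bigr => i _; rewrite expr2.
Qed.

(** Here [kap] plays the law of [tsq k / tsq 0], independent of [tsq 0]. It is chosen before [mu]
    and depends on [n] and [k] only, so that the Gaussian law and the spherical one share it. Each
    step of the induction multiplies it by an independent factor [r y], with [y] Gaussian. *)
Lemma tail_invariant_chain n k : (k <= n)%N ->
  exists kap : probability (measurableTypeR R) R,
  forall mu : probability 'rV[R]_n R, tail_invariant mu -> forall H : R * R -> \bar R,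
    measurable_fun setT H -> (forall x, 0 <= H x)%E ->
    (\int[mu]_x H (tsq k x, tsq 0 x) =
     \int[mu]_x \int[kap]_t H (t * tsq 0 x, tsq 0 x)%R)%E.
Proof.
elim: k => [_|k IH kn].
  exists (\d_ (1 : measurableTypeR R)) => mu smu H mH H0; apply: eq_integral => x _.
  rewrite integral_dirac// ?diracT ?mul1e ?mul1r//.
  apply: measurableT_comp => //; apply: measurable_fun_pair => //=.
  exact: measurable_funM.
have [kap Hkap] := IH (ltnW kn).
(* This is [tsq k.+1 y / tsq k y] when [tsq k y] is nonzero, written in the form that [gam_tdot]
   will produce. *)
pose r (y : 'rV[R]_n) : R := 1 - (tsq k y - tsq k.+1 y) / tsq k y.
have mr : measurable_fun setT r.
  apply: measurable_funB => //; apply: measurable_fun_div; last exact: measurable_tsq.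
  by apply: measurable_funB; exact: measurable_tsq.
pose h := fun p : measurableTypeR R * 'rV[R]_n => p.1 * r p.2 : measurableTypeR R.
have mh : measurable_fun setT h.
  by apply: measurable_funM => //; exact: measurableT_comp.
pose hm := mfun_Sub (mem_set mh : h \in mfun).
exists (distribution (kap \x gam n)%E hm) => mu smu H mH H0.
have mT (j : nat) : measurable_fun setT (@tsq R n j) by exact: measurable_tsq.
pose K0 := fun p : 'rV[R]_n * 'rV[R]_n =>
  H (tsq k p.1 - tdot k p.1 p.2 ^+ 2 / tsq k p.2, tsq 0 p.1).
have mK0 : measurable_fun setT K0.
  apply: measurableT_comp => //; apply: measurable_fun_pair => /=.
    apply: measurable_funB; first exact: measurableT_comp.
    apply: measurable_fun_div; last exact: measurableT_comp.
    by apply: measurable_funX; exact: measurable_tdot.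
  exact: measurableT_comp.
pose K1 := fun p : 'rV[R]_n * 'rV[R]_n => H (tsq k p.1 * r p.2, tsq 0 p.1).
have mK1 : measurable_fun setT K1.
  apply: measurableT_comp => //; apply: measurable_fun_pair => /=.
    by apply: measurable_funM; exact: measurableT_comp.
  exact: measurableT_comp.
pose K2 := fun p : ('rV[R]_n * 'rV[R]_n) * R => H (p.2 * tsq 0 p.1.1 * r p.1.2, tsq 0 p.1.1).
have mK2 : measurable_fun setT K2.
  apply: measurableT_comp => //; apply: measurable_fun_pair => /=.
    apply: measurable_funM.
      apply: measurable_funM => //; apply: measurableT_comp => //.
      exact: measurableT_comp.
    apply: measurableT_comp => //; exact: measurableT_comp.
  by apply: measurableT_comp => //; exact: measurableT_comp.
pose K3 := fun p => (\int[kap]_t K2 (p, t))%E.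
have mK3 : measurable_fun setT K3.
  by apply: (measurable_fun_fubini_tonelli_F (m2 := kap) K2) => // ?; exact: H0.
(* The identity of [tail_invariant] holds for each [y] with [tsq k y != 0], hence also on average
   over a Gaussian [y], the excluded vectors forming a null set. *)
transitivity (\int[gam n]_y \int[mu]_x K0 (x, y))%E.
  rewrite -[LHS](integral_prob_cst (gam n)).
  apply: (eq_integral_null (N := [set y | tsq k y = 0])) => //.
  - exact: (@measurable_preim _ _ _ _ (tsq k) [set 0]).
  - exact: gam_tsq_eq0.
  - by apply: (measurable_fun_fubini_tonelli_G (m1 := mu) K0) => // ?; exact: H0.
  - by move=> y /eqP y0; rewrite /K0 /= smu.
(* The roles are exchanged: for fixed [x] the Gaussian [y] is rotated, and [tdot k x y ^+ 2] becomes
   [tsq k x] times the square of a coordinate of [y]. From here on [x] enters through [tsq k x] and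
   [tsq 0 x] only. *)
transitivity (\int[mu]_x \int[gam n]_y K1 (x, y))%E.
  rewrite -(@fubini_tonelli _ _ _ _ R mu (gam n) K0 mK0 (fun=> H0 _)).
  apply: eq_integral => x _.
  pose L := fun p : R * R * R => H (tsq k x - p.1.1 / p.1.2, tsq 0 x).
  have mL : measurable_fun setT L.
    apply: measurableT_comp => //; apply: measurable_fun_pair => //=.
    apply: measurable_funB => //.
    by apply: measurable_fun_div; exact: measurableT_comp.
  have := @gam_tdot R n k x L kn mL (fun=> H0 _); rewrite /L /= => e.
  transitivity (\int[gam n]_y L (tdot k y x ^+ 2, tsq k y, tsq 0 y)%R)%E.
    apply: eq_integral => y _; rewrite /K0 /L /=; congr (H (_ - _ ^+ 2 / _, _)).
    by apply: eq_bigr => i _; rewrite mulrC.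
  rewrite e; apply: eq_integral => y _; rewrite /K1 /r /=.
  by congr (H (_, _)); ring.
rewrite (fubini_tonelli (m1 := mu) (m2 := gam n) K1)//; last by move=> ?; exact: H0.
(* For fixed [y] the induction hypothesis applies to [mu]. *)
transitivity (\int[gam n]_y \int[mu]_x K3 (x, y))%E.
  apply: eq_integral => y _.
  pose L := fun p : R * R => H (p.1 * r y, p.2).
  have mL : measurable_fun setT L.
    apply: measurableT_comp => //; apply: measurable_fun_pair => //=.
    by apply: measurable_funM.
  by rewrite (Hkap mu smu L mL (fun=> H0 _)).
rewrite -(fubini_tonelli (m1 := mu) (m2 := gam n) K3)//; last first.
  by move=> p; apply: integral_ge0 => t _; exact: H0.
apply: eq_integral => x _.
pose L := fun t : R => H (t * tsq 0 x, tsq 0 x).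
have mL : measurable_fun setT L.
  apply: measurableT_comp => //; apply: measurable_fun_pair => //=.
  exact: measurable_funM.
pose L2 := fun p : R * 'rV[R]_n => L (h p).
have mL2 : measurable_fun setT L2 by exact: measurableT_comp.
transitivity (\int[kap]_t \int[gam n]_y L2 (t, y))%E.
  rewrite (fubini_tonelli (m1 := kap) (m2 := gam n) L2)//; last by move=> ?; exact: H0.
  apply: eq_integral => y _; apply: eq_integral => t _.
  by rewrite /K2 /L2 /L /h /=; congr (H (_, _)); ring.
rewrite (ge0_integral_distribution hm mL)//; last by move=> ?; exact: H0.
by rewrite fubini_tonelli1//; move=> ?; exact: H0.
Qed.

(** The polar form. The unknown [kap] is eliminated by applying the previous lemma to the Gaussian
    law as well as to [mu]. *)
Lemma tail_invariant_law n k (mu : probability 'rV[R]_n R) (H : R * R -> \bar R) :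
  tail_invariant mu -> (k <= n)%N -> (0 < n)%N ->
  measurable_fun setT H -> (forall x, 0 <= H x)%E ->
  (\int[mu]_x H (tsq k x, tsq 0 x) =
   \int[mu]_x \int[gam n]_y H (tsq 0 x * (tsq k y / tsq 0 y), tsq 0 x)%R)%E.
Proof.
move=> smu kn n0 mH H0; have [kap Hkap] := tail_invariant_chain kn.
rewrite (Hkap mu smu H mH H0); apply: eq_integral => x _; set a := tsq 0 x.
pose K := fun p : R * R => H (a * (p.1 / p.2), a).
have mK : measurable_fun setT K.
  apply: measurableT_comp => //; apply: measurable_fun_pair => //=.
  by apply: measurable_funM => //; exact: measurable_fun_div.
rewrite [RHS](Hkap (gam n) (@tail_invariant_gam n) K mK (fun=> H0 _)).
rewrite -[LHS](integral_prob_cst (gam n)).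
pose L := fun p : 'rV[R]_n * R => K (p.2 * tsq 0 p.1, tsq 0 p.1).
have mL : measurable_fun setT L.
  have mT : measurable_fun setT (@tsq R n 0) by exact: measurable_tsq.
  apply: measurableT_comp => //; apply: measurable_fun_pair => /=.
    by apply: measurable_funM => //; exact: measurableT_comp.
  exact: measurableT_comp.
apply: (eq_integral_null (N := [set y | tsq 0 y = 0])) => //.
- by apply: (@measurable_preim _ _ _ _ (tsq 0) [set 0]) => //; exact: measurable_tsq.
- exact: gam_tsq_eq0.
- by apply: (measurable_fun_fubini_tonelli_F (m2 := kap) L) => // ?; exact: H0.
- move=> y /eqP y0; apply: eq_integral => t _; rewrite /K /=.
  by congr (H (_, _)); rewrite mulfK// mulrC.
Qed.

End tail_invariant.

(** * Chi-square laws *)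

Section chi_square.
Context {R : realType}.
Notation leb := (@lebesgue_measure R).
Notation N01 := (@normal_prob R 0 1).

Lemma gam_tsq n k (A : set R) : (k <= n)%N -> measurable A ->
  gam n [set x | A (tsq k x)] = gam (n - k) [set x | A (tsq 0 x)].
Proof.
have mt m j (B : set R) : measurable B -> measurable [set x : 'rV[R]_m | B (tsq j x)].
  by move=> mB; apply: measurable_preim => //; exact: measurable_tsq.
elim: k n => [|k IH] [|n]// kn mA.
rewrite gamS ?subSS; last exact: mt.
rewrite -IH// -[RHS](integral_prob_cst N01).
apply: eq_integral => z _; congr (gam n _).
by apply/funext => x /=; rewrite tsqS_cons.
Qed.

Definition sqn n (x : 'rV[R]_n) : measurableTypeR R := tsq 0 x.

Lemma measurable_sqn n : measurable_fun setT (@sqn n).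
Proof. exact: measurable_tsq. Qed.

HB.instance Definition _ n := isMeasurableFun.Build _ _ _ _ (@sqn n) (@measurable_sqn n).

(** The chi-square law with [n] degrees of freedom, handled without its density: tails, absence of
    atoms and positivity all come from the Gaussian vector. *)
Definition chi n : probability (measurableTypeR R) R := distribution (gam n) (@sqn n).

Lemma chiE n (A : set R) : chi n A = gam n [set x | A (tsq 0 x)].
Proof. by []. Qed.

Lemma normal_prob_sqr (b : R) : N01 [set z | z ^+ 2 = b] = 0%E.
Proof.
apply/eqP; rewrite eq_le measure_ge0 andbT.
have sub : [set z : R | z ^+ 2 = b] `<=` [set Num.sqrt b] `|` [set - Num.sqrt b].
  move=> z /= <-; rewrite sqrtr_sqr.
  by have [z0|z0] := lerP 0 z; [left; rewrite ger0_norm|right; rewrite ltr0_norm ?opprK].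
apply: (le_trans (le_prob N01 _ _ sub)).
- by apply: (@measurable_preim _ _ _ _ (fun z : R => z ^+ 2) [set b]) => //; exact: exprn_measurable.
- by apply: measurableU; exact: measurable_set1.
- apply: (le_trans (measureU2 _ _ _)); try exact: measurable_set1.
  rewrite -[leRHS]adde0; apply: leeD; rewrite le_eqVlt; apply/orP; left;
  by apply/eqP; exact: normal_prob_set1.
Qed.

(** Given the other coordinates, the square of the first one is prescribed, which leaves it at most
    two values. *)
Lemma chi_set1 n (a : R) : (0 < n)%N -> chi n [set a] = 0%E.
Proof.
case: n => // n _; rewrite chiE gamE prodP_swap; last first.
  by apply: (@measurable_preim _ _ _ _ (tsq 0) [set a]) => //; exact: measurable_tsq.
rewrite -[RHS](integral0 (prodP (fun=> N01) n) setT); apply: eq_integral => x _.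
rewrite -[RHS](normal_prob_sqr (a - tsq 0 x)); congr (N01 _).
apply/funext => z /=; rewrite tsq0_cons; apply/propext; split => [<-|->].
  by rewrite addrK.
by rewrite subrK.
Qed.

Lemma chi_ge0 n : chi n [set x | 0 <= x] = 1%E.
Proof.
rewrite chiE (_ : [set x | _] = setT) ?probability_setT//.
by apply/seteqP; split => // x _ /=; exact: tsq_ge0.
Qed.

(** Multiplied by the standard density, the integrand is [s] times the centred normal density of
    standard deviation [s], the inverse of the square root of [1 + u]. *)
Lemma normal_mgf (u : R) : -1 < u ->
  (\int[N01]_z (expR (- (u / 2) * z ^+ 2))%:E = ((Num.sqrt (1 + u))^-1)%:E)%E.
Proof.
move=> u1; have u0 : 0 < 1 + u by lra.
have s0 : Num.sqrt (1 + u) != 0 by rewrite gt_eqF// sqrtr_gt0.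
set s := (Num.sqrt (1 + u))^-1.
have sn0 : s != 0 by rewrite invr_eq0.
have s2 : s ^+ 2 = (1 + u)^-1 by rewrite exprVn sqr_sqrtr// ltW.
rewrite integral_normal_prob; last 2 first.
- apply/measurable_EFinP; apply: measurableT_comp => //.
  apply: measurable_funM => //; exact: exprn_measurable.
- by move=> z; rewrite lee_fin expR_ge0.
transitivity (\int[leb]_z (s%:E * (normal_pdf 0 s z)%:E))%E; last first.
  rewrite ge0_integralZl//.
  - by rewrite integral_normal_pdf mule1.
  - by apply/measurable_EFinP; exact: measurable_normal_pdf.
  - by move=> z _; rewrite lee_fin normal_pdf_ge0.
  - by rewrite lee_fin invr_ge0 sqrtr_ge0.
apply: eq_integral => z _; rewrite -!EFinM; congr EFin.
rewrite !normal_pdfE ?oner_eq0//= /normal_fun !subr0.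
have -> : normal_peak s = s^-1 * normal_peak 1.
  rewrite /normal_peak s2 expr1n mul1r -mulrnAr sqrtrM ?invr_ge0 ?ltW// invfM.
  by rewrite sqrtrV ?ltW// /s.
rewrite -(mulrA s^-1) mulVKf// mulrCA; congr (_ * _).
rewrite -expRD; congr expR; rewrite s2 expr1n; field.
by rewrite gt_eqF//; lra.
Qed.

Lemma gam_mgf n (u : R) : -1 < u ->
  (\int[gam n]_x (expR (- (u / 2) * tsq 0 x))%:E = ((Num.sqrt (1 + u))^-1 ^+ n)%:E)%E.
Proof.
move=> u1; elim: n => [|n IH].
  rewrite expr0 -[RHS](integral_prob_cst (gam 0)).
  by apply: eq_integral => x _; rewrite tsq_oversize// mulr0 expR0.
have mE m : measurable_fun setT (fun x : 'rV[R]_m => (expR (- (u / 2) * tsq 0 x))%:E).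
  apply/measurable_EFinP; apply: measurableT_comp => //.
  by apply: measurable_funM => //; exact: measurable_tsq.
rewrite ge0_integral_gam//.
transitivity (\int[N01]_z ((expR (- (u / 2) * z ^+ 2))%:E *
   ((Num.sqrt (1 + u))^-1 ^+ n)%:E))%E.
  apply: eq_integral => z _; rewrite -IH -ge0_integralZl//; last exact: mE.
  by apply: eq_integral => x _; rewrite tsq0_cons mulrDr expRD EFinM.
rewrite ge0_integralZr//.
- by rewrite normal_mgf// -EFinM exprS.
- apply/measurable_EFinP; apply: measurableT_comp => //.
  by apply: measurable_funM => //; exact: exprn_measurable.
Qed.

(** Both tails at once: the sign of [u] decides on which side of [c * n] the squared norm lies. The
    indicator of the event is bounded by the exponential of half the quantity required to be
    nonnegative. *)
Lemma gam_chernoff n (u c : R) : -1 < u ->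
  (gam n [set x | (0 <= u * (c * n%:R - tsq 0 x))%R]
   <= ((expR (u * c / 2) / Num.sqrt (1 + u)) ^+ n)%:E)%E.
Proof.
move=> u1; set A := [set x | _].
have mA : measurable A.
  apply: (@measurable_preim _ _ _ _ (fun x => u * (c * n%:R - tsq 0 x)) [set y | 0 <= y]).
    apply: measurable_funM => //; apply: measurable_funB => //.
    exact: measurable_tsq.
  rewrite (_ : [set y | _] = `[0, +oo[%classic)//.
  by apply/seteqP; split => y; rewrite /= in_itv/= andbT.
rewrite prob_integral//.
have mE : measurable_fun setT (fun x : 'rV[R]_n => (expR (- (u / 2) * tsq 0 x))%:E).
  apply/measurable_EFinP; apply: measurableT_comp => //.
  by apply: measurable_funM => //; exact: measurable_tsq.
apply: (@le_trans _ _ (\int[gam n]_x ((expR (u * c / 2) ^+ n)%:E *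
    (expR (- (u / 2) * tsq 0 x))%:E))%E); last first.
  rewrite ge0_integralZl//.
  by rewrite gam_mgf// -EFinM exprMn.
apply: ge0_le_integral => //.
- by apply/measurable_EFinP; exact: measurable_indic.
- apply: emeasurable_funM => //.
- move=> x _; rewrite -EFinM lee_fin indicE.
  have [xA|xA] := boolP (x \in A); last by rewrite mulr_ge0 ?exprn_ge0 ?expR_ge0.
  rewrite -expRM_natl -expRD -[leLHS]expR0 ler_expR.
  move: xA; rewrite inE /A /= => h.
  by rewrite -mulr_natl in h *; lra.
Qed.

(** Since [1 - u c <= exp (- u c)], the square [exp (u c) / (1 + u)] is at most the inverse of
    [(1 - u c) (1 + u) = 1 + u (1 - c - u c)], which exceeds 1. *)
Lemma chernoff_rate (u c : R) : -1 < u -> u * c < 1 -> 0 < u * (1 - c - u * c) ->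
  0 < expR (u * c / 2) / Num.sqrt (1 + u) < 1.
Proof.
move=> u1 uc h; have u0 : 0 < 1 + u by lra.
rewrite divr_gt0 ?expR_gt0 ?sqrtr_gt0//= ltr_pdivrMr ?sqrtr_gt0// mul1r.
rewrite -(@ltr_pXn2r _ 2)// ?nnegrE ?expR_ge0 ?sqrtr_ge0//.
rewrite sqr_sqrtr; last by lra.
rewrite -expRM_natl (_ : 2%:R * _ = u * c); last by field.
have e1 : 1 - u * c <= expR (- (u * c)) by have := expR_ge1Dx (- (u * c)).
have e0 := expR_gt0 (u * c).
have ee : expR (u * c) * expR (- (u * c)) = 1 by rewrite -expRD addrN expR0.
nra.
Qed.

Lemma gam_lower_tail (c : R) : 0 < c < 1 ->
  exists q : R, 0 < q < 1 /\
    forall n, (gam n [set x | (tsq 0 x <= c * n%:R)%R] <= (q ^+ n)%:E)%E.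
Proof.
move=> /andP[c0 c1].
(* Here [u = 1 - c], for which the quantity of [chernoff_rate] is [(1 - c) ^+ 3]. *)
exists (expR ((1 - c) * c / 2) / Num.sqrt (1 + (1 - c))); split.
  apply: chernoff_rate; [lra|nra|].
  rewrite (_ : (1 - c) * _ = (1 - c) ^+ 3); last by ring.
  by rewrite exprn_gt0// subr_gt0.
move=> n; rewrite (_ : [set x | _] = [set x | (0 <= (1 - c) * (c * n%:R - tsq 0 x))%R]).
  by apply: gam_chernoff; lra.
by apply/funext => x /=; rewrite pmulr_rge0 ?subr_ge0//; lra.
Qed.

Lemma gam_upper_tail (c : R) : 1 < c ->
  exists q : R, 0 < q < 1 /\
    forall n, (gam n [set x | (c * n%:R <= tsq 0 x)%R] <= (q ^+ n)%:E)%E.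
Proof.
(* With this choice [u * c] is half of [1 - c], so [1 - c - u * c] is negative like [u], and their
   product is positive. *)
move=> c1; pose u := - ((c - 1) / (2 * c)).
have c0 : 0 < c by lra.
have uc : u * c = - ((c - 1) / 2) by rewrite /u; field; rewrite gt_eqF.
have u0 : u < 0 by rewrite oppr_lt0 divr_gt0//; lra.
have u1 : -1 < u by nra.
exists (expR (u * c / 2) / Num.sqrt (1 + u)); split.
  by apply: chernoff_rate => //; [rewrite uc; lra|rewrite uc; nra].
move=> n; rewrite (_ : [set x | _] = [set x | (0 <= u * (c * n%:R - tsq 0 x))%R]).
  exact: gam_chernoff.
by apply/funext => x /=; rewrite nmulr_rge0// subr_le0.
Qed.

End chi_square.

(** * Rectangles, and positivity of chi-square laws on intervals *)

Section product_law_box.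
Context {R : realType}.
Notation leb := (@lebesgue_measure R).
Notation N01 := (@normal_prob R 0 1).

Lemma measurable_forall_ord d (T : measurableType d) n (B : 'I_n -> set T) :
  (forall i, measurable (B i)) -> measurable [set t | forall i, B i t].
Proof.
move=> mB; rewrite (_ : [set t | _] = \bigcap_(i in [set: 'I_n]) B i).
  by apply: fin_bigcap_measurable => //; exact: finite_finset.
by apply/seteqP; split => [t h i _|t h i]; exact: h.
Qed.

Lemma prodP_box (lam : nat -> probability (measurableTypeR R) R) n (A : nat -> set R) :
  (forall i, measurable (A i)) ->
  prodP lam n [set x | forall i : 'I_n, A i (x ord0 i)] = (\prod_(i < n) lam i (A i))%E.
Proof.
move=> mA; elim: n lam A mA => [|n IH] lam A mA.
  rewrite big_ord0 (_ : [set x | _] = setT); first exact: probability_setT.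
  by apply/seteqP; split => // x _ /= [].
have mbox m (B : nat -> set R) : (forall i, measurable (B i)) ->
    measurable [set x : 'rV[R]_m | forall i : 'I_m, B i (x ord0 i)].
  move=> mB; apply: (@measurable_forall_ord _ _ _ (fun i => [set x : 'rV[R]_m | B i (x ord0 i)])) => i.
  by apply: measurable_preim => //; exact: measurable_rV_coord.
rewrite prodPS; last exact: mbox.
rewrite big_ord_recl /=.
pose c := prodP (fun i => lam i.+1) n [set x | forall i : 'I_n, A i.+1 (x ord0 i)].
transitivity (\int[lam 0%N]_z ((\1_(A 0%N) z)%:E * c))%E.
  apply: eq_integral => z _; rewrite indicE.
  have [zA|zA] := boolP (z \in A 0%N).
    rewrite mul1e; congr (prodP _ _ _); apply/seteqP; split => x /= h i.
      by have := h (lift ord0 i); rewrite consrVS lift0.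
    case: (unliftP ord0 i) => [j ->|->]; first by rewrite consrVS lift0.
    by rewrite consrV0; rewrite inE in zA.
  rewrite mul0e (_ : _ @^-1` _ = set0) ?measure0//.
  apply/seteqP; split => // x /= /(_ ord0); rewrite consrV0.
  by move: zA; rewrite notin_setE.
rewrite ge0_integralZr//.
- rewrite -(prob_integral (lam 0%N) (mA 0%N)); congr (_ * _)%E.
  by rewrite /c (IH (fun i => lam i.+1) (fun i => A i.+1)).
- by apply/measurable_EFinP; apply: measurable_indic; exact: mA.
- exact: measure_ge0.
Qed.

Lemma normal_prob_itv_gt0 (u v : R) : u < v -> (0 < N01 `]u, v[%classic)%E.
Proof.
(* A lower bound for the density on the interval, where [x ^+ 2 <= u ^+ 2 + v ^+ 2]. *)
move=> uv; pose c : R := normal_peak 1 * expR (- (u ^+ 2 + v ^+ 2) / (1 ^+ 2 *+ 2)).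
have c0 : 0 < c by rewrite mulr_gt0 ?normal_peak_gt0 ?oner_eq0 ?expR_gt0.
apply: (@lt_le_trans _ _ (\int[leb]_(x in `]u, v[) c%:E)%E).
  rewrite integral_cst//= lebesgue_measure_itv/= lte_fin uv -EFinB -EFinM lte_fin.
  by rewrite mulr_gt0// subr_gt0.
apply: ge0_le_integral => //=.
- by move=> x _; rewrite lee_fin ltW.
- by apply/measurable_EFinP/measurable_funTS; exact: measurable_normal_pdf.
- move=> x; rewrite in_itv /= => /andP[ux xv].
  rewrite lee_fin normal_pdfE ?oner_eq0//= /normal_fun subr0.
  rewrite ler_pM2l ?normal_peak_gt0 ?oner_eq0// ler_expR expr1n.
  have [x0|x0] := lerP 0 x; by rewrite ler_pM2r ?invr_gt0//; nra.
Qed.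

Lemma prode_gt0 n (f : 'I_n -> \bar R) : (forall i, (0 < f i)%E) -> (0 < \prod_(i < n) f i)%E.
Proof.
by move=> f0; elim/big_ind : _ => // x y x0 y0; exact: mule_gt0.
Qed.

Lemma chi_itv_gt0 n (a b : R) : (0 < n)%N -> 0 <= a -> a < b ->
  (0 < chi n `]a, b]%classic)%E.
Proof.
case: n => // n _ a0 ab; rewrite chiE.
(* The first square is confined between [a] and [(a + b) / 2]; each of the other [n] is at most
   [del ^+ 2], so that they add at most [(b - a) / 2]. *)
pose del := Num.sqrt ((b - a) / (2 * n.+1%:R)).
pose A (i : nat) : set R := if i == 0%N then `]Num.sqrt a, Num.sqrt ((a + b) / 2)[%classic
  else `]- del, del[%classic.
have mA i : measurable (A i) by rewrite /A; case: ifP.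
have n0 : 0 < n.+1%:R :> R by rewrite ltr0n.
have del2 : del ^+ 2 = (b - a) / (2 * n.+1%:R).
  by rewrite sqr_sqrtr// divr_ge0//; lra.
have del0 : 0 < del by rewrite sqrtr_gt0 divr_gt0//; lra.
apply: (@lt_le_trans _ _ (gam n.+1 [set x | forall i : 'I_n.+1, A i (x ord0 i)])).
  rewrite gamE prodP_box//; apply: prode_gt0 => i; rewrite /A; case: ifP => _.
    by apply: normal_prob_itv_gt0; rewrite ltr_sqrt//; lra.
  by apply: normal_prob_itv_gt0; lra.
apply: le_prob.
- apply: (@measurable_forall_ord _ _ _ (fun i : 'I_n.+1 => [set x : 'rV[R]_n.+1 | A i (x ord0 i)])) => i.
  by apply: measurable_preim => //; exact: measurable_rV_coord.
- by apply: (@measurable_preim _ _ _ _ (tsq 0) `]a, b]%classic) => //; exact: measurable_tsq.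
move=> x /= h; rewrite (consrV_surj x) tsq0_cons in_itv /=.
set z := x ord0 ord0; set x' := \row_i _.
have := h ord0; rewrite /A /= -/z in_itv /= => /andP[z1 z2].
have sa0 := sqrtr_ge0 a.
have z1' : a < z ^+ 2 by rewrite -(sqr_sqrtr a0); rewrite ltr_pXn2r// ?nnegrE; lra.
have z2' : z ^+ 2 < (a + b) / 2.
  rewrite -(@sqr_sqrtr _ ((a + b) / 2)); last by lra.
  by rewrite ltr_pXn2r// ?nnegrE ?sqrtr_ge0//; lra.
have x'0 := tsq_ge0 0 x'.
have : tsq 0 x' <= n%:R * del ^+ 2.
  rewrite /tsq /tdot mulr_natl -[X in _ *+ X](card_ord n) -sumr_const.
  apply: ler_sum => i _; rewrite -expr2 mxE.
  have := h (lift ord0 i); rewrite /A lift0 /= in_itv /= => /andP[i1 i2].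
  by nra.
rewrite del2 => x'1.
have : n%:R * ((b - a) / (2 * n.+1%:R)) <= (b - a) / 2.
  rewrite [leLHS](_ : _ = n%:R / n.+1%:R * ((b - a) / 2)); last by field; rewrite addrC natr1.
  apply: ler_piMl; first lra.
  by rewrite ler_pdivrMr// mul1r ler_nat.
move=> x'2; apply/andP; split; first by rewrite (lt_le_trans z1')// lerDl.
by apply: (le_trans (lerD (ltW z2') (le_trans x'1 x'2))); lra.
Qed.

End product_law_box.

(** * Laws of the Gram-Schmidt vectors *)

Section gram_schmidt_theory.
Context {R : realType}.

Definition gs_step n (W : seq 'rV[R]_n) (v : 'rV[R]_n) : 'rV[R]_n :=
  v - \sum_(w <- W) (dotv v w / sqnorm w) *: w.

Lemma gram_schmidt_rcons n (W : seq 'rV[R]_n) v :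
  gram_schmidt (rcons W v) = rcons (gram_schmidt W) (gs_step (gram_schmidt W) v).
Proof. by rewrite /gram_schmidt -cats1 foldl_cat. Qed.

Lemma gs_step_orthogonal n (W : seq 'rV[R]_n) v w : orthogonal_family W ->
  w \in W -> dotv (gs_step W v) w = 0.
Proof.
elim/last_ind: W => [|W u IH]//.
rewrite orthogonal_rcons => /and3P[oW /allP Wu u0].
have E : gs_step (rcons W u) v = gs_step W v - (dotv v u / sqnorm u) *: u.
  by rewrite /gs_step big_rcons /= opprD addrA addrAC.
have Su : dotv (gs_step W v) u = dotv v u.
  rewrite dotvBl dotv_suml big1_seq ?subr0// => x /andP[_ xW].
  by rewrite dotvZl (eqP (Wu _ xW)) mulr0.
rewrite mem_rcons inE => /orP[/eqP ->|wW]; rewrite E dotvBl dotvZl.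
  by rewrite Su -[X in _ * X]/(sqnorm u) divfK// subrr.
by rewrite IH// (dotvC u) (eqP (Wu _ wW)) mulr0 subrr.
Qed.

Lemma sqnorm_gs_step n (W : seq 'rV[R]_n) v : orthogonal_family W ->
  sqnorm (gs_step W v) = resid W v.
Proof.
move=> oW; rewrite {1}/sqnorm {2}/gs_step dotvC dotvBl dotv_suml.
rewrite [X in _ - X]big1_seq ?subr0; last first.
  by move=> w /andP[_ wW]; rewrite dotvZl (dotvC w) gs_step_orthogonal// mulr0.
rewrite dotvC dotvBl dotv_suml /resid; congr (_ - _).
by apply: eq_bigr => w _; rewrite dotvZl dotvC expr2 mulrAC.
Qed.

Lemma orthogonal_gs_step n (W : seq 'rV[R]_n) v : orthogonal_family W ->
  sqnorm (gs_step W v) != 0 -> orthogonal_family (rcons W (gs_step W v)).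
Proof.
move=> oW v0; rewrite orthogonal_rcons oW v0 andbT /=.
by apply/allP => w wW; rewrite dotvC gs_step_orthogonal.
Qed.

Definition gs_prefix n (c : nat -> 'rV[R]_n) k := gram_schmidt (mkseq c k).

Definition gs_vec n (c : nat -> 'rV[R]_n) k := gs_step (gs_prefix c k) (c k).

Lemma gs_prefixE n (c : nat -> 'rV[R]_n) k : gs_prefix c k = mkseq (gs_vec c) k.
Proof.
elim: k => [|k IH]; first by rewrite /gs_prefix.
by rewrite /gs_prefix !mkseqS gram_schmidt_rcons -/(gs_prefix c k) -/(gs_vec c k) IH.
Qed.

Lemma size_gs_prefix n (c : nat -> 'rV[R]_n) k : size (gs_prefix c k) = k.
Proof. by rewrite gs_prefixE size_mkseq. Qed.

Lemma orthogonal_gs_prefix n (c : nat -> 'rV[R]_n) k :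
  (forall j, (j < k)%N -> sqnorm (gs_vec c j) != 0) -> orthogonal_family (gs_prefix c k).
Proof.
elim: k => [|k IH] h; first by rewrite /gs_prefix.
have oW : orthogonal_family (gs_prefix c k) by apply: IH => j jk; apply: h; exact: ltnW.
rewrite gs_prefixE mkseqS -gs_prefixE.
by apply: orthogonal_gs_step => //; exact: h.
Qed.

Lemma bhat_mkseq n (c : nat -> 'rV[R]_n) p j : (j < p)%N ->
  bhat (mkseq c p) j.+1 = gs_vec c j.
Proof. by move=> jp; rewrite /bhat /= -/(gs_prefix c p) gs_prefixE nth_mkseq. Qed.

Lemma measurable_gs_vec d (T : measurableType d) n (c : nat -> T -> 'rV[R]_n) k :
  (forall j, (j <= k)%N -> measurable_fun setT (c j)) ->
  measurable_fun setT (fun t => gs_vec (c ^~ t) k).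
Proof.
elim/ltn_ind: k => k IH mc; apply: measurable_fun_rV => i.
rewrite (_ : (fun t => _) = fun t => c k t ord0 i - \sum_(j < k)
    dotv (c k t) (gs_vec (c ^~ t) j) / sqnorm (gs_vec (c ^~ t) j) *
    gs_vec (c ^~ t) j ord0 i); last first.
  apply/funext => t; rewrite {1}/gs_vec /gs_step gs_prefixE big_map.
  rewrite (_ : iota 0 k = index_iota 0 k) ?big_mkord; last by rewrite /index_iota subn0.
  rewrite !mxE; congr (_ - _).
  by rewrite summxE; apply: eq_bigr => j _; rewrite mxE.
have mv (j : 'I_k) : measurable_fun setT (fun t => gs_vec (c ^~ t) j).
  by apply: IH => // j' jj'; apply: mc; rewrite (leq_trans jj')// ltnW.
apply: measurable_funB; first exact: measurableT_comp (measurable_rV_coord i) (mc k _).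
apply: measurable_sum => j; apply: measurable_funM; last first.
  exact: measurableT_comp (measurable_rV_coord i) (mv j).
apply: measurable_fun_div; last exact: measurable_sqnorm.
by apply: measurable_dotv => //; exact: mc.
Qed.

(** Measurability jointly in the previous vectors and the next one, as Tonelli requires when the
    next vector is integrated for a fixed past. *)
Lemma measurable_gs_resid d (T : measurableType d) n (c : nat -> T -> 'rV[R]_n) k :
  (forall j, (j < k)%N -> measurable_fun setT (c j)) ->
  measurable_fun setT (fun z : T * 'rV[R]_n => resid (gs_prefix (c ^~ z.1) k) z.2).
Proof.
move=> mc.
rewrite (_ : (fun z => _) = fun z => sqnorm z.2 - \sum_(j < k)
    dotv z.2 (gs_vec (c ^~ z.1) j) ^+ 2 / sqnorm (gs_vec (c ^~ z.1) j)); last first.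
  apply/funext => z; rewrite /resid gs_prefixE big_map; congr (_ - _).
  by rewrite (_ : iota 0 k = index_iota 0 k) ?big_mkord// /index_iota subn0.
have mv (j : 'I_k) : measurable_fun setT (fun z : T * 'rV[R]_n => gs_vec (c ^~ z.1) j).
  apply: (measurableT_comp (f := fun t => gs_vec (c ^~ t) j)) => //.
  by apply: measurable_gs_vec => i ij; apply: mc; exact: leq_ltn_trans ij _.
apply: measurable_funB; first exact: measurable_sqnorm.
apply: measurable_sum => j; apply: measurable_fun_div; last exact: measurable_sqnorm.
by apply: measurable_funX; apply: measurable_dotv.
Qed.

End gram_schmidt_theory.

(** * Independence of a vector from the previous ones *)

Section independence.
Context {d d' : measure_display} {Omega : measurableType d}
  {T : measurableType d'} {R : realType} (P : probability Omega R).
Variables (p : nat) (X : 'I_p -> {RV P >-> T}).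
Hypothesis indX : mutually_independent X.
Variable k : 'I_p.

(* The sigma-algebra generated by the X i, i < k, is carried by a copy of Omega. *)
Definition past_events : set (set Omega) :=
  [set E | exists2 A : 'I_p -> set T, (forall i, measurable (A i)) &
     E = [set w | forall i : 'I_p, (i < k)%N -> A i (X i w)]].

Definition past : Type := g_sigma_algebraType past_events.

HB.instance Definition _ := Measurable.on past.

Lemma past_eventsI : setI_closed past_events.
Proof.
move=> _ _ [A mA ->] [B mB ->]; exists (fun i => A i `&` B i).
  by move=> i; exact: measurableI.
apply/seteqP; split => w /=; first by move=> [h1 h2] i ik; split; [exact: h1|exact: h2].
by move=> h; split => i ik; case: (h i ik).
Qed.

Lemma past_events_setT : past_events setT.
Proof. by exists (fun=> setT) => //; apply/seteqP; split. Qed.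

Lemma measurable_past_events E : past_events E -> measurable E.
Proof.
move=> [A mA ->].
apply: (@measurable_forall_ord _ _ _ (fun i => [set w | (i < k)%N -> A i (X i w)])) => i.
case: (ltnP i k) => ik.
  rewrite (_ : [set w | _] = [set w | A i (X i w)]); last first.
    by apply/seteqP; split => w /= h; [exact: h|move=> _].
  exact: measurable_preim.
by rewrite (_ : [set w | _] = setT)//; apply/seteqP; split.
Qed.

Lemma measurable_past (E : set Omega) : <<s past_events >> E -> measurable E.
Proof.
by apply: smallest_sub; [exact: sigma_algebra_measurable|exact: measurable_past_events].
Qed.

Definition to_past (w : Omega) : past := w.

Lemma measurable_to_past : measurable_fun setT to_past.
Proof. by move=> _ E mE; rewrite setTI; exact: measurable_past. Qed.

HB.instance Definition _ := isMeasurableFun.Build _ _ _ _ to_past measurable_to_past.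

Lemma measurable_past_var (i : 'I_p) : (i < k)%N -> measurable_fun setT (X i : past -> T).
Proof.
move=> ik _ A mA; rewrite setTI; apply: sub_sigma_algebra.
exists (fun j => if j == i then A else setT).
  by move=> j; case: ifP.
apply/seteqP; split => w /=.
  by move=> h j jk; case: eqP => [->|].
by move=> /(_ i ik); rewrite eqxx.
Qed.

Lemma past_independent_gen E B : past_events E -> measurable B ->
  P (E `&` X k @^-1` B) = (P E * P (X k @^-1` B))%E.
Proof.
move=> [A mA ->] mB.
(* The product formula is used with [C = B] and with [C = setT]: the quotient isolates the factor of
   index [k]. Indices after [k] are left free. *)
pose A1 (C : set T) i := if i == k then C else if (i < k)%N then A i else setT.
have mA1 C i : measurable C -> measurable (A1 C i).
  by move=> mC; rewrite /A1; case: ifP => // _; case: ifP.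
have e1 : [set w | forall i, A1 B i (X i w)] =
    [set w | forall i : 'I_p, (i < k)%N -> A i (X i w)] `&` X k @^-1` B.
  apply/seteqP; split => w /=.
    move=> h; split; last by have := h k; rewrite /A1 eqxx.
    move=> i ik; have := h i; rewrite /A1 ik; case: eqP => // ei.
    by rewrite ei ltnn in ik.
  move=> [h1 h2] i; rewrite /A1; case: eqP => [->//|_].
  by case: ifP => // /h1.
have e2 : [set w | forall i, A1 setT i (X i w)] =
    [set w | forall i : 'I_p, (i < k)%N -> A i (X i w)].
  apply/seteqP; split => w /=.
    move=> h i ik; have := h i; rewrite /A1 ik; case: eqP => // ei.
    by rewrite ei ltnn in ik.
  move=> h1 i; rewrite /A1; case: eqP => [//|_].
  by case: ifP => // /h1.
rewrite -e1 -e2 !indX; [|by move=> i; exact: mA1..].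
rewrite (bigD1 k)//= [in RHS](bigD1 k)//=.
rewrite /A1 eqxx preimage_setT probability_setT mul1e muleC.
by congr (_ * _)%E; apply: eq_bigr => i ik; rewrite (negbTE ik).
Qed.

(** As functions of [E] both sides are finite measures on the past; they agree on [past_events], a
    generating family stable under intersection. *)
Lemma past_independent E B : <<s past_events >> E -> measurable B ->
  P (E `&` X k @^-1` B) = (P E * P (X k @^-1` B))%E.
Proof.
move=> sE mB.
have mXB : measurable (X k @^-1` B) by exact: measurable_preim.
have c0 : 0 <= fine (P (X k @^-1` B)) by rewrite fine_ge0.
have Pfin : P (X k @^-1` B) \is a fin_num by exact: fin_num_measure.
pose mu2 := mscale (NngNum c0) (distribution P to_past).
have [mu1 mu1E] : exists m : {measure set past -> \bar R},
    forall F, m F = P (F `&` X k @^-1` B).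
  by unshelve eexists (pushforward (mrestr P mXB) to_past); [exact: measurable_to_past|].
have mu2E F : mu2 F = (P F * P (X k @^-1` B))%E.
  by rewrite /mu2 /mscale /= fineK// muleC.
rewrite -mu1E -mu2E.
apply: (@measure_unique _ R past past_events (fun=> setT) erefl past_eventsI
  (fun=> past_events_setT) _ mu1 mu2) => //.
- by rewrite bigcup_const.
- by move=> F GF; rewrite [RHS]mu2E mu1E past_independent_gen.
- by move=> _; rewrite mu1E setTI ltey_eq Pfin.
Qed.

(** The joint law of the past and of the next vector is a product measure, as it agrees with one on
    rectangles. *)
Lemma past_joint_law (mu : probability T R) (F : set (past * T)) :
  (forall A, measurable A -> distribution P (X k) A = mu A) -> measurable F ->
  P [set w | F (to_past w, X k w)] =
  (\int[distribution P to_past]_w mu [set x | F (w, x)])%E.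
Proof.
move=> lawX mF.
pose J (w : Omega) : past * T := (to_past w, X k w).
have mJ : measurable_fun setT J.
  by apply: measurable_fun_pair => //; exact: measurable_to_past.
pose Jm := mfun_Sub (mem_set mJ : J \in mfun).
transitivity ((distribution P to_past \x mu)%E F); last first.
  rewrite /product_measure1; apply: eq_integral => w _ /=; congr (mu _).
  by apply/seteqP; split => x; rewrite /xsection /= inE.
symmetry.
rewrite (@product_measure_unique _ _ _ _ R (distribution P to_past) mu (distribution P Jm))//.
move=> A B mA mB; transitivity (P A * P (X k @^-1` B))%E.
  exact: past_independent.
by congr (_ * _)%E; exact: lawX.
Qed.

End independence.

Lemma prob_setI1 d (T : measurableType d) (R : realType) (P : probability T R)
    (E A : set T) : measurable E -> measurable A -> P (~` A) = 0%E ->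
  P (E `&` A) = P E.
Proof.
move=> mE mA PC.
have mC := measurableC mA.
rewrite -[in RHS](setIT E) -(setUv A) setIUr measureU.
- rewrite [X in (_ + X)%E](_ : _ = 0%E) ?adde0//.
  apply/eqP; rewrite eq_le measure_ge0 andbT -PC.
  by apply: le_prob => //; exact: measurableI.
- exact: measurableI.
- exact: measurableI.
- by rewrite setIACA setICr setI0.
Qed.

(** * Joint law of the Gram-Schmidt lengths *)

Section gram_schmidt_law.
Context {R : realType}.

Lemma prob_integral_preim d (T : measurableType d) d' (T' : measurableType d')
    (P : probability T R) (f : T -> T') (B : set T') :
  measurable_fun setT f -> measurable B ->
  P [set t | B (f t)] = (\int[P]_t (\1_B (f t))%:E)%E.
Proof.
move=> mf mB; rewrite prob_integral//; exact: measurable_preim.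
Qed.

Lemma measurable_indicE d (T : measurableType d) (B : set T) : measurable B ->
  measurable_fun setT (fun x => ((\1_B x : R)%:E)).
Proof. by move=> mB; apply/measurable_EFinP; exact: measurable_indic. Qed.

Lemma prob_resid n (nu : probability 'rV[R]_n R) W (B : set R) :
  rotation_invariant nu -> (size W <= n)%N -> orthogonal_family W -> measurable B ->
  nu [set x | B (resid W x)] = nu [set x | B (tsq (size W) x)].
Proof.
move=> inu Wn oW mB.
rewrite prob_integral_preim//; last exact: measurable_resid.
rewrite prob_integral_preim//; last exact: measurable_tsq.
apply: (integral_resid (H := fun p : R * R => (\1_B p.1)%:E)) => //.
apply: (measurableT_comp (f := fun x => ((\1_B x : R)%:E))) => //.
exact: measurable_indicE.
Qed.

(** In the polar form the length and the Gaussian ratio are both almost surely nonzero. *)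
Lemma rotation_tsq_eq0 n k (nu : probability 'rV[R]_n R) :
  rotation_invariant nu -> nu [set 0] = 0%E -> (k < n)%N ->
  nu [set x | tsq k x = 0] = 0%E.
Proof.
move=> inu nu0 kn.
have n0 : (0 < n)%N by exact: leq_ltn_trans kn.
have mT (j : nat) : measurable_fun setT (@tsq R n j) by exact: measurable_tsq.
rewrite (@prob_integral_preim _ _ _ _ nu (tsq k) [set 0])//.
have mH : measurable_fun setT (fun p : R * R => ((\1_([set 0] : set R) p.1 : R)%:E)).
  apply: (measurableT_comp (f := fun x => ((\1_([set 0] : set R) x : R)%:E))) => //.
  exact: measurable_indicE.
rewrite (tail_invariant_law (H := fun p : R * R => (\1_([set 0] : set R) p.1)%:E) (tail_invariant_rotation inu))//; last exact: ltnW.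
pose f (z : 'rV[R]_n * 'rV[R]_n) : \bar R := (\1_([set 0] : set R) (tsq 0 z.1 * (tsq k z.2 / tsq 0 z.2)))%:E.
have mf : measurable_fun setT f.
  apply: (measurableT_comp (f := fun x => ((\1_([set 0] : set R) x : R)%:E))).
    exact: measurable_indicE.
  apply: measurable_funM; first exact: measurableT_comp.
  by apply: measurable_fun_div; exact: measurableT_comp.
have f0 z : (0 <= f z)%E by rewrite lee_fin.
rewrite -[RHS](integral0 nu setT).
apply: (eq_integral_null (N := [set (0 : 'rV[R]_n)])) => //.
- rewrite (_ : [set (0 : 'rV[R]_n)] = [set x : 'rV[R]_n | [set 0] (tsq 0 x)]).
    exact: measurable_preim.
  apply/seteqP; split => x /=; first by move=> ->; rewrite tsq0; apply/eqP; rewrite sqnorm_eq0.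
  by rewrite tsq0 => /eqP; rewrite sqnorm_eq0 => /eqP.
- by apply: (measurable_fun_fubini_tonelli_F (m2 := gam n) f).
move=> x /eqP; rewrite -sqnorm_eq0 -tsq0 => x0.
rewrite -[RHS](integral0 (gam n) setT).
apply: (eq_integral_null (N := [set y | tsq k y = 0])) => //.
- exact: (@measurable_preim _ _ _ _ (tsq k) [set 0]).
- exact: gam_tsq_eq0.
- apply: (measurableT_comp (f := fun x => ((\1_([set 0] : set R) x : R)%:E))).
    exact: measurable_indicE.
  by apply: measurable_funM => //; exact: measurable_fun_div.
move=> y /eqP yk0; rewrite indicE memNset//=; apply/eqP.
have y0 : tsq 0 y != 0.
  by apply: contra_neq yk0 => y0; apply/eqP; rewrite eq_le tsq_ge0 andbT -y0 tsq_le0.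
by rewrite !mulf_neq0// invr_eq0.
Qed.

Section system_law.
Context {d : measure_display} {Omega : measurableType d} (P : probability Omega R).
Variables (n p : nat) (nu : probability 'rV[R]_n R) (b : 'I_p -> {RV P >-> 'rV[R]_n}).
Hypotheses (pn : (p <= n)%N) (iidb : iid nu b) (inu : rotation_invariant nu).

Let c (j : nat) (w : Omega) : 'rV[R]_n := nth 0 (system b w) j.

Let cE (i : 'I_p) : c i = b i.
Proof.
by apply/funext => w; rewrite /c /system (nth_map i) ?size_enum_ord// nth_ord_enum.
Qed.

Lemma system_mkseq w : system b w = mkseq (c ^~ w) p.
Proof.
by apply: (@eq_from_nth _ 0); rewrite /system size_map size_enum_ord ?size_mkseq// => i ip; rewrite nth_mkseq.
Qed.

Let measurable_c j : (j < p)%N -> measurable_fun setT (c j).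
Proof. by move=> jp; rewrite (cE (Ordinal jp)). Qed.

Lemma bhat_system j w : (j < p)%N -> bhat (system b w) j.+1 = gs_vec (c ^~ w) j.
Proof. by move=> jp; rewrite system_mkseq bhat_mkseq. Qed.

Lemma measurable_bhat j : (j < p)%N ->
  measurable_fun setT (fun w => sqnorm (bhat (system b w) j.+1)).
Proof.
move=> jp; under eq_fun do rewrite bhat_system//.
apply: measurable_sqnorm; apply: measurable_gs_vec => i ij; apply: measurable_c.
exact: leq_ltn_trans ij jp.
Qed.

(** Sets avoiding 0 force the previous Gram-Schmidt vectors to form an orthogonal family. The next
    squared length is then a [resid], whose law depends on the past through the number [k] of
    vectors only, and each step contributes a constant factor. *)
Lemma gs_vec_law_nz (B : nat -> set R) k : (k <= p)%N ->
  (forall j, measurable (B j)) -> (forall j, ~ B j 0) ->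
  P [set w | forall j : 'I_k, B j (sqnorm (gs_vec (c ^~ w) j))] =
  (\prod_(j < k) nu [set x | B j (tsq j x)])%E.
Proof.
move=> + mB B0; elim: k => [_|k IH kp].
  rewrite big_ord0 (_ : [set w | _] = setT); first exact: probability_setT.
  by apply/seteqP; split => // w _ [].
have [indb lawb] := iidb.
pose kk := Ordinal kp.
pose Om := past b kk.
have ck w : c k w = b kk w by exact: (congr1 (fun f => f w) (cE kk)).
have mcp j : (j < k)%N -> measurable_fun setT (c j : Om -> 'rV[R]_n).
  move=> jk; have jp := ltn_trans jk kp.
  by rewrite (cE (Ordinal jp)); exact: measurable_past_var.
have mE : measurable [set w : Om | forall j : 'I_k, B j (sqnorm (gs_vec (c ^~ w) j))].
  apply: (@measurable_forall_ord _ _ _ (fun j : 'I_k => [set w : Om | B j (sqnorm (gs_vec (c ^~ w) j))])) => j.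
  apply: measurable_preim => //; apply: measurable_sqnorm; apply: measurable_gs_vec => i ij.
  by apply: mcp; exact: leq_ltn_trans ij _.
pose F : set (Om * 'rV[R]_n) := [set z | (forall j : 'I_k, B j (sqnorm (gs_vec (c ^~ z.1) j))) /\
  B k (resid (gs_prefix (c ^~ z.1) k) z.2)].
have mF : measurable F.
  apply: measurableI.
    exact: (@measurable_preim _ _ _ _ fst [set w : Om | forall j : 'I_k, B j (sqnorm (gs_vec (c ^~ w) j))]).
  by apply: measurable_preim => //; exact: measurable_gs_resid.
have oE w : (forall j : 'I_k, B j (sqnorm (gs_vec (c ^~ w) j))) ->
    orthogonal_family (gs_prefix (c ^~ w) k).
  move=> h; apply: orthogonal_gs_prefix => j jk.
  by apply/eqP => e; apply: (B0 j); rewrite -e; exact: (h (Ordinal jk)).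
have -> : [set w | forall j : 'I_k.+1, B j (sqnorm (gs_vec (c ^~ w) j))] =
    [set w | F (to_past b kk w, b kk w)].
  apply/seteqP; split => w /=.
    move=> h; have h1 (j : 'I_k) : B j (sqnorm (gs_vec (c ^~ w) j)).
      exact: (h (widen_ord (leqnSn k) j)).
    split=> //; rewrite /to_past -sqnorm_gs_step; last exact: oE.
    have := h ord_max; rewrite /gs_vec /=; congr (B k (sqnorm (gs_step _ _))).
    exact: ck.
  move=> [h1]; rewrite /to_past -sqnorm_gs_step; last exact: oE.
  move=> h2 j; have [jk|] := ltnP j k; first exact: (h1 (Ordinal jk)).
  move=> kj; have -> : j = ord_max by apply/val_inj/eqP; rewrite eqn_leq kj -ltnS ltn_ord.
  by move: h2; rewrite -ck.
rewrite (past_joint_law indb (lawb kk) mF) big_ord_recr /= -(IH (ltnW kp)).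
(* Conditionally on the past, the probability is constant on the event about the first [k] lengths,
   and 0 off it. *)
transitivity (\int[distribution P (to_past b kk)]_w
   ((\1_([set w : Om | forall j : 'I_k, B j (sqnorm (gs_vec (c ^~ w) j))]) w)%:E *
    nu [set x | B k (tsq k x)]))%E.
  apply: eq_integral => w _; rewrite indicE.
  set E := [set w : Om | _].
  have [wE|wE] := boolP (w \in E).
    rewrite mul1e; rewrite inE in wE.
    have sz : size (gs_prefix (c ^~ w) k) = k by rewrite size_gs_prefix.
    transitivity (nu [set x | B k (resid (gs_prefix (c ^~ w) k) x)]); last first.
      rewrite prob_resid ?sz//; last exact: oE.
      by rewrite (leq_trans _ pn)// ltnW.
    congr (nu _); apply/seteqP; split => x /=; first by case.
    by move=> h; split.
  rewrite mul0e (_ : [set x | _] = set0) ?measure0//.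
  apply/seteqP; split => // x [/= h _]; move: wE; rewrite notin_setE; exact.
rewrite ge0_integralZr//.
- by rewrite -(prob_integral (distribution P (to_past b kk)) mE).
- exact: measurable_indicE.
Qed.

Hypothesis nu0 : nu [set 0] = 0%E.

(** Removing 0 from every [B j] changes both sides by null events and brings back the previous
    lemma. That no length vanishes, almost surely, follows from that same product formula with all
    sets equal to the complement of 0. *)
Lemma gs_law (B : nat -> set R) : (forall j, measurable (B j)) ->
  P [set w | forall j : 'I_p, B j (sqnorm (bhat (system b w) j.+1))] =
  (\prod_(j < p) nu [set x | B j (tsq j x)])%E.
Proof.
move=> mB; pose B' j := B j `&` [set~ 0].
have mC0 : measurable ([set~ 0] : set R) by apply: measurableC; exact: measurable_set1.
have mB' j : measurable (B' j) by exact: measurableI.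
have bE (C : nat -> set R) : [set w | forall j : 'I_p, C j (sqnorm (bhat (system b w) j.+1))] =
    [set w | forall j : 'I_p, C j (sqnorm (gs_vec (c ^~ w) j))].
  apply/seteqP; split => w /= h j; have := h j; rewrite bhat_system//; exact: ltn_ord.
have mgs (C : nat -> set R) : (forall j, measurable (C j)) ->
    measurable [set w | forall j : 'I_p, C j (sqnorm (gs_vec (c ^~ w) j))].
  move=> mC; rewrite -bE.
  apply: (@measurable_forall_ord _ _ _ (fun j : 'I_p => [set w | C j (sqnorm (bhat (system b w) j.+1))])) => j.
  by apply: measurable_preim => //; exact: measurable_bhat.
have nuT (j : 'I_p) (C : set R) : measurable C ->
    nu [set x | (C `&` [set~ 0]) (tsq j x)] = nu [set x | C (tsq j x)].
  move=> mC.
  have mN : measurable [set x : 'rV[R]_n | tsq j x = 0].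
    by apply: (@measurable_preim _ _ _ _ (tsq j) [set 0]) => //; exact: measurable_tsq.
  have mS : measurable [set x : 'rV[R]_n | C (tsq j x)].
    by apply: measurable_preim => //; exact: measurable_tsq.
  have jn : (j < n)%N by exact: leq_trans (ltn_ord j) pn.
  rewrite (_ : [set x | _] = [set x | C (tsq j x)] `\` [set x : 'rV[R]_n | tsq j x = 0]).
    apply: (@prob_setI1 _ _ _ nu _ (~` [set x | tsq j x = 0])) => //.
      exact: measurableC.
    by rewrite setCK; exact: rotation_tsq_eq0.
  by apply/seteqP; split => x /= [].
rewrite bE -(@prob_setI1 _ _ _ P _ [set w | forall j : 'I_p, [set~ 0] (sqnorm (gs_vec (c ^~ w) j))]).
- rewrite (_ : _ `&` _ = [set w | forall j : 'I_p, B' j (sqnorm (gs_vec (c ^~ w) j))]).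
    rewrite gs_vec_law_nz//; last by move=> j [_]; exact.
    by apply: eq_bigr => j _; exact: nuT.
  apply/seteqP; split => w /=; first by move=> [h1 h2] j; split; [exact: h1|exact: h2].
  by move=> h; split => j; case: (h j).
- exact: mgs.
- exact: (mgs (fun=> [set~ 0])).
- rewrite probability_setC; last exact: (mgs (fun=> [set~ 0])).
  rewrite (@gs_vec_law_nz (fun=> [set~ 0]) p)//; last by move=> j; apply.
  rewrite big1 ?subee//// => j _; have := nuT j setT measurableT.
  by rewrite setTI => ->; rewrite [X in nu X](_ : _ = setT) ?probability_setT.
Qed.

End system_law.
End gram_schmidt_law.

(** * Probabilities as real numbers, for linear arithmetic *)

Section real_probability.
Context {d : measure_display} {T : measurableType d} {R : realType}.
Variable P : probability T R.
Implicit Types A B : set T.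

Definition pr A : R := fine (P A).

Lemma prE A : measurable A -> P A = (pr A)%:E.
Proof. by move=> mA; rewrite /pr fineK// fin_num_measure. Qed.

Lemma pr_ge0 A : 0 <= pr A.
Proof. by rewrite /pr fine_ge0. Qed.

Lemma pr_le A B : measurable A -> measurable B -> A `<=` B -> pr A <= pr B.
Proof. by move=> mA mB AB; rewrite -lee_fin -!prE// le_prob. Qed.

Lemma pr_setT : pr setT = 1.
Proof. by rewrite /pr probability_setT. Qed.

Lemma pr_set0 : pr set0 = 0.
Proof. by rewrite /pr measure0. Qed.

Lemma pr_le1 A : measurable A -> pr A <= 1.
Proof. by move=> mA; rewrite -pr_setT; exact: pr_le. Qed.

Lemma pr_setC A : measurable A -> pr (~` A) = 1 - pr A.
Proof. by move=> mA; rewrite /pr probability_setC// prE. Qed.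

Lemma pr_setU A B : measurable A -> measurable B -> pr (A `|` B) <= pr A + pr B.
Proof.
move=> mA mB; rewrite -lee_fin EFinD -!prE//; last exact: measurableU.
exact: measureU2.
Qed.

Lemma pr_setUI A B : measurable A -> measurable B ->
  pr (A `|` B) = pr A + pr B - pr (A `&` B).
Proof.
move=> mA mB; apply/EFin_inj; rewrite EFinB EFinD -!prE//; last 2 first.
- exact: measurableI.
- exact: measurableU.
by rewrite measureUfinl//= ltey_eq fin_num_measure.
Qed.

Lemma pr_le_setU A B C : measurable A -> measurable B -> measurable C ->
  A `<=` B `|` C -> pr A <= pr B + pr C.
Proof.
move=> mA mB mC ABC; apply: le_trans (pr_setU mB mC).
by apply: pr_le => //; exact: measurableU.
Qed.

Lemma pr_eq1 A : measurable A -> (pr A == 1) = (P (~` A) == 0%E).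
Proof.
move=> mA; rewrite prE; last exact: measurableC.
by rewrite pr_setC// eqe subr_eq0 eq_sym.
Qed.

End real_probability.

(** Meant for [u] a squared spherical length over [a] and [v] a squared Gaussian length: the random
    scale between the two models is then close to 1. *)
Lemma ratio_bounds (R : realFieldType) (rho u v n : R) : 0 < rho < 1 ->
  1 - rho < u < 1 + rho -> (1 - rho) * n < v < (1 + rho) * n -> 0 < n ->
  (1 - rho) / (1 + rho) <= u * (n / v) <= (1 + rho) / (1 - rho).
Proof.
move=> /andP[r0 r1] /andP[u1 u2] /andP[v1 v2] n0.
have r1' : 0 < 1 - rho by rewrite subr_gt0.
have v0 : 0 < v by apply: lt_trans v1; rewrite mulr_gt0.
have r2' : 0 < 1 + rho by rewrite addr_gt0.
rewrite mulrA; apply/andP; split.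
  rewrite ler_pdivlMr// mulrAC ler_pdivrMr//.
  apply: (@le_trans _ _ ((1 - rho) * ((1 + rho) * n))).
    by rewrite ler_pM2l// ltW.
  rewrite (_ : u * n * (1 + rho) = u * ((1 + rho) * n)); last by ring.
  by rewrite ler_pM2r ?mulr_gt0// ltW.
rewrite ler_pdivrMr// mulrAC ler_pdivlMr//.
apply: (@le_trans _ _ ((1 + rho) * n * (1 - rho))).
  by rewrite !ler_pM2r// ltW.
by rewrite -mulrA ler_pM2l// mulrC ltW.
Qed.

(** * Comparison with the Gaussian law *)

Section tail_comparison.
Context {R : realType}.

Lemma rotation_law n k (nu : probability 'rV[R]_n R) (A : set R) :
  rotation_invariant nu -> (k <= n)%N -> (0 < n)%N -> measurable A ->
  nu [set x | A (tsq k x)] =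
  (nu \x gam n)%E [set z | A (tsq 0 z.1 * (tsq k z.2 / tsq 0 z.2))].
Proof.
move=> inu kn n0 mA.
have mT (j : nat) : measurable_fun setT (@tsq R n j) by exact: measurable_tsq.
rewrite (@prob_integral_preim _ _ _ _ _ nu (tsq k) A)//.
have mH : measurable_fun setT (fun p : R * R => ((\1_A p.1 : R)%:E)).
  apply: (measurableT_comp (f := fun x => ((\1_A x : R)%:E))) => //.
  exact: measurable_indicE.
rewrite (tail_invariant_law (H := fun p : R * R => (\1_A p.1)%:E) (tail_invariant_rotation inu))//.
rewrite /product_measure1; apply: eq_integral => x _ /=.
rewrite -(@prob_integral_preim _ _ _ _ _ (gam n) (fun y => tsq 0 x * (tsq k y / tsq 0 y)) A)//.
  by congr (gam n _); apply/seteqP; split => y; rewrite /xsection /= inE.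
by apply: measurable_funM => //; exact: measurable_fun_div.
Qed.

(** On the product of the two laws, [n / a * tsq k x] is replaced by [t * tsq k y], where [y] is
    Gaussian and [t] is [sqnorm x / a] times [n / tsq 0 y]. Off three bad events, bounded by [del1],
    [del2] and [del3], the scale [t] lies in the range where [A (t * y)] implies [A' y]. *)
Lemma tail_compare n k (nu : probability 'rV[R]_n R) (a rho del1 del2 del3 : R)
    (A A' : set R) :
  rotation_invariant nu -> (k <= n)%N -> (0 < n)%N -> measurable A -> measurable A' ->
  0 < rho < 1 ->
  pr nu [set x | rho <= `|sqnorm x / a - 1|] <= del1 ->
  pr (gam n) [set y | tsq 0 y <= (1 - rho) * n%:R] <= del2 ->
  pr (gam n) [set y | (1 + rho) * n%:R <= tsq 0 y] <= del3 ->
  (forall t y, (1 - rho) / (1 + rho) <= t <= (1 + rho) / (1 - rho) -> 0 <= y ->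
     A (t * y) -> A' y) ->
  pr nu [set x | A (n%:R / a * tsq k x)] <=
  pr (gam n) [set y | A' (tsq k y)] + (del1 + del2 + del3).
Proof.
move=> inu kn n0 mA mA' /andP[rho0 rho1] h1 h2 h3 AA'.
have mT (j : nat) : measurable_fun setT (@tsq R n j) by exact: measurable_tsq.
pose Q : probability ('rV[R]_n * 'rV[R]_n)%type R := (nu \x gam n)%E.
pose Bx := [set x : 'rV[R]_n | rho <= `|sqnorm x / a - 1|].
pose By := [set y : 'rV[R]_n | tsq 0 y <= (1 - rho) * n%:R].
pose Bz := [set y : 'rV[R]_n | (1 + rho) * n%:R <= tsq 0 y].
have mitv (c : R) : measurable [set y : R | c <= y].
  by rewrite (_ : [set y | _] = `[c, +oo[%classic)//; apply/seteqP; split => y; rewrite /= in_itv/= andbT.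
have mitv' (c : R) : measurable [set y : R | y <= c].
  by rewrite (_ : [set y | _] = `]-oo, c]%classic)//; apply/seteqP; split => y; rewrite /= in_itv.
have mBx : measurable Bx.
  apply: (@measurable_preim _ _ _ _ (fun x : 'rV[R]_n => `|sqnorm x / a - 1|) [set y | rho <= y]) => //.
  apply: measurableT_comp => //; apply: measurable_funB => //; apply: measurable_funM => //.
  exact: measurable_sqnorm.
have mBy : measurable By by exact: (@measurable_preim _ _ _ _ (tsq 0) [set y | y <= (1 - rho) * n%:R]).
have mBz : measurable Bz by exact: (@measurable_preim _ _ _ _ (tsq 0) [set y | (1 + rho) * n%:R <= y]).
have Q1 (B : set 'rV[R]_n) : measurable B -> pr Q (B `*` setT) = pr nu B.
  move=> mB; rewrite /pr; congr fine; rewrite -[RHS]mule1 -[X in _ = (_ * X)%E](@probability_setT _ _ _ (gam n)).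
  exact: product_measure1E.
have Q2 (B : set 'rV[R]_n) : measurable B -> pr Q (setT `*` B) = pr (gam n) B.
  move=> mB; rewrite /pr; congr fine; rewrite -[RHS]mul1e -[X in _ = (X * _)%E](@probability_setT _ _ _ nu).
  exact: product_measure1E.
have mA1 : measurable [set u : R | A (n%:R / a * u)].
  by apply: measurable_preim => //; exact: mulrl_measurable.
rewrite [leLHS]/pr (rotation_law inu kn n0 mA1) -/(pr Q _).
pose E := [set z : 'rV[R]_n * 'rV[R]_n | A (n%:R / a * (tsq 0 z.1 * (tsq k z.2 / tsq 0 z.2)))].
have mE : measurable E.
  apply: (@measurable_preim _ _ _ _ (fun z : 'rV[R]_n * 'rV[R]_n => n%:R / a * (tsq 0 z.1 * (tsq k z.2 / tsq 0 z.2)))) => //.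
  apply: measurable_funM => //; apply: measurable_funM; first exact: measurableT_comp.
  by apply: measurable_fun_div; exact: measurableT_comp.
have mA'k : measurable [set y : 'rV[R]_n | A' (tsq k y)] by exact: measurable_preim.
rewrite -/E -Q2//.
have mX1 : measurable (Bx `*` [set: 'rV[R]_n]) by exact: measurableX.
have mX2 : measurable ([set: 'rV[R]_n] `*` By) by exact: measurableX.
have mX3 : measurable ([set: 'rV[R]_n] `*` Bz) by exact: measurableX.
have mX4 : measurable ([set: 'rV[R]_n] `*` [set y : 'rV[R]_n | A' (tsq k y)]) by exact: measurableX.
have mU1 := measurableU _ _ mX2 mX3.
have mU2 := measurableU _ _ mX1 mU1.
apply: (le_trans (@pr_le_setU _ _ _ Q _ _ _ mE mX4 mU2 _)).
  move=> [x y] /= Exy; have [xB|xB] := pselect (Bx x); first by right; left.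
  have [yB|yB] := pselect (By y); first by right; right; left.
  have [zB|zB] := pselect (Bz y); first by right; right; right.
  left; split => //=.
  move/negP: xB; rewrite -ltNge ltr_distl => /andP[xa xb].
  move/negP: yB; rewrite -ltNge => ya.
  move/negP: zB; rewrite -ltNge => yb.
  have n0' : 0 < n%:R :> R by rewrite ltr0n.
  apply: (AA' (sqnorm x / a * (n%:R / tsq 0 y))).
  - by apply: ratio_bounds; rewrite ?rho0 ?xa ?ya.
  - exact: tsq_ge0.
  - move: Exy; rewrite /E /= -tsq0; congr A.
    by rewrite !mulrA; ring.
rewrite lerD2l; apply: (le_trans (pr_setU _ mX1 mU1)).
rewrite -addrA; apply: lerD; first by rewrite Q1.
by apply: (le_trans (pr_setU _ mX2 mX3)); apply: lerD; rewrite Q2.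
Qed.

End tail_comparison.

(** * Geometric rates *)

Section rates.
Context {R : realType}.

Lemma cvg_geom0 (q : R) : 0 <= q < 1 -> (q ^+ n) @[n --> \oo] --> 0.
Proof. by move=> /andP[q0 q1]; apply: cvg_expr; rewrite ger0_norm. Qed.

(** With [r] the square root of [q], the sequence [n r^n] is bounded, so [n q^n] is at most a
    constant times [r^n]. *)
Lemma cvg_natM_geom0 (q : R) : 0 < q < 1 -> (n%:R * q ^+ n) @[n --> \oo] --> 0.
Proof.
move=> /andP[q0 q1]; pose r := Num.sqrt q.
have r0 : 0 < r by rewrite sqrtr_gt0.
have r2 : r ^+ 2 = q by rewrite sqr_sqrtr// ltW.
have r1 : r < 1 by rewrite -(@ltr_pXn2r _ 2)// ?nnegrE ?ltW// r2 expr1n.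
have bern n : n%:R * r ^+ n * (1 - r) <= 1.
  elim: n => [|n IH]; first by rewrite !mul0r.
  have rn0 : 0 <= r ^+ n by rewrite exprn_ge0// ltW.
  have rn1 : r ^+ n <= 1 by rewrite exprn_ile1// ltW.
  rewrite exprS -natr1.
  have h1 : (n%:R * r ^+ n * (1 - r)) * r <= r by rewrite ler_piMl// ltW.
  have h2 : (1 - r) * (r * r ^+ n) <= 1 - r.
    by rewrite ler_piMr ?subr_ge0 ?(ltW r1)// mulr_ile1// ltW.
  rewrite (_ : _ * _ * _ = n%:R * r ^+ n * (1 - r) * r + (1 - r) * (r * r ^+ n)); last by ring.
  by lra.
apply: (@squeeze_cvgr _ _ _ _ (fun=> 0) (fun n => (1 - r)^-1 * r ^+ n)).
- near=> n; apply/andP; split; first by rewrite mulr_ge0// exprn_ge0// ltW.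
  rewrite -r2 -exprM mulnC exprM expr2 mulrA ler_wpM2r ?exprn_ge0 ?(ltW r0)//.
  by rewrite -[leRHS]mul1r ler_pdivlMr ?subr_gt0.
- exact: cvg_cst.
- rewrite -(mulr0 (1 - r)^-1); apply: cvgM; first exact: cvg_cst.
  by apply: cvg_geom0; rewrite r1 ltW.
Unshelve. all: by end_near.
Qed.

Lemma geom_sum_le (q : R) m n : 0 <= q < 1 ->
  \sum_(m <= i < n) q ^+ i <= q ^+ m / (1 - q).
Proof.
move=> /andP[q0 q1]; have h : 0 < 1 - q by rewrite subr_gt0.
rewrite ler_pdivlMr//.
have [nm|/ltnW mn] := leqP n m; first by rewrite big_geq// mul0r exprn_ge0.
rewrite mulr_suml (telescope_sumr_eq (fun i => - q ^+ i))//.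
  by rewrite opprK addrC lerBlDr lerDl exprn_ge0.
by move=> i _; rewrite exprS; ring.
Qed.

End rates.

(** * Comparison under the concentration assumption *)

Section concentration.
Context {R : realType}.
Variable nu : forall n : nat, probability 'rV[R]_n R.
Hypotheses (snu : spherical_model nu) (cnu : norm_concentration nu).

Lemma spherical_rotation n : (0 < n)%N -> rotation_invariant (nu n).
Proof. by move=> n0 Q A; case: (snu n0) => + _; exact. Qed.

(** The factor [n] in front of [del n] stands for the number of ratios in a later union bound; it is
    affordable because all the errors are geometric. The set [A'] absorbs every rescaling by a
    factor between [kap^-1] and [kap]. *)
Lemma concentration_compare : exists2 a : nat -> R, (\forall n \near \oo, 0 < a n) &
  forall kap : R, 1 < kap -> exists del : nat -> R,
    [/\ n%:R * del n @[n --> \oo] --> 0, (forall n, 0 <= del n) &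
     forall n k (A A' : set R), (0 < n)%N -> (k <= n)%N ->
       measurable A -> measurable A' ->
       (forall t y, kap^-1 <= t <= kap -> 0 <= y -> A (t * y) -> A' y) ->
       pr (nu n) [set x | A (n%:R / a n * tsq k x)] <=
       pr (gam n) [set y | A' (tsq k y)] + del n].
Proof.
case: cnu => a [d1 [d2 [alpha [rho0 [a0 [d10 d20 alpha0] /andP[rho00 rho01] conc]]]]].
pose e (rho : R) n := d1 * expR (- (d2 * rho `^ alpha)) ^+ n.
have conc' n rho : (0 < n)%N -> 0 < rho < rho0 ->
    pr (nu n) [set x | rho <= `|sqnorm x / a n - 1|] <= e rho n.
  move=> n0 rho_; have := conc n rho n0 rho_.
  rewrite -mulrA -mulrN expRM_natl => h.
  rewrite -lee_fin -prE//.
  apply: (@measurable_preim _ _ _ _ (fun x : 'rV[R]_n => `|sqnorm x / a n - 1|) [set y | rho <= y]).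
    apply: measurableT_comp => //; apply: measurable_funB => //; apply: measurable_funM => //.
    exact: measurable_sqnorm.
  by rewrite (_ : [set y | _] = `[rho, +oo[%classic)//; apply/seteqP; split => y; rewrite /= in_itv/= andbT.
have q01 (rho : R) : 0 < rho -> 0 < expR (- (d2 * rho `^ alpha)) < 1.
  move=> r0; rewrite expR_gt0/= expR_lt1 oppr_lt0 mulr_gt0// powR_gt0//.
have e_cvg rho : 0 < rho -> e rho n @[n --> \oo] --> 0.
  move=> r0; rewrite -(mulr0 d1); apply: cvgM; first exact: cvg_cst.
  by apply: cvg_geom0; have /andP[/ltW -> ->] := q01 _ r0.
exists a.
  have r0 : 0 < rho0 / 2 by rewrite divr_gt0.
  have r1 : rho0 / 2 < rho0 by lra.
  have : \forall n \near \oo, e (rho0 / 2) n < 1.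
    by apply: (cvgr_lt _ (e_cvg _ r0)).
  move=> h; near=> n.
  have n0 : (0 < n)%N by near: n; exact: nbhs_infty_gt.
  (* A negative [a n] would make the deviation event certain, whereas its probability is less than 1
     for large [n]. *)
  rewrite lt_neqAle eq_sym a0//= leNgt; apply/negP => an0.
  have := conc' n (rho0 / 2) n0; rewrite r0 r1 => /(_ isT).
  rewrite (_ : [set x | _] = setT).
    by rewrite pr_setT leNgt => /negP; apply; near: n.
  apply/seteqP; split => // x _ /=.
  rewrite ler_normr; apply/orP; right; rewrite opprB.
  have : sqnorm x / a n <= 0 by rewrite mulr_ge0_le0 ?sqnorm_ge0// invr_le0 ltW.
  by lra.
move=> kap kap1.
(* For [rho = (kap - 1) / (kap + 1)] the quotient [(1 + rho) / (1 - rho)] is exactly [kap]; the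
   minimum keeps [rho] below [rho0]. *)
pose rho := Num.min ((kap - 1) / (kap + 1)) (rho0 / 2).
have k1 : 0 < kap + 1 by lra.
have rho_gt0 : 0 < rho by rewrite lt_min !divr_gt0//; lra.
have rho_lt : rho < rho0.
  by apply: (@le_lt_trans _ _ (rho0 / 2)); [rewrite /rho ge_min lexx orbT|lra].
have rho_le : rho <= (kap - 1) / (kap + 1) by rewrite /rho ge_min lexx.
have rho1 : rho < 1 by lra.
have hk : (1 + rho) / (1 - rho) <= kap.
  move: rho_le; rewrite ler_pdivlMr// => h.
  by rewrite ler_pdivrMr ?subr_gt0//; lra.
have hk' : kap^-1 <= (1 - rho) / (1 + rho).
  rewrite -[leRHS]invrK lef_pV2 ?posrE ?invr_gt0 ?divr_gt0 ?subr_gt0//; try lra.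
have [|q1 [/andP[q10 q11] hq1]] := @gam_lower_tail R (1 - rho); first lra.
have [|q2 [/andP[q20 q21] hq2]] := @gam_upper_tail R (1 + rho); first lra.
exists (fun n => e rho n + q1 ^+ n + q2 ^+ n); split.
- rewrite (_ : (fun n => _) = (fun n => d1 * (n%:R * expR (- (d2 * rho `^ alpha)) ^+ n) + n%:R * q1 ^+ n + n%:R * q2 ^+ n)); last first.
    by apply/funext => n; rewrite /e; ring.
  rewrite [X in _ --> X](_ : _ = d1 * 0 + 0 + 0); last by rewrite mulr0 !addr0.
  apply: cvgD; last by apply: cvg_natM_geom0; rewrite q20.
  apply: cvgD; last by apply: cvg_natM_geom0; rewrite q10.
  apply: cvgM; first exact: cvg_cst.
  by apply: cvg_natM_geom0; exact: q01.
- move=> n; rewrite !addr_ge0 ?exprn_ge0 ?ltW//.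
  by rewrite mulr_gt0// exprn_gt0// expR_gt0.
- move=> n k A A' n0 kn mA mA' AA'.
  have mge (c : R) : measurable [set y : 'rV[R]_n | c <= tsq 0 y].
    apply: (@measurable_preim _ _ _ _ (tsq 0) [set y | c <= y]); first exact: measurable_tsq.
    by rewrite (_ : [set y | _] = `[c, +oo[%classic)//; apply/seteqP; split => y; rewrite /= in_itv/= andbT.
  have mle (c : R) : measurable [set y : 'rV[R]_n | tsq 0 y <= c].
    apply: (@measurable_preim _ _ _ _ (tsq 0) [set y | y <= c]); first exact: measurable_tsq.
    by rewrite (_ : [set y | _] = `]-oo, c]%classic)//; apply/seteqP; split => y; rewrite /= in_itv.
  apply: (@tail_compare R n k (nu n) (a n) rho) => //.
  + exact: spherical_rotation.
  + by rewrite rho_gt0.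
  + by apply: conc' => //; rewrite rho_gt0.
  + by rewrite -lee_fin -prE.
  + by rewrite -lee_fin -prE.
  + move=> t y /andP[t1 t2]; apply: AA'.
    by rewrite (le_trans hk' t1) (le_trans t2 hk).
Unshelve. all: by end_near.
Qed.

End concentration.

(** * Limit law and uniform tails of a single length *)

Section marginal_limits.
Context {R : realType}.

Lemma measurable_le_set (c : R) : measurable [set y : R | y <= c].
Proof.
by rewrite (_ : [set y | _] = `]-oo, c]%classic)//; apply/seteqP; split => y; rewrite /= in_itv.
Qed.

Lemma measurable_ge_set (c : R) : measurable [set y : R | c <= y].
Proof.
by rewrite (_ : [set y | _] = `[c, +oo[%classic)//; apply/seteqP; split => y; rewrite /= in_itv/= andbT.
Qed.

Lemma measurable_lt_set (c : R) : measurable [set y : R | y < c].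
Proof.
by rewrite (_ : [set y | _] = `]-oo, c[%classic)//; apply/seteqP; split => y; rewrite /= in_itv.
Qed.

Lemma measurable_gt_set (c : R) : measurable [set y : R | c < y].
Proof.
by rewrite (_ : [set y | _] = `]c, +oo[%classic)//; apply/seteqP; split => y; rewrite /= in_itv/= andbT.
Qed.

Lemma pr_nonincreasing_cvg d (T : measurableType d) (P : probability T R) (F : nat -> set T) :
  (forall n, measurable (F n)) -> (forall n, F n.+1 `<=` F n) ->
  pr P (F n) @[n --> \oo] --> pr P (\bigcap_n F n).
Proof.
move=> mF dF.
have mI : measurable (\bigcap_n F n) by exact: bigcapT_measurable.
have dF' : nonincreasing_seq F.
  apply/nonincreasing_seqP => n; apply/subsetPset; exact: dF.
have h := @nonincreasing_cvg_mu _ _ R P F _ mF mI dF'.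
apply: fine_cvg; rewrite -prE//; apply: h.
by rewrite ltey_eq fin_num_measure.
Qed.

Lemma pr_nondecreasing_cvg d (T : measurableType d) (P : probability T R) (F : nat -> set T) :
  (forall n, measurable (F n)) -> (forall n, F n `<=` F n.+1) ->
  pr P (F n) @[n --> \oo] --> pr P (\bigcup_n F n).
Proof.
move=> mF dF.
have mU : measurable (\bigcup_n F n) by exact: bigcupT_measurable.
have dF' : nondecreasing_seq F.
  apply/nondecreasing_seqP => n; apply/subsetPset; exact: dF.
have h := @nondecreasing_cvg_mu _ _ R P F mF mU dF'.
by apply: fine_cvg; rewrite -prE.
Qed.

Lemma atomless_small (P : probability (measurableTypeR R) R) (x eps : R) : P [set x] = 0%E ->
  0 < eps -> exists2 eta : R, 0 < eta & pr P [set y | x - eta <= y <= x + eta] < eps.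
Proof.
move=> Px eps0.
pose F n := [set y : R | x - n.+1%:R^-1 <= y <= x + n.+1%:R^-1].
have mF n : measurable (F n : set (measurableTypeR R)).
  by rewrite (_ : F n = `[x - n.+1%:R^-1, x + n.+1%:R^-1]%classic).
have dF n : F n.+1 `<=` F n.
  have h : n.+2%:R^-1 <= n.+1%:R^-1 :> R by rewrite lef_pV2 ?posrE ?ltr0n// ler_nat.
  move=> y; rewrite /F /=; move: (_%:R^-1) (_%:R^-1) h => u v uv /andP[h1 h2].
  by apply/andP; split; lra.
have := @pr_nonincreasing_cvg _ _ P F mF dF.
rewrite (_ : \bigcap_n F n = [set x]); last first.
  apply/seteqP; split => y; last first.
    move=> -> n _; rewrite /F /=.
    have h0 : 0 <= n.+1%:R^-1 :> R by [].
    by rewrite lerBlDr !lerDl h0.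
  move=> h; apply/eqP; rewrite -subr_eq0 -normr_eq0; apply/eqP.
  apply/le_anti; rewrite normr_ge0 andbT.
  apply/ler_addgt0Pl => e e0; rewrite addr0.
  have [n ne] : exists n, n.+1%:R^-1 < e.
    by have [n] := ltr_add_invr e0; rewrite add0r; exists n.
  have := h n I; rewrite /F /= ler_distl; move: (_%:R^-1) ne => w ne /andP[h1 h2].
  by apply/andP; split; lra.
rewrite {2}/pr Px /= => /(cvgr_lt _) /(_ _ eps0) [N _ /(_ N (leqnn N)) h].
by exists N.+1%:R^-1.
Qed.

Variable nu : forall n : nat, probability 'rV[R]_n R.
Variable a : nat -> R.
(** The comparison is assumed for an arbitrary pair [nu], [a], so that the section serves twice: for
    the spherical model, and for the Gaussian law itself with [a n = n]. *)
Hypothesis cmp : forall kap : R, 1 < kap -> exists del : nat -> R,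
    [/\ n%:R * del n @[n --> \oo] --> 0, (forall n, 0 <= del n) &
     forall n k (A A' : set R), (0 < n)%N -> (k <= n)%N ->
       measurable A -> measurable A' ->
       (forall t y, kap^-1 <= t <= kap -> 0 <= y -> A (t * y) -> A' y) ->
       pr (nu n) [set x | A (n%:R / a n * tsq k x)] <=
       pr (gam n) [set y | A' (tsq k y)] + del n].

Lemma natM_cvg0 (u : nat -> R) : (forall n, 0 <= u n) ->
  n%:R * u n @[n --> \oo] --> 0 -> u n @[n --> \oo] --> 0.
Proof.
move=> u0 h; apply: (@squeeze_cvgr _ _ _ _ (fun=> 0) (fun n => n%:R * u n)) => //; last exact: cvg_cst.
near=> n; rewrite u0 /=; apply: ler_peMl => //.
by rewrite ler1n; near: n; exact: nbhs_infty_gt.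
Unshelve. all: by end_near.
Qed.

Lemma pr_gam_tsq n m (A : set R) : (m <= n)%N -> measurable A ->
  pr (gam n) [set y | A (tsq (n - m) y)] = pr (chi m) A.
Proof.
by move=> mn mA; rewrite /pr (gam_tsq (leq_subr m n) mA) subKn.
Qed.

(** The comparison bounds from above; the lower bound comes from the complementary event. A
    rescaling by [kap] moves the threshold by at most [eta], inside an interval of small mass since
    the chi-square law has no atom. *)
Lemma marginal_cdf_cvg m (x : R) : (0 < m)%N ->
  pr (nu n) [set z | n%:R / a n * tsq (n - m) z <= x] @[n --> \oo] -->
  pr (chi m) [set y | y <= x].
Proof.
move=> m0; apply/cvgrPdist_le => eps eps0.
have [||eta eta0 heta] := @atomless_small (chi m) x (eps / 2).
- exact: chi_set1.
- by rewrite divr_gt0.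
have mI : measurable ([set y : R | x - eta <= y <= x + eta] : set (measurableTypeR R)).
  by rewrite (_ : [set y | _] = `[x - eta, x + eta]%classic).
(* This gives [|x| (kap - 1) <= eta]; the added 1 covers [x = 0]. *)
pose kap := 1 + eta / (`|x| + 1).
have x1 : 0 < `|x| + 1 by rewrite ltr_wpDl.
have kap1 : 1 < kap by rewrite ltrDl divr_gt0.
have kx : `|x| * (kap - 1) <= eta.
  rewrite /kap (addrC 1) addrK mulrA ler_pdivrMr// mulrC ler_pM2l//.
  by rewrite lerDl.
have [del [d0 dge hcmp]] := cmp kap1.
have e2 : 0 < eps / 2 by rewrite divr_gt0.
have dsmall : \forall n \near \oo, del n < eps / 2.
  by apply: (cvgr_lt _ (natM_cvg0 dge d0)).
have kx1 : kap * x <= x + eta.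
  have := ler_norm (x * (kap - 1)); rewrite normrM (gtr0_norm (_ : 0 < kap - 1)); last lra.
  by lra.
have kx2 : x - eta <= x / kap.
  rewrite ler_pdivlMr; last lra.
  have h : - x * (kap - 1) <= `|x| * (kap - 1) by rewrite ler_wpM2r ?subr_ge0 ?(ltW kap1)// -normrN ler_norm.
  have h2 : 0 <= eta * (kap - 1) by rewrite mulr_ge0 ?ltW// subr_gt0.
  have h3 : x * (kap - 1) <= `|x| * (kap - 1) by rewrite ler_wpM2r ?subr_ge0 ?(ltW kap1)// ler_norm.
  by lra.
near=> n.
have n0 : (0 < n)%N by near: n; exact: nbhs_infty_gt.
have mn : (m <= n)%N by near: n; exact: nbhs_infty_ge.
have dn : del n < eps / 2 by near: n.
have mS : measurable [set z : 'rV[R]_n | n%:R / a n * tsq (n - m) z <= x].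
  apply: (@measurable_preim _ _ _ _ (fun z : 'rV[R]_n => n%:R / a n * tsq (n - m) z) [set y | y <= x]).
    by apply: measurable_funM => //; exact: measurable_tsq.
  exact: measurable_le_set.
rewrite ler_distl; apply/andP; split.
- have := hcmp n (n - m)%N [set y | y <= x] [set y | y <= kap * x] n0 (leq_subr _ _)
    (measurable_le_set _) (measurable_le_set _).
  rewrite pr_gam_tsq//; last exact: measurable_le_set.
  have h : pr (chi m) [set y | y <= kap * x] <= pr (chi m) [set y | y <= x] +
      pr (chi m) [set y | x - eta <= y <= x + eta].
    apply: pr_le_setU => //; try exact: measurable_le_set.
    move=> y /= ykx; have [yx|yx] := lerP y x; first by left.
    by right; apply/andP; split; lra.
  move=> /(_ _) h2; rewrite lerBlDr.
  apply: (le_trans (h2 _)); last lra.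
  move=> t y /andP[t1 _] y0 /= tyx.
  have k0 : 0 < kap by lra.
  rewrite mulrC -ler_pdivrMr// (le_trans _ tyx)// mulrC ler_wpM2r//.
- have := hcmp n (n - m)%N [set y | x < y] [set y | x / kap < y] n0 (leq_subr _ _)
    (measurable_gt_set _) (measurable_gt_set _).
  rewrite pr_gam_tsq//; last exact: measurable_gt_set.
  rewrite (_ : [set z : 'rV[R]_n | _] = ~` [set z : 'rV[R]_n | n%:R / a n * tsq (n - m) z <= x]); last first.
    by apply/seteqP; split => z /=; rewrite ltNge => /negP.
  rewrite pr_setC//.
  rewrite (_ : [set y : R | x / kap < y] = ~` [set y : R | y <= x / kap]); last first.
    by apply/seteqP; split => z /=; rewrite ltNge => /negP.
  rewrite pr_setC; last exact: measurable_le_set.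
  have h : pr (chi m) [set y | y <= x] <= pr (chi m) [set y | y <= x / kap] +
      pr (chi m) [set y | x - eta <= y <= x + eta].
    apply: pr_le_setU => //; try exact: measurable_le_set.
    move=> y /= yx; have [yx'|yx'] := lerP y (x / kap); first by left.
    by right; apply/andP; split; lra.
  move=> h2; have : 1 - pr (nu n) [set z | n%:R / a n * tsq (n - m) z <= x] <=
     1 - pr (chi m) [set y | y <= x / kap] + del n.
    apply: h2 => t y /andP[_ t2] y0 /= xty.
    have k0 : 0 < kap by lra.
    by apply/negP; rewrite -ltNge ltr_pdivrMr// (lt_le_trans xty)// mulrC ler_wpM2l.
  by lra.
Unshelve. all: by end_near.
Qed.

Lemma pr_itv d (T : measurableType d) (P : probability T R) (f : T -> R) (u v : R) :
  measurable_fun setT f -> u < v ->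
  pr P [set t | `]u, v]%classic (f t)] = pr P [set t | f t <= v] - pr P [set t | f t <= u].
Proof.
move=> mf uv.
have mu_ : measurable [set t | f t <= u].
  exact: (measurable_preim mf (measurable_le_set u)).
have mitv : measurable [set t | `]u, v]%classic (f t)] by exact: measurable_preim.
have -> : [set t | f t <= v] = [set t | f t <= u] `|` [set t | `]u, v]%classic (f t)].
  apply/seteqP; split => y /=; rewrite in_itv/=; last by case; lra.
  by move=> yv; have [|] := lerP (f y) u; [left|right; lra].
rewrite pr_setUI// (_ : _ `&` _ = set0); last first.
  by apply/seteqP; split => y //= []; rewrite in_itv/=; lra.
by rewrite pr_set0 subr0 addrAC subrr add0r.
Qed.

Lemma marginal_itv_cvg m (u v : R) : (0 < m)%N ->
  pr (nu n) [set z | `]u, v]%classic (n%:R / a n * tsq (n - m) z)] @[n --> \oo] -->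
  pr (chi m) `]u, v]%classic.
Proof.
move=> m0; have [vu|uv] := leP v u.
  have e : `]u, v]%classic = set0 :> set R by apply/seteqP; split => y //=; rewrite in_itv/=; lra.
  rewrite e pr_set0; apply: cvg_near_cst; near=> n.
  by rewrite (_ : [set z | _] = set0) ?pr_set0.
have mZ n : measurable_fun setT (fun z : 'rV[R]_n => n%:R / a n * tsq (n - m) z).
  by apply: measurable_funM => //; exact: measurable_tsq.
rewrite -[pr (chi m) _]/(pr (chi m) [set y : measurableTypeR R | `]u, v]%classic y]).
rewrite (pr_itv (chi m) (f := id))//.
rewrite (_ : (fun n => _) = fun n => pr (nu n) [set z | n%:R / a n * tsq (n - m) z <= v] -
   pr (nu n) [set z | n%:R / a n * tsq (n - m) z <= u]).
  by apply: cvgB; exact: marginal_cdf_cvg.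
by apply/funext => n; exact: (pr_itv (nu n) (mZ n) uv).
Unshelve. all: by end_near.
Qed.

(** If a length with [l.+1] degrees of freedom is at most [t] times the next one, then it is at most
    [c * l.+1], or the next one is at least [c / t * l.+1]. As [t < c < 1], both are large
    deviations. *)
Lemma marginal_tails (t : R) : 0 < t < 1 ->
  exists (c q : R) (M : nat) (del : nat -> R), [/\ 0 < c, 0 < q < 1,
    n%:R * del n @[n --> \oo] --> 0, (forall n, 0 <= del n) &
    forall n l, (M <= l)%N -> (l.+1 < n)%N ->
      pr (nu n) [set z | n%:R / a n * tsq (n - l.+1) z <= c * l.+1%:R] <= q ^+ l + del n /\
      pr (nu n) [set z | c / t * l.+1%:R <= n%:R / a n * tsq (n - l.+2) z] <= q ^+ l + del n].
Proof.
move=> /andP[t0 t1]; pose c := (1 + t) / 2.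
have c0 : 0 < c by rewrite /c; lra.
have c1 : c < 1 by rewrite /c; lra.
have ct : t < c by rewrite /c; lra.
(* The distortion must leave room on both sides, [kap * c < 1] and [1 < c / t / kap]; it is taken
   midway between 1 and the smaller bound. *)
pose kap := (1 + Num.min c^-1 (c / t)) / 2.
have cV : 1 < c^-1 by rewrite invf_gt1.
have ct1 : 1 < c / t by rewrite ltr_pdivlMr// mul1r.
have km : 1 < Num.min c^-1 (c / t) by rewrite lt_min cV.
have kap1 : 1 < kap by rewrite /kap; lra.
have kap0 : 0 < kap by lra.
have kc : kap * c < 1.
  rewrite -ltr_pdivlMr// mul1r; apply: (@lt_le_trans _ _ (Num.min c^-1 (c / t))); first by rewrite /kap; lra.
  by rewrite ge_min lexx.
have kct : 1 < c / t / kap.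
  rewrite ltr_pdivlMr// mul1r; apply: (@lt_le_trans _ _ (Num.min c^-1 (c / t))); first by rewrite /kap; lra.
  by rewrite ge_min lexx orbT.
(* The upper tail is applied with [l.+2] degrees of freedom and rate [c2]; the gap between [c2] and
   [c / t / kap] makes up for the threshold being stated with [l.+1], as soon as [l] is at least
   [M]. *)
pose c2 := (1 + c / t / kap) / 2.
have c21 : 1 < c2 by rewrite /c2; lra.
have c22 : c2 < c / t / kap by rewrite /c2; lra.
have [|q1 [/andP[q10 q11] hq1]] := @gam_lower_tail R (kap * c); first by rewrite mulr_gt0.
have [|q2 [/andP[q20 q21] hq2]] := @gam_upper_tail R c2; first by [].
have [del [d0 dge hcmp]] := cmp kap1.
pose q := Num.max q1 q2.
have q0 : 0 < q by rewrite lt_max q10.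
have q1' : q < 1 by rewrite gt_max q11.
have [M hM] : exists M : nat, c2 / (c / t / kap - c2) < M%:R.
  have := archi_boundP (_ : 0 <= c2 / (c / t / kap - c2)).
  by move=> h; eexists; apply: h; rewrite divr_ge0 ?subr_ge0// ltW// (lt_trans _ c21).
exists c, q, M, del; split => //; first by rewrite q0.
move=> n l Ml ln; have n0 : (0 < n)%N by exact: leq_ltn_trans ln.
have l0 : 0 < l.+1%:R :> R by rewrite ltr0n.
split.
- have := hcmp n (n - l.+1)%N [set y | y <= c * l.+1%:R] [set y | y <= kap * c * l.+1%:R]
    n0 (leq_subr _ _) (measurable_le_set _) (measurable_le_set _).
  rewrite pr_gam_tsq//; [|exact: ltnW|exact: measurable_le_set] => h.
  apply: (le_trans (h _)).
    move=> s y /andP[s1 _] y0 /= syx.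
    rewrite -mulrA mulrC -ler_pdivrMr// (le_trans _ syx)// mulrC ler_wpM2r//.
  rewrite lerD2r; apply: (@le_trans _ _ (q1 ^+ l.+1)).
    rewrite -lee_fin -prE; first exact: hq1.
    exact: measurable_le_set.
  rewrite exprS; apply: (@le_trans _ _ (q1 ^+ l)); first by rewrite ler_piMl ?exprn_ge0// ltW.
  by apply: lerXn2r; rewrite ?nnegrE ?(ltW q10) ?(ltW q0)// /q le_max lexx.
- have := hcmp n (n - l.+2)%N [set y | c / t * l.+1%:R <= y] [set y | c2 * l.+2%:R <= y]
    n0 (leq_subr _ _) (measurable_ge_set _) (measurable_ge_set _).
  rewrite pr_gam_tsq//; last exact: measurable_ge_set.
  move=> h; apply: (le_trans (h _)).
    move=> s y /andP[_ s2] y0 /= csy.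
    have h1 : c / t / kap * l.+1%:R <= y.
      rewrite mulrAC ler_pdivrMr// (le_trans csy)// mulrC ler_wpM2l//.
    apply: le_trans h1.
    have h2 : c2 < (c / t / kap - c2) * l.+1%:R.
      rewrite mulrC -ltr_pdivrMr ?subr_gt0//; apply: (lt_le_trans hM).
      by rewrite ler_nat (leq_trans Ml).
    by rewrite -(natr1 l.+1) mulrDr mulr1; lra.
  rewrite lerD2r; apply: (@le_trans _ _ (q2 ^+ l.+2)).
    rewrite -lee_fin -prE; first exact: hq2.
    exact: measurable_ge_set.
  rewrite !exprS mulrA; apply: (@le_trans _ _ (q2 ^+ l)).
    by rewrite ler_piMl ?exprn_ge0 ?(ltW q20)// mulr_ile1 ?(ltW q20) ?(ltW q21).
  by apply: lerXn2r; rewrite ?nnegrE ?(ltW q20) ?(ltW q0)// /q le_max lexx orbT.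
Qed.

End marginal_limits.

(** * Weak convergence from convergence on boxes *)

Section portmanteau.
Context {R : realType} {K : nat}.
Implicit Types (ab : {ffun 'I_K -> R * R}) (l : seq {ffun 'I_K -> R * R}).

(** Half-open boxes are stable under intersection, and finite functions as indices make the rational
    ones enumerable by [pickle]. *)
Definition box ab : set 'rV[R]_K :=
  [set x | forall i, `](ab i).1, (ab i).2]%classic (x ord0 i)].

Definition boxI ab ab' : {ffun 'I_K -> R * R} :=
  [ffun i => (Num.max (ab i).1 (ab' i).1, Num.min (ab i).2 (ab' i).2)].

Definition boxU l : set 'rV[R]_K := [set x | exists2 ab, ab \in l & box ab x].

Lemma box_setI ab ab' : box ab `&` box ab' = box (boxI ab ab').
Proof.
apply/seteqP; split => x /=.
  move=> [h1 h2] i; have := h1 i; have := h2 i; rewrite ffunE /= !in_itv /=.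
  by move=> /andP[a1 a2] /andP[b1 b2]; rewrite gt_max le_min a1 a2 b1 b2.
move=> h; split => i; have := h i; rewrite ffunE /= !in_itv /= gt_max le_min.
  by move=> /andP[/andP[-> _] /andP[-> _]].
by move=> /andP[/andP[_ ->] /andP[_ ->]].
Qed.

Lemma measurable_box ab : measurable (box ab).
Proof.
apply: (@measurable_forall_ord _ _ _ (fun i => [set x : 'rV[R]_K | `](ab i).1, (ab i).2]%classic (x ord0 i)])) => i.
by apply: measurable_preim => //; exact: measurable_rV_coord.
Qed.

Lemma boxU_cons ab l : boxU (ab :: l) = box ab `|` boxU l.
Proof.
apply/seteqP; split => x /=.
  move=> [ab']; rewrite inE => /orP[/eqP ->|abl] h; first by left.
  by right; exists ab'.
move=> [h|[ab' abl h]]; first by exists ab => //; rewrite inE eqxx.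
by exists ab' => //; rewrite inE abl orbT.
Qed.

Lemma boxU_nil : boxU [::] = set0.
Proof. by apply/seteqP; split => x //= []. Qed.

Lemma measurable_boxU l : measurable (boxU l).
Proof.
elim: l => [|ab l IH]; first by rewrite boxU_nil.
by rewrite boxU_cons; apply: measurableU => //; exact: measurable_box.
Qed.

Lemma boxU_setI ab l : box ab `&` boxU l = boxU [seq boxI ab ab' | ab' <- l].
Proof.
elim: l => [|ab' l IH]; first by rewrite boxU_nil setI0.
by rewrite /= !boxU_cons setIUr box_setI IH.
Qed.

Variables (mu_ : nat -> probability 'rV[R]_K R) (mu : probability 'rV[R]_K R).
Hypothesis box_cvg : forall ab, pr (mu_ n) (box ab) @[n --> \oo] --> pr mu (box ab).

(** Inclusion-exclusion by induction on the number of boxes: the intersection of one box with the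
    union of the others is a union over a list of the same length as these others. *)
Lemma boxU_cvg l : pr (mu_ n) (boxU l) @[n --> \oo] --> pr mu (boxU l).
Proof.
move sl : (size l) => m; elim: m l sl => [|m IH] [|ab l]//= sl.
  rewrite boxU_nil pr_set0; apply: cvg_near_cst; near=> n; exact: pr_set0.
case: sl => sl.
have E (P : probability 'rV[R]_K R) : pr P (boxU (ab :: l)) =
    pr P (box ab) + pr P (boxU l) - pr P (boxU [seq boxI ab ab' | ab' <- l]).
  by rewrite boxU_cons pr_setUI ?boxU_setI//; [exact: measurable_box|exact: measurable_boxU].
rewrite E (_ : (fun n => _) = fun n => pr (mu_ n) (box ab) + pr (mu_ n) (boxU l)
  - pr (mu_ n) (boxU [seq boxI ab ab' | ab' <- l])).
  by apply: cvgB; [apply: cvgD => //; exact: IH|apply: IH; rewrite size_map].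
by apply/funext => n; rewrite E.
Unshelve. all: by end_near.
Qed.

Definition rat_box (q : {ffun 'I_K -> rat * rat}) : {ffun 'I_K -> R * R} :=
  [ffun i => (ratr (q i).1, ratr (q i).2)].

Definition inner_boxes (U : set 'rV[R]_K) n : seq {ffun 'I_K -> R * R} :=
  [seq ab <- pmap (fun m => omap rat_box (unpickle m)) (iota 0 n) | `[< box ab `<=` U >]].

Lemma inner_boxes_sub (U : set 'rV[R]_K) n : boxU (inner_boxes U n) `<=` U.
Proof. by move=> x [ab]; rewrite mem_filter => /andP[/asboolP abU _]; exact: abU. Qed.

Lemma inner_boxes_nd (U : set 'rV[R]_K) n :
  boxU (inner_boxes U n) `<=` boxU (inner_boxes U n.+1).
Proof.
move=> x [ab abl abx]; exists ab => //; move: abl.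
rewrite !mem_filter => /andP[-> abl]; rewrite andTb.
by rewrite -(addn1 n) iotaD pmap_cat mem_cat abl.
Qed.

(** Each point of an open set has a rational box around it inside a ball for the sup norm, and this
    box has a code. *)
Lemma inner_boxes_cover (U : set 'rV[R]_K) : open U ->
  \bigcup_n boxU (inner_boxes U n) = U.
Proof.
move=> oU; apply/seteqP; split => x.
  by move=> [n _]; exact: inner_boxes_sub.
move=> Ux; have /nbhs_ballP[e /= e0 eU] : nbhs x U by exact: open_nbhs_nbhs.
have h1 i : exists q : rat, ratr q \in `]x ord0 i - e, x ord0 i[.
  by apply: rat_in_itvoo; rewrite ltrBlDr ltrDl.
have h2 i : exists q : rat, ratr q \in `]x ord0 i, x ord0 i + e[.
  by apply: rat_in_itvoo; rewrite ltrDl.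
have [q1 hq1] := choice h1; have [q2 hq2] := choice h2.
pose q := [ffun i => (q1 i, q2 i)] : {ffun 'I_K -> rat * rat}.
exists (pickle q).+1 => //; exists (rat_box q).
  rewrite mem_filter; apply/andP; split.
    apply/asboolP => y /= hy; apply: eU; split => // i j; rewrite (ord1 i).
    have := hy j; rewrite !ffunE /= in_itv /= => /andP[y1 y2].
    have := hq1 j; rewrite in_itv /= => /andP[a1 a2].
    have := hq2 j; rewrite in_itv /= => /andP[b1 b2].
    by rewrite /ball /= ltr_distl; apply/andP; split; lra.
  rewrite mem_pmap; apply/mapP; exists (pickle q); last by rewrite pickleK.
  by rewrite mem_iota add0n ltnSn.
move=> i; rewrite !ffunE /= in_itv /=.
have := hq1 i; rewrite in_itv /= => /andP[a1 a2].
have := hq2 i; rewrite in_itv /= => /andP[b1 b2].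
by rewrite a2 (ltW b1).
Qed.

Lemma measurable_open_rV (U : set 'rV[R]_K) : open U -> measurable U.
Proof.
move=> oU; rewrite -(inner_boxes_cover oU).
by apply: bigcupT_measurable => n; exact: measurable_boxU.
Qed.

Lemma portmanteau_open (U : set 'rV[R]_K) eps : open U -> 0 < eps ->
  \forall n \near \oo, pr mu U - eps < pr (mu_ n) U.
Proof.
move=> oU eps0; have e2 : 0 < eps / 2 by rewrite divr_gt0.
have := @pr_nondecreasing_cvg _ _ _ mu (fun n => boxU (inner_boxes U n))
  (fun n => measurable_boxU _) (fun n => @inner_boxes_nd U n).
rewrite inner_boxes_cover// => h.
have [N _ /(_ N (leqnn N)) hN] : \forall n \near \oo, pr mu U - eps / 2 < pr mu (boxU (inner_boxes U n)).
  by apply: (cvgr_gt _ h); rewrite ltrBlDr ltrDl.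
have h2 : \forall n \near \oo, pr mu (boxU (inner_boxes U N)) - eps / 2 < pr (mu_ n) (boxU (inner_boxes U N)).
  by apply: (cvgr_gt _ (@boxU_cvg (inner_boxes U N))); rewrite ltrBlDr ltrDl.
near=> n.
have h3 : pr (mu_ n) (boxU (inner_boxes U N)) <= pr (mu_ n) U.
  apply: pr_le; [exact: measurable_boxU|exact: measurable_open_rV|exact: inner_boxes_sub].
have h4 : pr mu (boxU (inner_boxes U N)) - eps / 2 < pr (mu_ n) (boxU (inner_boxes U N)) by near: n.
by lra.
Unshelve. all: by end_near.
Qed.

(** Asymptotic lower bounds on two disjoint open sets carrying the whole limit mass turn into an
    upper bound on each. The sets will be an event and its strict failure, the ties between them
    being null. *)
Lemma portmanteau_split (U V : set 'rV[R]_K) : open U -> open V -> U `&` V = set0 ->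
  pr mu (U `|` V) = 1 -> pr (mu_ n) U @[n --> \oo] --> pr mu U.
Proof.
move=> oU oV UV UV1.
have mU := measurable_open_rV oU; have mV := measurable_open_rV oV.
have splitE (P : probability 'rV[R]_K R) : pr P (U `|` V) = pr P U + pr P V.
  by rewrite pr_setUI// UV pr_set0 subr0.
apply/cvgrPdist_le => eps eps0.
have hU := portmanteau_open oU eps0; have hV := portmanteau_open oV eps0.
near=> n.
have h1 : pr mu U - eps < pr (mu_ n) U by near: n.
have h2 : pr mu V - eps < pr (mu_ n) V by near: n.
have h3 : pr (mu_ n) U + pr (mu_ n) V <= 1.
  by rewrite -splitE pr_le1//; exact: measurableU.
rewrite splitE in UV1; rewrite ler_distl; apply/andP; split; lra.
Unshelve. all: by end_near.
Qed.

End portmanteau.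

Section open_sets_rV.
Context {R : realType} {K : nat}.

Lemma continuous_coord (i : 'I_K) : continuous (fun x : 'rV[R]_K => x ord0 i).
Proof. exact: coord_continuous. Qed.

Lemma open_lt_rV (f g : 'rV[R]_K -> R) : continuous f -> continuous g ->
  open [set x | f x < g x].
Proof.
move=> cf cg.
have -> : [set x | f x < g x] = (fun x => g x - f x) @^-1` [set y | 0 < y].
  by apply/seteqP; split => x /=; rewrite subr_gt0.
apply: open_comp; last exact: open_gt.
by move=> x _; apply: (@continuousB _ _ _ g f); [exact: cg|exact: cf].
Qed.

Lemma open_forall_ord n (B : 'I_n -> set 'rV[R]_K) : (forall i, open (B i)) ->
  open [set x | forall i, B i x].
Proof.
move=> oB; rewrite openE => x /= Bx; rewrite /interior.
apply: (filter_forall (F := nbhs x) (f := fun i y => B i y)) => i.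
by apply: open_nbhs_nbhs; split => //; exact: Bx.
Qed.

End open_sets_rV.

(** * Null sets and coordinates under product laws *)

Section product_law_theory.
Context {R : realType}.
Implicit Type lam : nat -> probability (measurableTypeR R) R.

Definition upd n (x : 'rV[R]_n) (i : 'I_n) (z : R) : 'rV[R]_n :=
  \row_j if j == i then z else x ord0 j.

(** Tonelli with the coordinate [i] innermost: an atomless law gives no mass to the single value
    that the other coordinates allow. *)
Lemma prodP_null lam n (i : 'I_n) (A : set 'rV[R]_n) :
  (forall k a, lam k [set a] = 0%E) -> measurable A ->
  (forall x, exists c, forall z, A (upd x i z) -> z = c) -> prodP lam n A = 0%E.
Proof.
elim: n lam i A => [|n IH] lam i A atom mA hA; first by case: (i) => [].
case: (unliftP ord0 i) hA => [j ->|->] hA.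
  rewrite prodPS// -[RHS](integral0 (lam 0%N) setT); apply: eq_integral => z _.
  apply: (IH _ j); first by move=> k a; exact: atom.
    by apply: measurable_preim => //; exact: measurable_consrV.
  move=> x; have [c hc] := hA (consrV z x); exists c => u Au; apply: hc.
  move: Au => /=; congr (A _); apply/rowP => k; rewrite [RHS]mxE.
  case: (unliftP ord0 k) => [k' ->|->]; first by rewrite !consrVS mxE (inj_eq lift_inj).
  by rewrite !consrV0 (negbTE (neq_lift _ _)).
rewrite prodP_swap// -[RHS](integral0 (prodP (fun i => lam i.+1) n) setT).
apply: eq_integral => x _; have [c hc] := hA (consrV 0 x).
apply/eqP; rewrite eq_le measure_ge0 andbT -(atom 0%N c); apply: le_prob => //.
  apply: (@measurable_preim _ _ _ _ (fun z : R => consrV z x) A) => //.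
  by apply: measurable_consrV.
move=> z /= Az; apply: hc; congr (A _) : Az; apply/rowP => k; rewrite [RHS]mxE.
case: (unliftP ord0 k) => [k' ->|->]; last by rewrite eqxx consrV0.
by rewrite !consrVS eq_sym (negbTE (neq_lift _ _)).
Qed.

(* Coordinates indexed by nat, 0 out of range. *)
Definition co n (x : 'rV[R]_n) (i : nat) : R := oapp (x ord0) 0 (insub i).

Lemma coE n (x : 'rV[R]_n) i (h : (i < n)%N) : co x i = x ord0 (Ordinal h).
Proof. by rewrite /co insubT. Qed.

Lemma co_ord n (x : 'rV[R]_n) (i : 'I_n) : co x i = x ord0 i.
Proof. by rewrite coE; congr (x _ _); exact: val_inj. Qed.

Lemma co_row n (f : nat -> R) i : (i < n)%N -> co (\row_(j < n) f j) i = f i.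
Proof. by move=> h; rewrite coE mxE. Qed.

Lemma co_consrV0 n z (x : 'rV[R]_n) : co (consrV z x) 0 = z.
Proof. by rewrite coE -[RHS](consrV0 z x); congr (consrV z x _ _); exact: val_inj. Qed.

Lemma co_consrVS n z (x : 'rV[R]_n) i : co (consrV z x) i.+1 = co x i.
Proof.
rewrite /co; case: insubP => [u un uE|un].
  have h : (i < n)%N by [].
  rewrite insubT /= -(consrVS z x (Ordinal h)); congr (consrV z x _ _).
  exact: val_inj.
by rewrite insubN.
Qed.

Lemma co_upd n (x : 'rV[R]_n) (i : 'I_n) z k : (k < n)%N ->
  co (upd x i z) k = if k == i then z else co x k.
Proof. by move=> h; rewrite !coE mxE -val_eqE. Qed.

Lemma measurable_co n i : measurable_fun setT (fun x : 'rV[R]_n => co x i).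
Proof.
rewrite /co; case: insubP => [u _ _|_] /=; first exact: measurable_rV_coord.
exact: measurable_cst.
Qed.

Lemma continuous_co n i : continuous (fun x : 'rV[R]_n => co x i).
Proof.
rewrite /co; case: insubP => [u _ _|_] /=; first exact: continuous_coord.
exact: cst_continuous.
Qed.

Definition truncV n (x : 'rV[R]_n.+1) : 'rV[R]_n := \row_(i < n) co x i.

Lemma co_truncV n (x : 'rV[R]_n.+1) i : (i < n)%N -> co (truncV x) i = co x i.
Proof. exact: co_row. Qed.

Lemma measurable_truncV n : measurable_fun setT (@truncV n).
Proof.
apply: measurable_fun_rV => i; rewrite /truncV.
under eq_fun do rewrite mxE.
exact: measurable_co.
Qed.

Lemma prodP_truncV lam n (A : set 'rV[R]_n) : measurable A ->
  prodP lam n.+1 (@truncV n @^-1` A) = prodP lam n A.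
Proof.
elim: n lam A => [|n IH] lam A mA.
  have [A0|A0] := pselect (A 0).
    rewrite (_ : A = setT) ?preimage_setT ?probability_setT//.
    by apply/seteqP; split => // x _; rewrite (_ : x = 0)//; apply/rowP => -[].
  rewrite (_ : A = set0) ?preimage_set0 ?measure0//.
  apply/seteqP; split => // x; rewrite (_ : x = 0)//; apply/rowP => -[] //.
rewrite prodPS; last by apply: measurable_preim => //; exact: measurable_truncV.
rewrite [RHS]prodPS//; apply: eq_integral => z _; rewrite -IH; last first.
  by apply: measurable_preim => //; exact: measurable_consrV.
congr (prodP _ _ _); apply/funext => x /=; congr (A _); apply/rowP => i.
rewrite mxE; case: (unliftP ord0 i) => [j ->|->].
  by rewrite consrVS mxE -[RHS](co_consrVS z); congr co.
by rewrite consrV0 co_consrV0.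
Qed.

Lemma prodP_co lam n i (B : set R) : (i < n)%N -> measurable B ->
  prodP lam n [set x | B (co x i)] = lam i B.
Proof.
elim: n lam i => [|n IH] lam [|i]// h mB.
  rewrite -(prodP_coord0 lam n mB); congr (prodP _ _ _); apply/funext => x /=.
  by rewrite -(co_ord x ord0).
rewrite prodPS; last by apply: measurable_preim => //; exact: measurable_co.
rewrite -(IH (fun i => lam i.+1) i)//.
rewrite -[RHS](integral_prob_cst (lam 0%N)); apply: eq_integral => z _.
by congr (prodP _ _ _); apply/funext => x /=; rewrite co_consrVS.
Qed.

Lemma prodP_setM lam n (B : set R) (A : set 'rV[R]_n) (C : set 'rV[R]_n.+1) :
  measurable B -> measurable A -> measurable C ->
  (forall z x, B z -> A x -> C (consrV z x)) ->
  (lam 0%N B * prodP (fun i => lam i.+1) n A <= prodP lam n.+1 C)%E.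
Proof.
move=> mB mA mC BAC.
pose tail (x : 'rV[R]_n.+1) : 'rV[R]_n := \row_j x ord0 (lift ord0 j).
have mtail : measurable_fun setT tail.
  by apply: measurable_fun_rV => j; under eq_fun do rewrite mxE; exact: measurable_rV_coord.
pose D := [set x : 'rV[R]_n.+1 | B (x ord0 ord0)] `&` [set x | A (tail x)].
have mD : measurable D.
  by apply: measurableI; apply: measurable_preim => //; exact: measurable_rV_coord.
have tailE z x : tail (consrV z x) = x by apply/rowP => j; rewrite mxE consrVS.
have DC : D `<=` C.
  by move=> x [Bx Ax]; rewrite (consrV_surj x); exact: BAC.
apply: (le_trans _ (le_prob (prodP lam n.+1) mD mC DC)).
rewrite prodPS// (prob_integral (lam 0%N))// muleC -ge0_integralZl//; last first.
  by apply/measurable_EFinP; exact: measurable_indic.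
rewrite le_eqVlt; apply/orP; left; apply/eqP.
apply: eq_integral => z _; rewrite indicE; have [zB|zB] := boolP (z \in B).
  rewrite mule1; congr (prodP _ _ _); rewrite inE in zB.
  by apply/seteqP; split => x /=; rewrite /D /= consrV0 tailE => // -[].
rewrite mule0 (_ : _ @^-1` _ = set0) ?measure0//.
apply/seteqP; split => x //=; rewrite /D /= consrV0 => -[Bz _].
by move: zB; rewrite notin_setE.
Qed.

End product_law_theory.

Lemma measurable_forall_nat d (T : measurableType d) (D : nat -> Prop) (B : nat -> set T) :
  (forall i, D i -> measurable (B i)) -> measurable [set x | forall i, D i -> B i x].
Proof.
move=> mB; rewrite (_ : [set x | _] = \bigcap_(i in D) B i)//.
exact: bigcap_measurableType.
Qed.

Lemma measurable_exists_nat d (T : measurableType d) (D : nat -> Prop) (B : nat -> set T) :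
  (forall i, D i -> measurable (B i)) -> measurable [set x | exists2 i, D i & B i x].
Proof.
move=> mB; rewrite (_ : [set x | _] = \bigcup_(i in D) B i)//.
exact: bigcup_measurable.
Qed.

Lemma measurable_le_fun d (T : measurableType d) (R : realType) (f g : T -> R) :
  measurable_fun setT f -> measurable_fun setT g -> measurable [set x | f x <= g x].
Proof.
by move=> mf mg; rewrite -[X in measurable X]setTI; exact: measurable_fun_le.
Qed.

Lemma measurable_lt_fun d (T : measurableType d) (R : realType) (f g : T -> R) :
  measurable_fun setT f -> measurable_fun setT g -> measurable [set x | f x < g x].
Proof.
move=> mf mg; rewrite (_ : [set x | _] = ~` [set x | g x <= f x]).
  exact/measurableC/measurable_le_fun.
by apply/seteqP; split => x /=; rewrite ltNge => /negP.
Qed.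

Lemma measurable_eq_fun d (T : measurableType d) (R : realType) (f g : T -> R) :
  measurable_fun setT f -> measurable_fun setT g -> measurable [set x | f x = g x].
Proof.
move=> mf mg; rewrite (_ : [set x | _] = [set x | f x <= g x] `&` [set x | g x <= f x]).
  by apply: measurableI; exact: measurable_le_fun.
apply/seteqP; split => [x /= -> //|x [/= fg gf]].
by apply/eqP; rewrite eq_le fg.
Qed.

Lemma open_forall_lt (R : realType) K n (B : nat -> set 'rV[R]_K) : (forall i, open (B i)) ->
  open [set x | forall i, (i < n)%N -> B i x].
Proof.
move=> oB; rewrite (_ : [set x | _] = [set x | forall i : 'I_n, B i x]).
  exact: open_forall_ord.
by apply/seteqP; split => x /= h => [i|i ni]; [exact: h|exact: (h (Ordinal ni))].
Qed.

Lemma open_exists_nat (R : realType) K (D : nat -> Prop) (B : nat -> set 'rV[R]_K) :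
  (forall i, open (B i)) -> open [set x | exists2 i, D i & B i x].
Proof.
move=> oB; rewrite (_ : [set x | _] = \bigcup_(i in D) B i)//.
exact: bigcup_open.
Qed.

Lemma null_exists_nat d (T : measurableType d) (R : realType) (P : probability T R)
    (D : nat -> Prop) (F : nat -> set T) :
  (forall i, D i -> measurable (F i)) -> (forall i, D i -> P (F i) = 0%E) ->
  P [set x | exists2 i, D i & F i x] = 0%E.
Proof.
move=> mF F0; apply: measure_negligible; first exact: measurable_exists_nat.
rewrite (_ : [set x | _] = \bigcup_i [set x | D i /\ F i x]).
  apply: negligible_bigcup => i; have [Di|nD] := pselect (D i).
    by exists (F i); split; [exact: mF|exact: F0|move=> x []].
  by rewrite (_ : [set x | _] = set0)//; [exact: negligible_set0|apply/seteqP; split => x // []].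
by apply/seteqP; split => x /= [i]; [move=> Di Fi; exists i|move=> _ []; exists i].
Qed.

(** * The limit probability *)

Section limit_law.
Context {R : realType}.

(** The estimates are read off the Gaussian model: with scale [n / n] the comparison holds without
    error, and letting [n] tend to infinity for fixed [l] removes the error term of the general
    statement. *)
Lemma chi_tails (t : R) : 0 < t < 1 -> exists (c q : R) (M : nat), [/\ 0 < c, 0 < q < 1 &
  forall l, (M <= l)%N -> pr (chi l.+1) [set x | x <= c * l.+1%:R] <= q ^+ l /\
    pr (chi l.+2) [set x | c / t * l.+1%:R <= x] <= q ^+ l].
Proof.
move=> t01.
have cmp (kap : R) : 1 < kap -> exists del : nat -> R,
    [/\ n%:R * del n @[n --> \oo] --> 0, (forall n, 0 <= del n) &
     forall n k (A A' : set R), (0 < n)%N -> (k <= n)%N ->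
       measurable A -> measurable A' ->
       (forall t y, kap^-1 <= t <= kap -> 0 <= y -> A (t * y) -> A' y) ->
       pr (gam n) [set x | A (n%:R / n%:R * tsq k x)] <=
       pr (gam n) [set y | A' (tsq k y)] + del n].
  move=> kap1; exists (fun=> 0); split => //.
    by apply: cvg_near_cst; near=> n; rewrite mulr0.
  move=> n k A A' n0 kn mA mA' AA'; rewrite addr0; apply: pr_le.
  - apply: (@measurable_preim _ _ _ _ (fun x => n%:R / n%:R * tsq k x)) => //.
    by apply: measurable_funM => //; exact: measurable_tsq.
  - by apply: (@measurable_preim _ _ _ _ (tsq k)) => //; exact: measurable_tsq.
  move=> x /=; rewrite divff ?pnatr_eq0 -?lt0n// => Ax.
  apply: (AA' 1) => //; last exact: tsq_ge0.
  by rewrite invf_le1 ?(ltW kap1)//; lra.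
have [c [q [M [del [c0 q01 ndel del0 H]]]]] := marginal_tails cmp t01.
exists c, q, M; split => // l Ml.
have del_cvg : (q ^+ l + del n @[n --> \oo] --> q ^+ l).
  by rewrite -[X in _ --> X]addr0; apply: cvgD; [exact: cvg_cst|exact: natM_cvg0].
have lim_le (x : R) : (\forall n \near \oo, x <= q ^+ l + del n) -> x <= q ^+ l.
  move=> h; rewrite -(cvg_lim _ del_cvg)//; apply: limr_ge => //.
  by apply/cvg_ex; exists (q ^+ l).
have e n x : (0 < n)%N -> n%:R / n%:R * x = x :> R.
  by move=> n0; rewrite divff ?mul1r// pnatr_eq0 -lt0n.
split; apply: lim_le; near=> n.
- have ln : (l.+1 < n)%N by near: n; exact: nbhs_infty_gt.
  have [+ _] := H n l Ml ln.
  rewrite -(@pr_gam_tsq _ n l.+1)//; [|exact: ltnW|exact: measurable_le_set].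
  by congr (pr _ _ <= _); apply/funext => x /=; rewrite e// (leq_ltn_trans _ ln).
- have ln : (l.+1 < n)%N by near: n; exact: nbhs_infty_gt.
  have [_ +] := H n l Ml ln.
  rewrite -(@pr_gam_tsq _ n l.+2)//; last exact: measurable_ge_set.
  by congr (pr _ _ <= _); apply/funext => x /=; rewrite e// (leq_ltn_trans _ ln).
Unshelve. all: by end_near.
Qed.

(** Coordinates are numbered from the last Gram-Schmidt vector; with [r = s ^+ 2] this is the
    reducedness condition on the last [n] lengths, freed of division. *)
Definition chain (r : R) n : set 'rV[R]_n :=
  [set x | forall i, (i.+1 < n)%N -> r * co x i.+1 < co x i].

(** Strict failure, and not the complement of [chain], so that this set is open too; ties belong to
    neither. *)
Definition chain_fail (r : R) n : set 'rV[R]_n :=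
  [set x | exists2 i, (i.+1 < n)%N & co x i < r * co x i.+1].

Arguments chain r n _ : clear implicits.
Arguments chain_fail r n _ : clear implicits.

Lemma measurable_chain r n : measurable (chain r n).
Proof.
apply: measurable_forall_nat => i _; apply: measurable_lt_fun; last exact: measurable_co.
by apply: measurable_funM => //; exact: measurable_co.
Qed.

Lemma continuous_scale_co n (r : R) i : continuous (fun x : 'rV[R]_n => r * co x i).
Proof.
move=> x; apply: (@continuousM _ _ (fun=> r) (fun x => co x i)); first exact: cst_continuous.
exact: continuous_co.
Qed.

Lemma open_chain r n : open (chain r n).
Proof.
rewrite (_ : chain r n = [set x | forall i, (i < n.-1)%N -> r * co x i.+1 < co x i]).
  apply: open_forall_lt => i; apply: open_lt_rV; last exact: continuous_co.
  exact: continuous_scale_co.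
by apply/seteqP; split => x h i ni; apply: h; case: (n) ni => //.
Qed.

Lemma open_chain_fail r n : open (chain_fail r n).
Proof.
apply: open_exists_nat => i; apply: open_lt_rV; first exact: continuous_co.
exact: continuous_scale_co.
Qed.

Lemma chain_disjoint r n : chain r n `&` chain_fail r n = set0.
Proof. by apply/seteqP; split => // x [h [i ni]]; have := h i ni; lra. Qed.

Definition limit_law (g : nat) : nat -> probability (measurableTypeR R) R :=
  fun i => chi (g + i).+1.

Lemma limit_law_set1 g k a : limit_law g k [set a] = 0%E.
Proof. exact: chi_set1. Qed.

(** A tie determines the coordinate of index [i] from the next one, a null event for atomless
    laws. *)
Lemma prodP_chain_total (lam : nat -> probability (measurableTypeR R) R) r n :
  (forall k a, lam k [set a] = 0%E) ->
  pr (prodP lam n) (chain r n `|` chain_fail r n) = 1.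
Proof.
move=> atom.
have m1 := @measurable_chain r n; have m2 := measurable_open_rV (@open_chain_fail r n).
apply/eqP; rewrite pr_eq1; last exact: measurableU.
pose F i := [set x : 'rV[R]_n | co x i = r * co x i.+1].
have mF i : measurable (F i).
  apply: measurable_eq_fun; first exact: measurable_co.
  by apply: measurable_funM => //; exact: measurable_co.
have sub : ~` (chain r n `|` chain_fail r n) `<=` [set x | exists2 i, (i.+1 < n)%N & F i x].
  move=> x; rewrite setCU => -[/= h1 h2]; apply: contrapT => h; apply: h1 => i ni.
  rewrite ltNge; apply/negP; rewrite le_eqVlt => /orP[/eqP e|e]; first by apply: h; exists i.
  by apply: h2; exists i.
apply/eqP; apply: (subset_measure0 _ _ sub).
- exact/measurableC/measurableU.
- exact: measurable_exists_nat.
apply: null_exists_nat => // i ni.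
apply: (@prodP_null _ _ _ (Ordinal (ltnW ni))) => // x.
exists (r * co x i.+1) => z; rewrite /F /= !co_upd//; last exact: ltnW.
by rewrite /= eqxx eqn_leq ltnn.
Qed.

End limit_law.
Arguments chain {R} r n _.
Arguments chain_fail {R} r n _.

Lemma pr_exists_le d (T : measurableType d) (R : realType) (P : probability T R)
    (F : nat -> set T) (u : nat -> R) m n :
  (forall i, (m <= i < n)%N -> measurable (F i)) ->
  (forall i, (m <= i < n)%N -> pr P (F i) <= u i) ->
  pr P [set x | exists2 i, (m <= i < n)%N & F i x] <= \sum_(m <= i < n) u i.
Proof.
elim: n => [|n IH] mF Fu.
  rewrite big_geq// (_ : [set x | _] = set0) ?pr_set0//.
  by apply/seteqP; split => // x [i]; rewrite ltn0 andbF.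
have lift i : (m <= i < n)%N -> (m <= i < n.+1)%N by move=> /andP[-> /ltnW].
have [nm|mn] := ltnP n m.
  rewrite big_geq// (_ : [set x | _] = set0) ?pr_set0//.
  apply/seteqP; split => // x [i] /andP[mi]; rewrite ltnS => /(leq_trans mi).
  by rewrite leqNgt nm.
rewrite big_nat_recr//=; have nn : (m <= n < n.+1)%N by rewrite mn ltnSn.
apply: le_trans (lerD (IH (fun i h => mF i (lift i h)) (fun i h => Fu i (lift i h))) (Fu n nn)).
apply: pr_le_setU; [exact: measurable_exists_nat| |exact: mF|].
  by apply: measurable_exists_nat => i /lift; exact: mF.
move=> x [i /andP[mi]]; rewrite ltnS leq_eqVlt => /orP[/eqP ->|iN Fi]; first by right.
by left; exists i => //; rewrite mi.
Qed.

(** * The limit constant lies strictly between 0 and 1 *)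

Section limit_constant.
Context {R : realType}.
Implicit Type lam : nat -> probability (measurableTypeR R) R.

Lemma pr_tail_small (P : probability (measurableTypeR R) R) (eps : R) : 0 < eps ->
  exists2 C : R, 0 < C & pr P [set x | C < x] <= eps.
Proof.
move=> eps0.
have := @pr_nonincreasing_cvg _ _ _ P (fun n => [set x : R | n.+1%:R < x]).
rewrite (_ : \bigcap_n _ = set0); last first.
  apply/seteqP; split => // x /(_ (Num.truncn x) I) /=; rewrite ltNge ltW//.
  exact: truncnS_gt.
rewrite pr_set0 => h.
have {h}/cvgrPdist_le/(_ _ eps0)[N _ /(_ N (leqnn N))] := h
  (fun n => measurable_gt_set n.+1%:R)
  (fun n x (hx : n.+2%:R < x) => lt_trans (ltac:(by rewrite ltr_nat) : n.+1%:R < n.+2%:R :> R) hx).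
rewrite sub0r normrN ger0_norm ?pr_ge0// => h.
by exists N.+1%:R.
Qed.

Lemma chain_nonincreasing lam r n :
  pr (prodP lam n.+1) (chain r n.+1) <= pr (prodP lam n) (chain r n).
Proof.
rewrite -[leRHS](_ : pr (prodP lam n.+1) (@truncV R n @^-1` chain r n) = _); last first.
  by rewrite /pr prodP_truncV//; exact: measurable_chain.
apply: pr_le; first exact: measurable_chain.
  apply: measurable_preim; [exact: measurable_truncV|exact: measurable_chain].
by move=> x /= h i ni; rewrite !co_truncV ?(ltnW ni)//; apply: h; exact: ltnW.
Qed.

(** The probability that all ratios of an infinite sequence of independent chi-square variables
    exceed [r], as a decreasing limit over finite prefixes. *)
Definition reduced_limit (r : R) (g : nat) : R :=
  limn (fun n => pr (prodP (limit_law g) n) (chain r n)).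

Lemma reduced_limit_noninc (r : R) g :
  nonincreasing_seq (fun n => pr (prodP (limit_law g) n) (chain r n) : R).
Proof. by apply/nonincreasing_seqP => n; exact: chain_nonincreasing. Qed.

Lemma reduced_limit_cvg r g :
  pr (prodP (limit_law g) n) (chain r n) @[n --> \oo] --> reduced_limit r g.
Proof.
apply: nonincreasing_is_cvgn; first exact: reduced_limit_noninc.
by exists 0 => _ [n _ <-]; exact: pr_ge0.
Qed.

Lemma reduced_limit_le r g n : reduced_limit r g <= pr (prodP (limit_law g) n) (chain r n).
Proof.
apply: nonincreasing_cvgn_ge; first exact: reduced_limit_noninc.
by apply/cvg_ex; exists (reduced_limit r g); exact: reduced_limit_cvg.
Qed.

(** The first two lengths already violate the condition on a box of positive mass: one at most [r],
    the next above 1. *)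
Lemma reduced_limit_lt1 r g : 0 < r -> reduced_limit r g < 1.
Proof.
move=> r0; apply: (le_lt_trans (@reduced_limit_le r g 2)).
have mC : measurable (chain r 2) by exact: measurable_chain.
suff : 0 < pr (prodP (limit_law g) 2) (~` chain r 2) by rewrite pr_setC//; lra.
pose A (i : nat) : set R := if i == 0%N then `]0, r]%classic else `]1, 2]%classic.
have mA i : measurable (A i) by rewrite /A; case: ifP.
have mB : measurable [set x : 'rV[R]_2 | forall i : 'I_2, A i (x ord0 i)].
  apply: measurable_forall_ord => i.
  by apply: (measurable_preim (measurable_rV_coord i)).
apply: (@lt_le_trans _ _ (pr (prodP (limit_law g) 2) [set x | forall i : 'I_2, A i (x ord0 i)])).
  rewrite -lte_fin -prE// prodP_box//; apply: prode_gt0 => i.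
  by rewrite /A; case: ifP => _; apply: chi_itv_gt0 => //; lra.
apply: pr_le => //; first exact: measurableC.
move=> x /= hx hc; have := hc 0%N erefl.
have := hx ord0; have := hx (lift ord0 ord0); rewrite -!co_ord /A /= !in_itv /= /bump /=.
move=> /andP[x1 _] /andP[_ x0]; apply/negP; rewrite -leNgt.
by apply: (le_trans x0); rewrite ler_peMr// ltW.
Qed.

(** For positivity of the limit, a union bound controls ratios of high rank only. The cap makes a
    chain extensible at its head: a new first coordinate in []C, C / r]] exceeds [r] times the old
    one and satisfies the cap again. *)
Definition capped_chain (r C : R) n : set 'rV[R]_n :=
  chain r n `&` [set x | co x 0 <= C / r].

Arguments capped_chain r C n _ : clear implicits.

Lemma measurable_capped_chain r C n : measurable (capped_chain r C n).
Proof.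
apply: measurableI; first exact: measurable_chain.
by apply: measurable_le_fun => //; exact: measurable_co.
Qed.

Lemma capped_chain_step lam r C n : 0 < r ->
  pr (lam 0%N) `]C, C / r]%classic *
    pr (prodP (fun i => lam i.+1) n.+1) (capped_chain r C n.+1) <=
  pr (prodP lam n.+2) (capped_chain r C n.+2).
Proof.
move=> r0; rewrite -lee_fin EFinM -!prE//; try exact: measurable_capped_chain.
apply: prodP_setM => //; try exact: measurable_capped_chain.
move=> z x; rewrite /= in_itv /= => /andP[Cz zC] [cx /= x0].
split => /=; last by rewrite co_consrV0.
move=> [|i] ni; rewrite ?co_consrV0 !co_consrVS; last exact: cx.
by apply: le_lt_trans Cz; rewrite -ler_pdivlMl// mulrC.
Qed.

Lemma capped_chain_iter lam r C n M : 0 < r ->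
  (\prod_(i < M) pr (lam i) `]C, C / r]%classic) *
    pr (prodP (fun i => lam (M + i)%N) n.+1) (capped_chain r C n.+1) <=
  pr (prodP lam (M + n).+1) (capped_chain r C (M + n).+1).
Proof.
move=> r0; elim: M lam => [|M IH] lam; first by rewrite big_ord0 mul1r.
rewrite big_ord_recl -mulrA; apply: le_trans (capped_chain_step _ _ _ r0).
apply: ler_wpM2l; first exact: pr_ge0.
exact: (IH (fun i => lam i.+1)).
Qed.

(** Far enough in the sequence the union bound works, uniformly in [n]: the ratios fail with total
    probability at most 1/4, and the cap is exceeded with probability at most 1/4. *)
Lemma capped_chain_base (r : R) g : 0 < r < 1 -> exists M, exists2 C, 0 < C &
  forall n, 1 / 2 <= pr (prodP (limit_law (g + M)) n.+1) (capped_chain r C n.+1).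
Proof.
move=> r01; have [c [q [M0 [c0 q01 H]]]] := chi_tails r01.
move: (q01) (r01) => /andP[q0 q1] /andP[r0 r1].
have /cvgrPdist_le/(_ ((1 - q) / 8)) : q ^+ n @[n --> \oo] --> (0 : R).
  by apply: cvg_geom0; rewrite (ltW q0).
have e0 : 0 < (1 - q) / 8 by rewrite divr_gt0// subr_gt0.
move=> /(_ e0)[M1 _ hM1].
pose M := maxn M0 M1.
(* The denominator 8 makes the sum of the failure bounds, [2 * q ^+ M / (1 - q)], at most 1/4. *)
have hM : q ^+ M <= (1 - q) / 8.
  by have := hM1 M (leq_maxr _ _); rewrite sub0r normrN ger0_norm// exprn_ge0// ltW.
exists M.
have [C C0 hC] := @pr_tail_small (chi (g + M).+1) (1 / 4) ltac:(by lra).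
(* The cap is its parameter divided by [r], so [C * r] sets it to the quantile [C]. *)
exists (C * r); first by rewrite mulr_gt0.
move=> n; set P := prodP _ _; rewrite /capped_chain mulfK ?gt_eqF//.
pose h i := (g + M + i)%N.
pose F i : set 'rV[R]_n.+1 := [set x | co x i <= c * (h i).+1%:R] `|`
  [set x | c / r * (h i).+1%:R <= co x i.+1].
have mF i : measurable (F i).
  by apply: measurableU; apply: measurable_le_fun => //; exact: measurable_co.
pose A := [set x | exists2 i, (0 <= i < n)%N & F i x].
have mA : measurable A by apply: measurable_exists_nat => i _; exact: mF.
have pA : pr P A <= 1 / 4.
  have : pr P A <= \sum_(0 <= i < n) 2 * q ^+ (h i).
    have hF (i : nat) : (i < n)%N -> pr P (F i) <= 2 * q ^+ (h i).
      move=> ni; have [|h1 h2] := H (h i).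
        by rewrite /h (leq_trans (leq_maxl M0 M1))// -/M -addnA addnCA leq_addr.
      have m1 : measurable [set x : 'rV[R]_n.+1 | co x i <= c * (h i).+1%:R].
        by apply: measurable_le_fun => //; exact: measurable_co.
      have m2 : measurable [set x : 'rV[R]_n.+1 | c / r * (h i).+1%:R <= co x i.+1].
        by apply: measurable_le_fun => //; exact: measurable_co.
      apply: (le_trans (pr_setU P m1 m2)); rewrite mulr_natl mulr2n; apply: lerD.
        apply: le_trans h1; rewrite /pr.
        rewrite (@prodP_co _ (limit_law (g + M)) n.+1 i [set x | x <= c * (h i).+1%:R])//.
          exact: ltnW.
        exact: measurable_le_set.
      apply: le_trans h2; rewrite /pr.
      rewrite (@prodP_co _ (limit_law (g + M)) n.+1 i.+1 [set x | c / r * (h i).+1%:R <= x])//.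
        by rewrite /limit_law addnS.
      exact: measurable_ge_set.
    by apply: pr_exists_le => // i; exact: hF.
  move/le_trans; apply.
  apply: (@le_trans _ _ (2 * q ^+ M * \sum_(0 <= i < n) q ^+ i)).
    rewrite big_distrr /=; apply: ler_sum => i _.
    rewrite -mulrA ler_pM2l// -exprD; apply: ler_wiXn2l; [exact: ltW|exact: ltW|].
    by rewrite /h -addnA leq_addl.
  have := @geom_sum_le _ q 0 n; rewrite (ltW q0) q1 expr0 => /(_ isT) hs.
  apply: (@le_trans _ _ (2 * q ^+ M * (1 / (1 - q)))).
    by apply: ler_wpM2l => //; rewrite mulr_ge0// exprn_ge0// ltW.
  rewrite mulrA ler_pdivrMr ?subr_gt0//; lra.
pose B := [set x : 'rV[R]_n.+1 | C < co x 0].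
have mB : measurable B by apply: measurable_lt_fun => //; exact: measurable_co.
have pB : pr P B <= 1 / 4.
  apply: le_trans hC; rewrite /pr (@prodP_co _ (limit_law (g + M)) n.+1 0 [set x | C < x])//.
    by rewrite /limit_law addn0.
  exact: measurable_gt_set.
have mCC : measurable (chain r n.+1 `&` [set x | co x 0 <= C]).
  apply: measurableI; first exact: measurable_chain.
  by apply: measurable_le_fun => //; exact: measurable_co.
have : pr P setT <= pr P (chain r n.+1 `&` [set x | co x 0 <= C]) + pr P (A `|` B).
  apply: pr_le_setU => //; first exact: measurableU.
  move=> x _; have [ABx|nABx] := pselect ((A `|` B) x); [by right|left].
  split => /=; last by rewrite leNgt; apply/negP => h'; apply: nABx; right.
  move=> i ni; rewrite ltNge; apply/negP => hi; apply: nABx; left; exists i => //.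
  have [xi|xi] := leP (co x i) (c * (h i).+1%:R); [by left|right => /=].
  rewrite mulrAC ler_pdivrMr//.
  by rewrite [leRHS]mulrC; apply/ltW/(lt_le_trans xi).
rewrite pr_setT; have := pr_setU P mA mB.
move: (pr P _) (pr P A) (pr P B) (pr P (_ `|` _)) pA pB => u v w z; lra.
Qed.

(** The first [M] coordinates are put in []C, C / r]], which has positive probability independent of
    [n], and are followed by a capped chain of probability at least 1/2. *)
Lemma reduced_limit_gt0 r g : 0 < r < 1 -> 0 < reduced_limit r g.
Proof.
move=> r01; have [M [C C0 hC]] := capped_chain_base g r01.
move: (r01) => /andP[r0 r1].
pose p := \prod_(i < M) pr (limit_law g i) `]C, C / r]%classic.
have p0 : 0 < p.
  apply: prodr_gt0 => i _; rewrite -lte_fin -prE//; apply: chi_itv_gt0 => //; first exact: ltW.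
  by rewrite ltr_pdivlMr// gtr_pMr.
apply: (@lt_le_trans _ _ (p * (1 / 2))); first by rewrite mulr_gt0//; lra.
apply: limr_ge; first by apply/cvg_ex; exists (reduced_limit r g); exact: reduced_limit_cvg.
near=> n.
have [k nk] : exists k, n = (M + k).+1.
  exists (n - M.+1)%N; rewrite -addSn subnKC//; near: n; exact: nbhs_infty_gt.
rewrite nk; apply: (@le_trans _ _ (pr (prodP (limit_law g) (M + k).+1) (capped_chain r C (M + k).+1))).
  apply: le_trans (capped_chain_iter _ _ _ _ r0); rewrite ler_pM2l//.
  rewrite (_ : (fun i => limit_law g (M + i)) = limit_law (g + M))//.
  by apply/funext => i; rewrite /limit_law addnA.
apply: pr_le; [exact: measurable_capped_chain|exact: measurable_chain|].
by move=> x [].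
Unshelve. all: by end_near.
Qed.

End limit_constant.

(** * Convergence in distribution on nat *)

Section discrete_law.
Context {R : realType} (q : nat -> R).
Hypothesis q0 : forall k, 0 <= q k.
Hypothesis q_sum : \sum_(k < n) q k @[n --> \oo] --> (1 : R).
Local Open Scope ereal_scope.

Definition discrete_law (U : set nat) : \bar R := \esum_(k in U) (q k)%:E.

Let discrete_law0 : discrete_law set0 = 0.
Proof. by rewrite /discrete_law esum_set0. Qed.

Let discrete_law_ge0 U : 0 <= discrete_law U.
Proof. by apply: esum_ge0 => k _; rewrite lee_fin. Qed.

Let discrete_law_sigma_additive : semi_sigma_additive discrete_law.
Proof.
move=> F mF tF mUF; apply: cvg_toP.
  apply: ereal_nondecreasing_is_cvgn => a b ab.
  by apply: lee_sum_nneg_natr => // n _ _; exact: discrete_law_ge0.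
by rewrite /discrete_law nneseries_sum_bigcup// => i; rewrite lee_fin.
Qed.

HB.instance Definition _ := isMeasure.Build _ _ _ discrete_law
  discrete_law0 discrete_law_ge0 discrete_law_sigma_additive.

Let discrete_law_setT : discrete_law [set: nat] = 1.
Proof.
rewrite /discrete_law -nneseries_esumT; last by move=> n; rewrite lee_fin.
apply: cvg_lim => //; rewrite (_ : (fun n => _) = fun n => (\sum_(k < n) q k)%R%:E).
  by apply: cvg_EFin; [near=> n|exact: q_sum].
by apply/funext => n; rewrite sumEFin big_mkord.
Unshelve. all: by end_near.
Qed.

HB.instance Definition _ := Measure_isProbability.Build _ _ R discrete_law discrete_law_setT.

Lemma exists_discrete_law : exists P : probability nat R, forall k, pr P [set k] = q k.
Proof. by exists discrete_law => k; rewrite /pr /= /discrete_law esum_set1// lee_fin. Qed.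

End discrete_law.

(** * Integer-valued random variables *)

Section nat_valued.
Context d (T : measurableType d) (R : realType) (P : probability T R) (W : T -> nat).
Hypothesis mW : forall k, measurable [set w | W w = k].

Lemma measurable_nat_valued (D : set nat) : measurable [set w | D (W w)].
Proof.
rewrite (_ : [set w | _] = [set w | exists2 k, D k & W w = k]).
  by apply: measurable_exists_nat => k _; exact: mW.
by apply/seteqP; split => w /= => [Dw|[k Dk we]]; [exists (W w)|rewrite we].
Qed.

Lemma measurable_fun_nat_valued d' (T' : measurableType d') (f : nat -> T') :
  measurable_fun setT (fun w => f (W w)).
Proof. by move=> _ Y _; rewrite setTI; exact: (measurable_nat_valued (f @^-1` Y)). Qed.

Lemma pr_nat_lt K : pr P [set w | (W w < K)%N] = \sum_(k < K) pr P [set w | W w = k].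
Proof.
elim: K => [|K IH].
  by rewrite big_ord0 (_ : [set w | _] = set0) ?pr_set0//; apply/seteqP; split.
rewrite big_ord_recr /= -IH (_ : [set w | _] = [set w | (W w < K)%N] `|` [set w | W w = K]).
  rewrite pr_setUI//; last exact: (measurable_nat_valued [set k | (k < K)%N]).
  rewrite (_ : _ `&` _ = set0) ?pr_set0 ?subr0//.
  by apply/seteqP; split => // w [/= wK we]; move: wK; rewrite we ltnn.
apply/seteqP; split => w /=.
  by rewrite ltnS leq_eqVlt => /orP[/eqP|]; [right|left].
by case=> [/ltnW|->]; rewrite ltnS.
Qed.

(** Truncation at [K]: outcomes from [K] on count for 0 in the lower bound and for [B] in the upper
    one. *)
Lemma nat_expectation_bounds (f : nat -> R) (B : R) K : (forall k, 0 <= f k <= B) ->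
  ((\sum_(k < K) f k * pr P [set w | W w = k])%:E <= \int[P]_w (f (W w))%:E /\
  \int[P]_w (f (W w))%:E <= (\sum_(k < K) f k * pr P [set w | W w = k] +
      B * pr P [set w | (K <= W w)%N])%:E)%E.
Proof.
move=> fB; have f0 k : 0 <= f k by have /andP[] := fB k.
have B0 : 0 <= B by have /andP[h1 h2] := fB 0%N; exact: le_trans h2.
pose S w : R := \sum_(k < K) f k * \1_[set w | W w = k] w.
have intI (c : R) (D : set T) : 0 <= c -> measurable D ->
    (\int[P]_w (c * \1_D w)%:E = (c * pr P D)%:E)%E.
  move=> c0 mD; under eq_integral do rewrite EFinM.
  rewrite ge0_integralZl//; last by apply/measurable_EFinP; exact: measurable_indic.
  by rewrite integral_indic// setIT EFinM -prE.
have mI (c : R) (D : set T) : measurable D -> measurable_fun setT (fun w => (c * \1_D w)%:E).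
  by move=> mD; apply/measurable_EFinP; apply: measurable_funM => //; exact: measurable_indic.
have mS : measurable_fun setT (fun w => (S w)%:E).
  apply/measurable_EFinP; apply: measurable_sum => k.
  by apply/measurable_EFinP; exact: mI.
have intS : (\int[P]_w (S w)%:E = (\sum_(k < K) f k * pr P [set w | W w = k])%:E)%E.
  rewrite /S; under eq_integral do rewrite -sumEFin.
  rewrite ge0_integral_sum//; last 2 first.
  - by move=> k; exact: mI.
  - by move=> k w _; rewrite lee_fin mulr_ge0.
  by rewrite -sumEFin; apply: eq_bigr => k _; rewrite intI.
have S0 w : 0 <= S w by apply: sumr_ge0 => k _; rewrite mulr_ge0.
have SE w : S w = if (W w < K)%N then f (W w) else 0.
  rewrite /S; case: ifP => [wK|wK].
    rewrite (bigD1 (Ordinal wK))//= indicE mem_set//= mulr1 big1 ?addr0// => k kw.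
    rewrite indicE memNset ?mulr0//= => we; move/eqP: kw; apply.
    exact: val_inj.
  rewrite big1// => k _; rewrite indicE memNset ?mulr0//= => we.
  by move: wK; rewrite we ltn_ord.
have mf : measurable_fun setT (fun w => (f (W w))%:E).
  by apply/measurable_EFinP; exact: (measurable_fun_nat_valued (T' := R)).
have mK : measurable [set w | (K <= W w)%N] by exact: (measurable_nat_valued [set k | (K <= k)%N]).
split; rewrite -?intS.
  by apply: ge0_le_integral => // w _; rewrite lee_fin SE; case: ifP.
rewrite EFinD -intI// -intS -ge0_integralD//; last 3 first.
- by move=> w _; rewrite lee_fin.
- by move=> w _; rewrite lee_fin mulr_ge0.
- exact: mI.
apply: ge0_le_integral => //.
- by move=> w _; rewrite lee_fin.
- by apply: emeasurable_funD => //; exact: mI.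
move=> w _; rewrite -EFinD lee_fin SE indicE; case: ltnP => wK.
  by rewrite lerDl mulr_ge0.
by rewrite mem_set//= mulr1 add0r; have /andP[] := fB (W w).
Qed.

End nat_valued.

Definition real_of_nat (R : realType) (k : nat) : measurableTypeR R := k%:R.

Lemma measurable_real_of_nat (R : realType) : measurable_fun setT (@real_of_nat R).
Proof. by []. Qed.

HB.instance Definition _ (R : realType) := isMeasurableFun.Build _ _ _ _ (@real_of_nat R)
  (@measurable_real_of_nat R).

Lemma integral_prob_shift d (T : measurableType d) (R : realType) (P : probability T R)
    (f : T -> R) (M : R) : measurable_fun setT f -> (forall x, `|f x| <= M) ->
  (\int[P]_x (f x)%:E = \int[P]_x (f x + M)%:E - M%:E)%E.
Proof.
move=> mf fM.
have intf : P.-integrable setT (EFin \o f).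
  apply: measurable_bounded_integrable => //.
    by apply: (@le_lt_trans _ _ 1%E); [exact: probability_le1|exact: ltry].
  by exists M; split; [exact: num_real|move=> y My x _; apply: le_trans (ltW My); exact: fM].
have intM : P.-integrable setT (EFin \o cst M).
  by apply: finite_measure_integrable_cst.
have := integralD_EFin measurableT intf intM => /= ->.
rewrite (_ : \int[P]_x M%:E = M%:E)%E; last exact: integral_prob_cst.
by rewrite addeK.
Qed.

Lemma cvg_sum_ord (R : realType) K (u : nat -> nat -> R) (l : nat -> R) :
  (forall k, u k n @[n --> \oo] --> l k) ->
  \sum_(k < K) u k n @[n --> \oo] --> \sum_(k < K) l k.
Proof.
move=> ul; elim: K => [|K IH].
  by rewrite big_ord0; apply: cvg_near_cst; near=> n; rewrite big_ord0.
rewrite big_ord_recr (_ : (fun n => _) = fun n => \sum_(k < K) u k n + u K n).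
  by apply: cvgD => //; exact: ul.
by apply/funext => n; rewrite big_ord_recr.
Unshelve. all: by end_near.
Qed.

(** Tightness keeps mass from escaping to infinity and makes the limit weights sum to 1. A test
    function is then cut at a level beyond which all laws involved have small mass, and finitely
    many weights remain. *)
Lemma nat_cvg_in_distribution (R : realType) (d : nat -> measure_display)
    (Omega : forall n : nat, measurableType (d n))
    (P : forall n : nat, probability (Omega n) R)
    (W : forall n : nat, Omega n -> nat) (q : nat -> R) :
  (forall n k, measurable [set w | W n w = k]) ->
  (forall k, pr (P n) [set w | W n w = k] @[n --> \oo] --> q k) ->
  (forall eps : R, 0 < eps -> exists K,
     \forall n \near \oo, pr (P n) [set w | (K <= W n w)%N] <= eps) ->
  exists mu : probability (measurableTypeR R) R,
    cvg_in_distribution P (fun n w => (W n w)%:R) mu.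
Proof.
move=> mW cvg_q tight.
have q0 k : 0 <= q k.
  by apply: (ler_cvg_to (cvg_cst 0) (cvg_q k)); near=> n; exact: pr_ge0.
have ge_lt n K : pr (P n) [set w | (K <= W n w)%N] = 1 - \sum_(k < K) pr (P n) [set w | W n w = k].
  rewrite -pr_nat_lt// -pr_setC; last exact: (measurable_nat_valued (mW n) [set k | (k < K)%N]).
  by congr (pr _ _); apply/seteqP; split => w /=; rewrite [(K <= _)%N]leqNgt => /negP.
have cvg_sum_q K (f : nat -> R) : \sum_(k < K) f k * pr (P n) [set w | W n w = k] @[n --> \oo] -->
    \sum_(k < K) f k * q k.
  apply: (@cvg_sum_ord _ K (fun k n => f k * pr (P n) [set w | W n w = k]) (fun k => f k * q k)) => k.
  by apply: cvgM; [exact: cvg_cst|exact: cvg_q].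
have cvg_sum_q1 K : \sum_(k < K) pr (P n) [set w | W n w = k] @[n --> \oo] --> \sum_(k < K) q k.
  exact: (@cvg_sum_ord _ K (fun k n => pr (P n) [set w | W n w = k]) q).
have q_le1 K : \sum_(k < K) q k <= 1.
  apply: (ler_cvg_to (cvg_sum_q1 K) (cvg_cst (1 : R))); near=> n.
  have : 0 <= pr (P n) [set w | (K <= W n w)%N] by exact: pr_ge0.
  by rewrite ge_lt; lra.
have q_tail eps : 0 < eps -> exists K, forall L, (K <= L)%N -> 1 - eps <= \sum_(k < L) q k.
  move=> eps0; have [K hK] := tight _ eps0; exists K => L KL.
  apply: (@le_trans _ _ (\sum_(k < K) q k)).
    apply: (ler_cvg_to (cvg_cst (1 - eps)) (cvg_sum_q1 K)); near=> n.
    have : pr (P n) [set w | (K <= W n w)%N] <= eps by near: n.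
    by rewrite ge_lt; lra.
  rewrite -(subnKC KL) big_split_ord /= lerDl; apply: sumr_ge0 => k _; exact: q0.
have q_sum : \sum_(k < n) q k @[n --> \oo] --> (1 : R).
  apply/cvgrPdist_le => eps eps0; have [K hK] := q_tail _ eps0.
  near=> n; rewrite ler_distl; apply/andP; split; last first.
    by rewrite -lerBlDr; apply: hK; near: n; exact: nbhs_infty_ge.
  by have := q_le1 n; lra.
have [mu0 mu0E] := exists_discrete_law q0 q_sum.
exists (distribution mu0 (@real_of_nat R)) => f cf [M0 [_ hM0]].
(* Boundedness supplies a bound for every number strictly above [M0]. Adding [M] to [f] makes it
   nonnegative, with values at most [2 * M]. *)
pose M := M0 + 1; have fM x : `|f x| <= M by apply: hM0 => //; rewrite ltrDl.
have mf : measurable_fun setT f by exact: continuous_measurable_fun.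
have M_ge0 : 0 <= M by exact: le_trans (fM 0).
pose f' (k : nat) := f k%:R + M.
have f'B k : 0 <= f' k <= 2 * M.
  by have := fM k%:R; rewrite /f' ler_norml => /andP[]; lra.
have mid k : measurable [set j : nat | j = k] by [].
have reduce n : (\int[P n]_w (f (W n w)%:R)%:E = \int[P n]_w (f' (W n w))%:E - M%:E)%E.
  apply: (@integral_prob_shift _ _ _ _ (fun w => f (W n w)%:R)) => //.
  exact: (measurable_fun_nat_valued (mW n) (T' := R) (fun k => f k%:R)).
rewrite [X in _ --> X](_ : _ = (\int[mu0]_k (f' k)%:E - M%:E)%E); last first.
  apply: (eq_trans (@integral_prob_shift _ _ _ (distribution mu0 (@real_of_nat R)) f M mf fM)).
  rewrite ge0_integral_distribution//.
  - by apply/measurable_EFinP; apply: measurable_funD.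
  - by move=> y; rewrite lee_fin; have := fM y; rewrite ler_norml => /andP[]; lra.
rewrite (_ : (fun n => _) = fun n => (\int[P n]_w (f' (W n w))%:E - M%:E)%E); last first.
  by apply/funext => n; rewrite reduce.
have fin d' (T : measurableType d') (Q : probability T R) (V : T -> nat)
    (mV : forall k, measurable [set w | V w = k]) : (\int[Q]_w (f' (V w))%:E)%E \is a fin_num.
  have [h1 h2] := nat_expectation_bounds Q mV 0 f'B.
  by rewrite ge0_fin_numE ?(le_lt_trans h2) ?ltry//; apply: le_trans h1; rewrite big_ord0.
have finn n := fin _ _ (P n) _ (mW n).
have fin0 := fin _ _ mu0 id mid.
apply: cvgeB; [exact: fin_num_adde_defl| |exact: cvg_cst].
rewrite -(fineK fin0) (_ : (fun n => \int[P n]_w (f' (W n w))%:E)%E =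
    fun n => (fine (\int[P n]_w (f' (W n w))%:E))%:E); last first.
  by apply/funext => n; rewrite fineK.
apply: cvg_EFin; first by near=> n.
apply/cvgrPdist_le => eps eps0.
(* Each of the two tails costs [2 * M * e], and the difference of the finite sums costs [e]. *)
pose e := eps / (2 * M + 2 * M + 1).
have D0 : 0 < 2 * M + 2 * M + 1 by lra.
have e0 : 0 < e by rewrite divr_gt0.
have [K1 hK1] := q_tail _ e0; have [K2 hK2] := tight _ e0.
pose K := maxn K1 K2.
have tail0 : pr mu0 [set k | (K <= k)%N] <= e.
  have -> : [set k | (K <= k)%N] = ~` [set k : nat | (id k < K)%N].
    by apply/seteqP; split => k /=; rewrite [(K <= _)%N]leqNgt => /negP.
  rewrite pr_setC// pr_nat_lt//.
  have := hK1 K (leq_maxl _ _); rewrite (eq_bigr (fun k : 'I_K => pr mu0 [set w | w = k :> nat])).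
    by lra.
  by move=> k _; rewrite -mu0E.
near=> n.
have tailn : pr (P n) [set w | (K <= W n w)%N] <= e.
  apply: (@le_trans _ _ (pr (P n) [set w | (K2 <= W n w)%N])); last by near: n.
  apply: pr_le; [exact: (measurable_nat_valued (mW n) [set k | (K <= k)%N])|
    exact: (measurable_nat_valued (mW n) [set k | (K2 <= k)%N])|].
  by move=> w /=; apply: leq_trans; exact: leq_maxr.
have sums : `|\sum_(k < K) f' k * q k - \sum_(k < K) f' k * pr (P n) [set w | W n w = k]| <= e.
  by near: n; move/cvgrPdist_le : (cvg_sum_q K f'); apply.
have [] := nat_expectation_bounds (P n) (mW n) K f'B.
rewrite -(fineK (finn n)) !lee_fin /=.
have [] := nat_expectation_bounds mu0 mid K f'B.
rewrite -(fineK fin0) !lee_fin /=.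
rewrite (eq_bigr (fun k : 'I_K => f' k * q k)); last by move=> k _; rewrite -mu0E.
have t1 : 2 * M * pr mu0 [set k | (K <= k)%N] <= 2 * M * e by apply: ler_wpM2l => //; lra.
have t2 : 2 * M * pr (P n) [set w | (K <= W n w)%N] <= 2 * M * e by apply: ler_wpM2l => //; lra.
have eE : eps = 2 * M * e + 2 * M * e + e by rewrite /e; field; rewrite gt_eqF.
move: sums t1 t2; rewrite !ler_distl eE.
move: (fine _) (fine _) (2 * M * pr _ _) (2 * M * pr _ _) (2 * M * e).
move=> x y z u v => h1 h2 h3 h4 h5 h6 h7; apply/andP; split; move/andP: h1 => [h1 h1']; lra.
Unshelve. all: by end_near.
Qed.

Lemma bernoulli_ineq (R : realType) (x : R) n : 0 <= x <= 1 -> 1 - n%:R * x <= (1 - x) ^+ n.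
Proof.
move=> /andP[x0 x1]; elim: n => [|n IH]; first by rewrite mul0r subr0 expr0.
rewrite exprS; apply: (@le_trans _ _ ((1 - x) * (1 - n%:R * x))).
  have : 0 <= n%:R * x * x by rewrite !mulr_ge0.
  by rewrite -natr1; move: (n%:R) => m; nra.
by apply: ler_wpM2l => //; rewrite subr_ge0.
Qed.

Lemma prob_setU_eq0 d (T : measurableType d) (R : realType) (P : probability T R) (A B : set T) :
  measurable A -> measurable B -> P A = 0%E -> P B = 0%E -> P (A `|` B) = 0%E.
Proof.
move=> mA mB PA PB; apply/eqP; rewrite eq_le measure_ge0 andbT.
rewrite prE; last exact: measurableU.
by rewrite lee_fin; apply: (le_trans (pr_setU P mA mB)); rewrite /pr PA PB addr0.
Qed.

(** * The worst ratio *)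

Section argmin_sets.
Context {R : realType}.

(** For positive coordinates this is positive exactly when the ratio of rank [i] is less than that
    of rank [j]; the cross-multiplied form is continuous everywhere. *)
Definition ratio_gap n (x : 'rV[R]_n) i j : R := co x j * co x i.+1 - co x i * co x j.+1.

Definition strict_argmin K i : set 'rV[R]_K.+1 :=
  [set x | forall j, (j < K)%N -> j != i -> 0 < ratio_gap x i j].

Definition not_argmin K i : set 'rV[R]_K.+1 :=
  [set x | exists2 j, (j < K)%N && (j != i) & ratio_gap x i j < 0].

Lemma continuous_ratio_gap n i j : continuous (fun x : 'rV[R]_n => ratio_gap x i j).
Proof.
move=> x; apply: (@continuousB _ _ _ (fun x => co x j * co x i.+1) (fun x => co x i * co x j.+1)).
  by apply: (@continuousM _ _ (fun x => co x j) (fun x => co x i.+1)); exact: continuous_co.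
by apply: (@continuousM _ _ (fun x => co x i) (fun x => co x j.+1)); exact: continuous_co.
Qed.

Lemma open_strict_argmin K i : open (@strict_argmin K i).
Proof.
rewrite (_ : strict_argmin i = [set x | forall j, (j < K)%N -> [set x | j != i -> 0 < ratio_gap x i j] x])//.
apply: open_forall_lt => j; have [->|ji] := eqVneq j i.
  by rewrite (_ : [set x | _] = setT); [exact: openT|apply/seteqP; split].
rewrite (_ : [set x | _] = [set x | 0 < ratio_gap x i j]).
  by apply: open_lt_rV; [exact: cst_continuous|exact: continuous_ratio_gap].
by apply/seteqP; split => x /=; [apply|].
Qed.

Lemma open_not_argmin K i : open (@not_argmin K i).
Proof.
apply: open_exists_nat => j.
by apply: open_lt_rV; [exact: continuous_ratio_gap|exact: cst_continuous].
Qed.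

Lemma argmin_disjoint K i : @strict_argmin K i `&` @not_argmin K i = set0.
Proof. by apply/seteqP; split => // x [h [j /andP[jK ji]]]; have := h j jK ji; lra. Qed.

Lemma measurable_ratio_gap n i j : measurable_fun setT (fun x : 'rV[R]_n => ratio_gap x i j).
Proof. by apply: measurable_funB; apply: measurable_funM; exact: measurable_co. Qed.

(** In a tie between positive coordinates, the coordinate whose index is the smaller of [i] and [j]
    occurs once, with a positive coefficient, so the others determine it. *)
Lemma prodP_argmin_total (lam : nat -> probability (measurableTypeR R) R) K i :
  (forall k a, lam k [set a] = 0%E) -> (forall k, lam k [set x | x <= 0] = 0%E) ->
  (i < K)%N -> pr (prodP lam K.+1) (@strict_argmin K i `|` @not_argmin K i) = 1.
Proof.
move=> atom pos iK.
have mE := measurable_open_rV (@open_strict_argmin K i).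
have mV := measurable_open_rV (@open_not_argmin K i).
pose N1 : set 'rV[R]_K.+1 := [set x | exists2 j, (j < K.+1)%N & co x j <= 0].
pose T j : set 'rV[R]_K.+1 := [set x | ratio_gap x i j = 0] `&`
  [set x | forall k, (k < K.+1)%N -> 0 < co x k].
pose N2 : set 'rV[R]_K.+1 := [set x | exists2 j, (j < K)%N && (j != i) & T j x].
have mN1 : measurable N1.
  by apply: measurable_exists_nat => j _; apply: measurable_le_fun => //; exact: measurable_co.
have mT j : measurable (T j).
  apply: measurableI; first by apply: measurable_eq_fun => //; exact: measurable_ratio_gap.
  by apply: measurable_forall_nat => k _; apply: measurable_lt_fun => //; exact: measurable_co.
have mN2 : measurable N2 by apply: measurable_exists_nat => j _; exact: mT.
have N1_0 : prodP lam K.+1 N1 = 0%E.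
  apply: null_exists_nat => j jK; first by apply: measurable_le_fun => //; exact: measurable_co.
  rewrite -[RHS](pos j); apply: (@prodP_co _ _ _ _ [set x | x <= 0]) => //.
  exact: measurable_le_set.
have N2_0 : prodP lam K.+1 N2 = 0%E.
  apply: null_exists_nat => // j /andP[jK ji].
  have [ij|ij] := ltnP i j.
    have ni : (i < K.+1)%N by exact: ltnW.
    apply: (@prodP_null _ _ _ (Ordinal ni)) => // x.
    exists (co x j * co x i.+1 / co x j.+1) => z [+ /(_ j.+1 jK)].
    rewrite /= /ratio_gap !co_upd//=; last exact: ltnW.
    rewrite eqxx (negbTE ji) !(gtn_eqF (ltnSn i)) (gtn_eqF (ltnW ij : (i < j.+1)%N)).
    move=> /eqP; rewrite subr_eq0 => /eqP e h.
    by rewrite e mulfK// gt_eqF.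
  have {}ij : (j < i)%N by rewrite ltn_neqAle ji ij.
  have nj : (j < K.+1)%N by exact: ltnW.
  apply: (@prodP_null _ _ _ (Ordinal nj)) => // x.
  exists (co x i * co x j.+1 / co x i.+1) => z [+ /(_ i.+1 iK)].
  rewrite /= /ratio_gap !co_upd//=; last exact: ltnW.
  rewrite eqxx (gtn_eqF ij) !(gtn_eqF (ltnSn j)) (gtn_eqF (ltnW ij : (j < i.+1)%N)).
  move=> /eqP; rewrite subr_eq0 => /eqP e h.
  by rewrite -e mulfK// gt_eqF.
apply/eqP; rewrite pr_eq1; last exact: measurableU.
have sub : ~` (@strict_argmin K i `|` @not_argmin K i) `<=` N1 `|` N2.
  move=> x; rewrite setCU => -[/= h1 h2].
  have [N1x|N1x] := pselect (N1 x); [by left|right].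
  have pos_x k : (k < K.+1)%N -> 0 < co x k.
    by move=> kK; rewrite ltNge; apply/negP => xk; apply: N1x; exists k.
  apply: contrapT => hN2; apply: h1 => j jK ji.
  rewrite ltNge; apply/negP; rewrite le_eqVlt => /orP[/eqP e|e].
    by apply: hN2; exists j; rewrite ?jK//; split.
  by apply: h2; exists j; rewrite ?jK.
apply/eqP; apply: (subset_measure0 _ _ sub).
- exact/measurableC/measurableU.
- exact: measurableU.
exact: prob_setU_eq0.
Qed.

End argmin_sets.
Arguments strict_argmin {R} K i _.
Arguments not_argmin {R} K i _.

Lemma chi_le0 (R : realType) n : (0 < n)%N -> chi n [set x : R | x <= 0] = 0%E.
Proof.
move=> n0; apply/eqP; rewrite eq_le measure_ge0 andbT.
have m1 : measurable [set x : measurableTypeR R | (0 : R) <= x] by exact: measurable_ge_set.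
have sub : [set x : R | x <= 0] `<=` [set 0] `|` ~` [set x | 0 <= x].
  move=> x /=; rewrite le_eqVlt => /orP[/eqP ->|x0]; [by left|right].
  by move=> /=; lra.
apply: (@le_trans _ _ (chi n ([set (0 : R)] `|` ~` [set x | 0 <= x]))).
  apply: le_prob => //; first exact: measurable_le_set.
  by apply: measurableU => //; exact: measurableC.
have mC : measurable (~` [set x : measurableTypeR R | (0 : R) <= x]) by exact: measurableC.
rewrite prE; last exact: measurableU.
rewrite lee_fin; apply: (le_trans (pr_setU _ _ _)) => //.
by rewrite pr_setC// /pr chi_set1// chi_ge0 subrr addr0.
Qed.

(** * Passage to the limit for an abstract array of lengths *)

Section ratio_limits.
Context {R : realType} {d : nat -> measure_display} {Omega : forall n, measurableType (d n)}.
Variables (P : forall n, probability (Omega n) R) (p : nat -> nat).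
Variables (Z : forall n, nat -> Omega n -> R) (sc : nat -> R) (g0 : nat).
Arguments Z : clear implicits.
Hypothesis mZ : forall n i, measurable_fun setT (Z n i).
Hypothesis sc_gt0 : \forall n \near \oo, 0 < sc n.
Hypothesis p_large : forall K, \forall n \near \oo, (K <= p n)%N.
Hypothesis box_cvg : forall K (ab : {ffun 'I_K -> R * R}),
  pr (P n) [set w | forall i, `](ab i).1, (ab i).2]%classic (sc n * Z n i w)] @[n --> \oo] -->
  pr (prodP (limit_law g0) K) (box ab).
Hypothesis ratio_tails : forall t eps : R, 0 < t < 1 -> 0 < eps -> exists M,
  \forall n \near \oo, pr (P n) [set w | exists2 i, (M <= i)%N && (i.+1 < p n)%N &
    Z n i w <= t * Z n i.+1 w] <= eps.

Definition scaled n K (w : Omega n) : 'rV[R]_K := \row_(i < K) (fun i => sc n * Z n i w) i.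

Arguments scaled : clear implicits.

Lemma measurable_scaled n K : measurable_fun setT (scaled n K).
Proof.
apply: measurable_fun_rV => i; rewrite /scaled; under eq_fun do rewrite mxE.
exact: measurable_funM.
Qed.

HB.instance Definition _ n K := isMeasurableFun.Build _ _ _ _ (scaled n K)
  (@measurable_scaled n K).

Lemma co_scaled n K w i : (i < K)%N -> co (scaled n K w) i = sc n * Z n i w.
Proof. exact: co_row. Qed.

Lemma scaled_cvg K (U V : set 'rV[R]_K) : open U -> open V -> U `&` V = set0 ->
  pr (prodP (limit_law g0) K) (U `|` V) = 1 ->
  pr (P n) [set w | U (scaled n K w)] @[n --> \oo] --> pr (prodP (limit_law g0) K) U.
Proof.
apply: (@portmanteau_split R K (fun n => distribution (P n) (scaled n K))) => ab.
apply: cvg_trans (@box_cvg K ab); apply: near_eq_cvg; near=> n.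
congr (pr _ _); apply/seteqP; split => w /= h i; first by have := h i; rewrite mxE.
by have := h i; rewrite mxE.
Unshelve. all: by end_near.
Qed.

Lemma coord_cvg K i (c : R) : (i < K)%N ->
  pr (P n) [set w | sc n * Z n i w < c] @[n --> \oo] --> pr (limit_law g0 i) [set x | x < c] /\
  pr (P n) [set w | c < sc n * Z n i w] @[n --> \oo] --> pr (limit_law g0 i) [set x | c < x].
Proof.
move=> iK.
pose U : set 'rV[R]_K := [set x | co x i < c]; pose V : set 'rV[R]_K := [set x | c < co x i].
have oU : open U by apply: open_lt_rV; [exact: continuous_co|exact: cst_continuous].
have oV : open V by apply: open_lt_rV; [exact: cst_continuous|exact: continuous_co].
have UV0 : U `&` V = set0 by apply/seteqP; split => // x []; rewrite /U /V /=; lra.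
have mU := measurable_open_rV oU; have mV := measurable_open_rV oV.
have UV1 : pr (prodP (limit_law g0) K) (U `|` V) = 1.
  apply/eqP; rewrite pr_eq1; last exact: measurableU.
  rewrite (_ : ~` _ = [set x | [set c] (co x i)]); last first.
    apply/seteqP; split => x; rewrite setCU /U /V /=.
      by move=> [h1 h2]; apply/eqP; rewrite eq_le; apply/andP; split; rewrite leNgt; exact/negP.
    by move=> ->; rewrite ltxx.
  rewrite (_ : prodP _ _ _ = limit_law g0 i [set c]); last exact: prodP_co.
  by rewrite limit_law_set1.
have UE : pr (prodP (limit_law g0) K) U = pr (limit_law g0 i) [set x | x < c].
  rewrite /pr; congr fine; apply: (@prodP_co _ _ _ _ [set x | x < c]) => //.
  exact: measurable_lt_set.
have VE : pr (prodP (limit_law g0) K) V = pr (limit_law g0 i) [set x | c < x].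
  rewrite /pr; congr fine; apply: (@prodP_co _ _ _ _ [set x | c < x]) => //.
  exact: measurable_gt_set.
split.
  rewrite -UE; apply: cvg_trans (scaled_cvg oU oV UV0 UV1); apply: near_eq_cvg; near=> n.
  by congr (pr _ _); apply/seteqP; split => w; rewrite /U /= co_scaled.
rewrite -VE; rewrite setIC in UV0; rewrite setUC in UV1.
apply: cvg_trans (scaled_cvg oV oU UV0 UV1); apply: near_eq_cvg; near=> n.
by congr (pr _ _); apply/seteqP; split => w; rewrite /V /= co_scaled.
Unshelve. all: by end_near.
Qed.

(** Up to the event [T] of a bad ratio of rank at least [M], the first [K] lengths decide; the
    condition being homogeneous, the positive scale [sc n] may be inserted. *)
Lemma chain_limit r : 0 < r < 1 ->
  pr (P n) [set w | forall i, (i.+1 < p n)%N -> r * Z n i.+1 w < Z n i w] @[n --> \oo] -->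
  reduced_limit r g0.
Proof.
move=> r01; apply/cvgrPdist_le => eps eps0.
have e3 : 0 < eps / 3 by rewrite divr_gt0.
have [M hM] := ratio_tails r01 e3.
have /cvgrPdist_le/(_ _ e3)[K0 _ hK0] := @reduced_limit_cvg _ r g0.
pose K := maxn M.+1 K0.
have hK : `|reduced_limit r g0 - pr (prodP (limit_law g0) K) (chain r K)| <= eps / 3.
  by apply: hK0; exact: leq_maxr.
have := scaled_cvg (@open_chain _ r K) (@open_chain_fail _ r K) (@chain_disjoint _ r K)
  (@prodP_chain_total _ (limit_law g0) r K (@limit_law_set1 _ g0)).
move=> /cvgrPdist_le/(_ _ e3) hX.
near=> n.
set A := [set w | _].
have mA : measurable A.
  apply: measurable_forall_nat => i _; apply: measurable_lt_fun => //.
  exact: measurable_funM.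
pose X := [set w | chain r K (scaled n K w)].
have mX : measurable X.
  by apply: (measurable_preim (@measurable_scaled n K)); exact: measurable_chain.
pose T := [set w | exists2 i, (M <= i)%N && (i.+1 < p n)%N & Z n i w <= r * Z n i.+1 w].
have mT : measurable T.
  apply: measurable_exists_nat => i _; apply: measurable_le_fun => //.
  exact: measurable_funM.
have s0 : 0 < sc n by near: n.
have Kp : (K <= p n)%N by near: n.
have scE i w : (i.+1 < K)%N -> (r * co (scaled n K w) i.+1 < co (scaled n K w) i) =
    (r * Z n i.+1 w < Z n i w).
  by move=> iK; rewrite !co_scaled ?(ltnW iK)// mulrCA ltr_pM2l.
have AX : A `<=` X by move=> w Aw i iK; rewrite scE//; apply: Aw; exact: leq_trans Kp.
have XA : X `<=` A `|` T.
  move=> w Xw; have [Tw|nTw] := pselect (T w); [by right|left] => i ip.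
  have [iK|Ki] := ltnP i.+1 K; first by rewrite -scE//; exact: Xw.
  rewrite ltNge; apply/negP => h; apply: nTw; exists i => //.
  by rewrite ip andbT -ltnS (leq_trans (leq_maxl _ _) Ki).
have pT : pr (P n) T <= eps / 3 by rewrite /T; near: n.
have pX : `|pr (prodP (limit_law g0) K) (chain r K) - pr (P n) X| <= eps / 3 by rewrite /X; near: n.
have h1 := pr_le (P n) mA mX AX; have h2 := pr_le_setU (P n) mX mA mT XA.
move: hK pX; rewrite !ler_distl => /andP[? ?] /andP[? ?]; apply/andP; split; lra.
Unshelve. all: by end_near.
Qed.

Variable W : forall n, Omega n -> nat.
Arguments W : clear implicits.
Hypothesis mW : forall n k, measurable [set w | W n w = k].
Hypothesis Z_gt0 : \forall n \near \oo,
  P n [set w | exists2 i, (i < p n)%N & Z n i w <= 0] = 0%E.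
Hypothesis W_argmin : forall n w, (forall i, (i < p n)%N -> 0 < Z n i w) -> (1 < p n)%N ->
  exists i, [/\ W n w = (g0 + i)%N, (i.+1 < p n)%N,
    forall j, (j < i)%N -> Z n i w * Z n j.+1 w < Z n j w * Z n i.+1 w &
    forall j, (j.+1 < p n)%N -> Z n i w * Z n j.+1 w <= Z n j w * Z n i.+1 w].

Let nonpos n := [set w | exists2 i, (i < p n)%N & Z n i w <= 0].
Arguments nonpos : clear implicits.

Let measurable_nonpos n : measurable (nonpos n).
Proof. by apply: measurable_exists_nat => i _; exact: measurable_le_fun. Qed.

(** Suppose that the worst ratio has rank at least [M] and [L]. Either it is at most [t], a rare
    tail event, or all ratios before it exceed [t], and then [Z 0] is at least [t ^+ L * Z L], hence
    at least half of [Z L]. But scaled [Z 0] is rarely above [C] and scaled [Z L] rarely below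
    [3 * C]. *)
Lemma argmin_tight eps : 0 < eps -> exists K,
  \forall n \near \oo, pr (P n) [set w | (K <= W n w)%N] <= eps.
Proof.
(* Five errors: the event [T], then for each of the two lengths a limit probability and the distance
   to that limit. *)
move=> eps0; have e5 : 0 < eps / 5 by rewrite divr_gt0.
have [C C0 hC] := pr_tail_small (limit_law g0 0) e5.
have [c [q [M0 [c0 q01 hchi]]]] := @chi_tails R (1 / 2) ltac:(lra).
move: (q01) => /andP[q0 q1].
have qcvg : q ^+ n @[n --> \oo] --> (0 : R) by apply: cvg_geom0; rewrite (ltW q0).
have [L hL] : exists L, pr (limit_law g0 L) [set x | x < 3 * C] <= eps / 5.
  have /cvgrPdist_le/(_ _ e5)[L1 _ hL1] := qcvg.
  pose L := maxn (maxn M0 L1) (Num.truncn (3 * C / c)).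
  exists L; have [|h _] := hchi (g0 + L)%N.
    by apply: leq_trans (leq_addl _ _); rewrite /L !leq_max leqnn.
  have : q ^+ (g0 + L) <= eps / 5.
    have := hL1 (g0 + L)%N; rewrite /= sub0r normrN ger0_norm ?exprn_ge0 ?(ltW q0)//; apply.
    by apply: leq_trans (leq_addl _ _); rewrite /L !leq_max leqnn orbT.
  apply: le_trans; apply: le_trans h; apply: pr_le.
  - exact: measurable_lt_set.
  - exact: measurable_le_set.
  move=> x /= /ltW/le_trans; apply; rewrite -ler_pdivrMl// [c^-1 * _]mulrC ltW//.
  apply: (lt_le_trans (truncnS_gt _)); rewrite ler_nat ltnS.
  by apply: leq_trans (leq_addl _ _); exact: leq_maxr.
(* Bernoulli's inequality gives [t ^+ L >= 1 / 2] for this [t], which still is below 1. *)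
pose t : R := 1 - (2 * L.+1%:R)^-1.
have L2 : 1 < 2 * L.+1%:R :> R by rewrite -natrM ltr1n mulnS.
have t01 : 0 < t < 1.
  rewrite /t subr_gt0 invf_lt1 ?(lt_trans ltr01)// L2/=.
  by rewrite ltrBlDr ltrDl invr_gt0 (lt_trans ltr01).
have tL : 1 / 2 <= t ^+ L.
  apply: le_trans (bernoulli_ineq L _); last first.
    by rewrite invr_ge0 (le_trans ler01 (ltW L2))//= invf_le1 ?(lt_trans ltr01)// ltW.
  have : L%:R * (2 * L.+1%:R)^-1 <= 1 / 2 :> R.
    rewrite ler_pdivrMr ?(lt_trans ltr01)// mulrA mulfVK ?pnatr_eq0// mul1r ler_nat.
    exact: leqnSn.
  by move: (L%:R * _) => x; lra.
move: (t01) => /andP[t0 t1].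
have [M hM] := ratio_tails t01 e5.
have [_ h0] := coord_cvg C (ltnSn 0).
have [h3 _] := coord_cvg (3 * C) (ltnSn L).
move/cvgrPdist_le/(_ _ e5) in h0; move/cvgrPdist_le/(_ _ e5) in h3.
exists (g0 + maxn M L)%N; near=> n.
pose T := [set w | exists2 i, (M <= i)%N && (i.+1 < p n)%N & Z n i w <= t * Z n i.+1 w].
have mT : measurable T.
  apply: measurable_exists_nat => i _; apply: measurable_le_fun => //.
  exact: measurable_funM.
pose A0 := [set w | C < sc n * Z n 0 w]; pose A3 := [set w | sc n * Z n L w < 3 * C].
have mA0 : measurable A0 by apply: measurable_lt_fun => //; exact: measurable_funM.
have mA3 : measurable A3 by apply: measurable_lt_fun => //; exact: measurable_funM.
have s0 : 0 < sc n by near: n.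
have p1 : (1 < p n)%N by near: n.
have Lp : (L.+1 < p n)%N by near: n; exact: p_large.
have Z0 : pr (P n) (nonpos n) = 0.
  by rewrite /pr (_ : P n (nonpos n) = 0%E)//; near: n.
have pT : pr (P n) T <= eps / 5 by rewrite /T; near: n.
have pA0 : `|pr (limit_law g0 0) [set x | C < x] - pr (P n) A0| <= eps / 5 by rewrite /A0; near: n.
have pA3 : `|pr (limit_law g0 L) [set x | x < 3 * C] - pr (P n) A3| <= eps / 5 by rewrite /A3; near: n.
have mK : measurable [set w | (g0 + maxn M L <= W n w)%N].
  exact: (measurable_nat_valued (mW n) [set k | (g0 + maxn M L <= k)%N]).
have sub : [set w | (g0 + maxn M L <= W n w)%N] `<=` (nonpos n `|` T) `|` (A0 `|` A3).
  move=> w /= Ww.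
  have [npw|npw] := pselect (nonpos n w); first by left; left.
  have pos i : (i < p n)%N -> 0 < Z n i w.
    by move=> ip; rewrite ltNge; apply/negP => h; apply: npw; exists i.
  have [i [Wi ip strict _]] := W_argmin pos p1.
  move: Ww; rewrite Wi leq_add2l geq_max => /andP[Mi Li].
  have [Ti|Ti] := leP (Z n i w) (t * Z n i.+1 w); first by left; right; exists i; rewrite ?Mi.
  right; have [A0w|A0w] := ltP C (sc n * Z n 0 w); [by left|right].
  have step j : (j < i)%N -> t * Z n j.+1 w <= Z n j w.
    move=> ji; rewrite -(ler_pM2r (pos _ ip)); apply: le_trans (ltW (strict j ji)).
    rewrite mulrAC ler_pM2r; first exact: ltW.
    by apply: pos; exact: leq_ltn_trans (ltnW ip).
  have chainL k : (k <= i)%N -> t ^+ k * Z n k w <= Z n 0 w.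
    elim: k => [|k IH] ki; first by rewrite expr0 mul1r.
    apply: le_trans (IH (ltnW ki)); rewrite exprSr -mulrA ler_wpM2l ?exprn_ge0 ?(ltW t0)//.
    exact: step.
  have ZL : 0 < Z n L w by apply: pos; exact: ltnW.
  have h12 : 1 / 2 * Z n L w <= Z n 0 w.
    by apply: le_trans (chainL L Li); rewrite ler_pM2r.
  have : sc n * (1 / 2 * Z n L w) <= sc n * Z n 0 w by rewrite ler_pM2l.
  rewrite mulrCA /A3 /= => h; apply: (@le_lt_trans _ _ (2 * C)); last by lra.
  by move: (sc n * Z n L w) h => x; lra.
have h1 := pr_le_setU (P n) mK (measurableU _ _ (measurable_nonpos n) mT)
  (measurableU _ _ mA0 mA3) sub.
have h2 := pr_setU (P n) (measurable_nonpos n) mT.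
have h4 := pr_setU (P n) mA0 mA3.
move: pA0 pA3; rewrite !ler_distl => /andP[? ?] /andP[? ?]; lra.
Unshelve. all: by end_near.
Qed.

(** The limit is not computed. By the Cauchy criterion it suffices to be, for each [eps], eventually
    close to some number: here the limit probability that rank [i] is the strict minimum among the
    first [K] ratios, with [K] depending on [eps]. *)
Lemma argmin_level_cvg k : cvg (pr (P n) [set w | W n w = k] @[n --> \oo]).
Proof.
apply/cauchy_cvgP/cauchy_exP => eps eps0.
have e4 : 0 < eps / 4 by rewrite divr_gt0.
suff [l hl] : exists l, \forall n \near \oo, `|l - pr (P n) [set w | W n w = k]| <= 3 * (eps / 4).
  exists l; rewrite /ball /= ; near=> n.
  by apply: (@le_lt_trans _ _ (3 * (eps / 4))); [near: n|lra].
have [kg|gk] := ltnP k g0.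
  exists 0; near=> n.
  have p1 : (1 < p n)%N by near: n.
  have Z0 : pr (P n) (nonpos n) = 0.
    by rewrite /pr (_ : P n (nonpos n) = 0%E)//; near: n.
  have : pr (P n) [set w | W n w = k] <= pr (P n) (nonpos n).
    apply: pr_le => // w /= Wk; apply: contrapT => npw.
    have pos i : (i < p n)%N -> 0 < Z n i w.
      by move=> ip; rewrite ltNge; apply/negP => h; apply: npw; exists i.
    have [i [Wi _ _ _]] := W_argmin pos p1.
    by move: kg; rewrite -Wk Wi ltnNge leq_addr.
  have := pr_ge0 (P n) [set w | W n w = k].
  rewrite Z0 sub0r normrN; move: (pr _ _) => x x0 x1.
  by rewrite ger0_norm//; lra.
pose i := (k - g0)%N; have kE : k = (g0 + i)%N by rewrite /i subnKC.
have [K0 hK0] := argmin_tight e4.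
pose K := maxn K0 i.+1; have iK : (i < K)%N by exact: leq_maxr.
have lim_le0 j : limit_law g0 j [set x : R | x <= 0] = 0%E by exact: chi_le0.
have total := prodP_argmin_total (@limit_law_set1 R g0) lim_le0 iK.
have oE := @open_strict_argmin R K i; have oV := @open_not_argmin R K i.
have dis := @argmin_disjoint R K i.
have /cvgrPdist_le/(_ _ e4) hE := scaled_cvg oE oV dis total.
have /cvgrPdist_le/(_ _ e4) hV : pr (P n) [set w | not_argmin K i (scaled n K.+1 w)] @[n --> \oo] -->
    pr (prodP (limit_law g0) K.+1) (not_argmin K i).
  by apply: (scaled_cvg oV oE); [rewrite setIC|rewrite setUC].
have mE := measurable_open_rV oE; have mV := measurable_open_rV oV.
exists (pr (prodP (limit_law g0) K.+1) (strict_argmin K i)).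
move: total; rewrite pr_setUI// dis pr_set0 subr0 => total.
near=> n.
have Kp : (K.+1 <= p n)%N by near: n; exact: p_large.
have p1 : (1 < p n)%N by near: n.
have s0 : 0 < sc n by near: n.
have Z0 : pr (P n) (nonpos n) = 0.
  by rewrite /pr (_ : P n (nonpos n) = 0%E)//; near: n.
have pK0 : pr (P n) [set w | (K0 <= W n w)%N] <= eps / 4 by near: n.
pose XE := [set w | strict_argmin K i (scaled n K.+1 w)].
pose XV := [set w | not_argmin K i (scaled n K.+1 w)].
have pE : `|pr (prodP (limit_law g0) K.+1) (strict_argmin K i) - pr (P n) XE| <= eps / 4 by rewrite /XE; near: n.
have pV : `|pr (prodP (limit_law g0) K.+1) (not_argmin K i) - pr (P n) XV| <= eps / 4 by rewrite /XV; near: n.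
have mXE : measurable XE by apply: (measurable_preim (@measurable_scaled n K.+1)).
have mXV : measurable XV by apply: (measurable_preim (@measurable_scaled n K.+1)).
have mK0 : measurable [set w | (K0 <= W n w)%N].
  exact: (measurable_nat_valued (mW n) [set k | (K0 <= k)%N]).
have gapE j w : (j < K)%N -> ratio_gap (scaled n K.+1 w) i j =
    sc n ^+ 2 * (Z n j w * Z n i.+1 w - Z n i w * Z n j.+1 w).
  move=> jK; rewrite /ratio_gap !co_scaled ?ltnS//; try exact: ltnW.
  by ring.
have s2 : 0 < sc n ^+ 2 by rewrite exprn_gt0.
have posw w : ~ nonpos n w -> forall i, (i < p n)%N -> 0 < Z n i w.
  by move=> npw j jp; rewrite ltNge; apply/negP => h; apply: npw; exists j.
(* A strict minimum among the first [K] ratios can be beaten only from rank [K] on, which tightness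
   makes rare. *)
have subE : XE `<=` (nonpos n `|` [set w | W n w = k]) `|` [set w | (K0 <= W n w)%N].
  move=> w Ew; have [npw|npw] := pselect (nonpos n w); first by left; left.
  have [i' [Wi' ip' _ mini]] := W_argmin (posw w npw) p1.
  have [i'K|Ki'] := ltnP i' K; last first.
    by right; rewrite /= Wi'; apply: leq_trans (leq_addl _ _); apply: leq_trans Ki'; exact: leq_maxl.
  left; right; rewrite /= Wi' kE; congr addn; apply/eqP; apply/negPn/negP => ii'.
  have := Ew i' i'K ii'; rewrite gapE// pmulr_rgt0// subr_gt0 ltNge => /negP; apply.
  rewrite mulrC [leRHS]mulrC; have := mini i; rewrite mulrC [leRHS]mulrC; apply.
  by apply: leq_trans Kp; rewrite ltnS.
(* A strictly smaller ratio prevents rank [i] from being the worst; as the two open events fill the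
   limit mass, this yields the upper bound. *)
have subV : [set w | W n w = k] `&` XV `<=` nonpos n.
  move=> w [/= Wk [j /andP[jK ji]]]; rewrite gapE// pmulr_rlt0// subr_lt0 => h.
  apply: contrapT => npw; have [i' [Wi' _ _ mini]] := W_argmin (posw w npw) p1.
  have ii' : i' = i by apply/eqP; rewrite -(eqn_add2l g0) -Wi' -kE Wk.
  have := mini j; rewrite ii' leNgt h => /(_ _)/negP; apply => //.
  by apply: leq_trans Kp; rewrite ltnS.
have h1 := pr_le_setU (P n) mXE (measurableU _ _ (measurable_nonpos n) (mW n k)) mK0 subE.
have h2 := pr_setU (P n) (measurable_nonpos n) (mW n k).
have h3 := pr_le (P n) (measurableI _ _ (mW n k) mXV) (measurable_nonpos n) subV.
have h4 := pr_setUI (P n) (mW n k) mXV.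
have h5 := pr_le1 (P n) (measurableU _ _ (mW n k) mXV).
move: pE pV; rewrite !ler_distl => /andP[? ?] /andP[? ?]; apply/andP; split; lra.
Unshelve. all: by end_near.
Qed.

Lemma argmin_cvg : exists mu : probability (measurableTypeR R) R,
  cvg_in_distribution P (fun n w => (W n w)%:R) mu.
Proof.
apply: (@nat_cvg_in_distribution _ _ _ _ _ (fun k => limn (fun n => pr (P n) [set w | W n w = k]))) => //.
  by move=> k; exact: argmin_level_cvg.
exact: argmin_tight.
Qed.

End ratio_limits.

Lemma head_filter (T : Type) (x0 : T) (a : pred T) s :
  head x0 [seq x <- s | a x] = nth x0 s (find a s).
Proof. by elim: s => //= x s IH; case: ifP. Qed.

Lemma bigmin_seqP (R : realDomainType) (r : seq nat) (f : nat -> R) x0 :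
  (forall i, i \in r -> \big[Num.min/x0]_(i <- r) f i <= f i) /\
  (\big[Num.min/x0]_(i <- r) f i = x0 \/
   exists2 i, i \in r & \big[Num.min/x0]_(i <- r) f i = f i).
Proof.
elim: r => [|j r [IH1 IH2]]; first by rewrite big_nil; split => //; left.
rewrite big_cons; split.
  by move=> i; rewrite inE => /orP[/eqP ->|/IH1 h]; rewrite ge_min ?lexx// h orbT.
case: (leP (f j) (\big[Num.min/x0]_(i <- r) f i)) => h.
  by right; exists j; rewrite ?inE ?eqxx.
case: IH2 => [->|[i ir e]]; [by left|right; exists i => //].
by rewrite inE ir orbT.
Qed.

Lemma measurable_head_filter d (T : measurableType d) (c : nat -> T -> bool) (s : seq nat) k :
  (forall i, i \in s -> measurable [set w | c i w]) ->
  measurable [set w | head 0%N [seq i <- s | c i w] = k].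
Proof.
elim: s => [|j s IH] mc /=.
  have [e|e] := pselect (0%N = k).
    by rewrite (_ : [set w | _] = setT)//; apply/seteqP; split.
  by rewrite (_ : [set w | _] = set0)//; apply/seteqP; split.
rewrite (_ : [set w | _] = ([set w | c j w] `&` [set w | j = k]) `|`
    (~` [set w | c j w] `&` [set w | head 0%N [seq i <- s | c i w] = k])).
  have mj : measurable [set w | c j w] by apply: mc; rewrite inE eqxx.
  apply: measurableU; apply: measurableI => //.
  - have [e|e] := pselect (j = k).
      by rewrite (_ : [set w | _] = setT)//; apply/seteqP; split.
    by rewrite (_ : [set w | _] = set0)//; apply/seteqP; split.
  - exact: measurableC.
  - by apply: IH => i ir; apply: mc; rewrite inE ir orbT.
apply/seteqP; split => w /=.
  by case: ifP => cj h; [left|right; split => //; rewrite cj].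
by case=> [[-> ->]//|[/negP/negbTE -> ->]].
Qed.

(** * Spherical bases *)

Section ladder.
Context {R : realType} {d : measure_display} {Omega : measurableType d}.
Variables (P : probability Omega R) (n p : nat) (b : 'I_p -> {RV P >-> 'rV[R]_n}).

(* The squared lengths of the Gram-Schmidt vectors, numbered from the last one:
   [ladder i] is asymptotically a chi-square variable with [n - p + i + 1]
   degrees of freedom. *)
Definition ladder (i : nat) (w : Omega) : R :=
  if (i < p)%N then sqnorm (bhat (system b w) (p - i)) else 0.

Lemma ladderE i w : (i < p)%N -> ladder i w = sqnorm (bhat (system b w) (p - i.+1).+1).
Proof. by move=> ip; rewrite /ladder ip subnSK. Qed.

Lemma size_system w : size (system b w) = p.
Proof. by rewrite size_map size_enum_ord. Qed.

Lemma measurable_ladder i : measurable_fun setT (ladder i).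
Proof.
have [ip|pi] := ltnP i p; last first.
  by rewrite (_ : ladder i = cst 0)//; apply/funext => w; rewrite /ladder ltnNge pi.
rewrite (_ : ladder i = fun w => sqnorm (bhat (system b w) (p - i.+1).+1)).
  by apply: measurable_bhat; rewrite ltn_subrL (leq_ltn_trans _ ip).
by apply/funext => w; rewrite ladderE.
Qed.

Lemma gs_ratio_ladder i w : (i.+1 < p)%N ->
  gs_ratio (system b w) (p - i.+1) = ladder i w / ladder i.+1 w.
Proof. by move=> ip; rewrite /gs_ratio /ladder ip (ltnW ip) subnSK// ltnW. Qed.

Lemma measurable_gs_ratio k : (1 <= k < p)%N ->
  measurable_fun setT (fun w => gs_ratio (system b w) k).
Proof.
move=> /andP[k1 kp]; have ip : ((p - k.+1).+1 < p)%N.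
  by rewrite subnSK// ltn_subrL k1 (leq_ltn_trans _ kp).
have kE : k = (p - (p - k.+1).+1)%N by rewrite subnSK// subKn// ltnW.
rewrite (_ : (fun w => _) = fun w => ladder (p - k.+1) w / ladder (p - k.+1).+1 w).
  by apply: measurable_fun_div; exact: measurable_ladder.
by apply/funext => w; rewrite -gs_ratio_ladder// -kE.
Qed.

Lemma s_reduced_ladder s w : (forall i, (i < p)%N -> 0 < ladder i w) ->
  s_reduced s (system b w) <->
  (forall i, (i.+1 < p)%N -> s ^+ 2 * ladder i.+1 w < ladder i w).
Proof.
move=> pos; rewrite /s_reduced size_system; split => h i ip.
  have := h (p - i.+1)%N; rewrite gs_ratio_ladder// ltr_pdivlMr ?pos//; apply.
  by rewrite subn_gt0 ip/= -subn1 leq_sub2l.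
move: ip => /andP[i1 ip].
have ip' : (i < p)%N by case: (p) ip => [|q]; rewrite ?ltnS// leqNgt i1.
have ip2 : ((p - i.+1).+1 < p)%N by rewrite subnSK// ltn_subrL i1 (leq_ltn_trans _ ip').
have iE : i = (p - (p - i.+1).+1)%N by rewrite subnSK// subKn// ltnW.
by rewrite iE gs_ratio_ladder// ltr_pdivlMr ?pos//; exact: h.
Qed.

Lemma measurable_s_reduced s : measurable [set w | s_reduced s (system b w)].
Proof.
rewrite (_ : [set w | _] = [set w | forall i, (1 <= i <= p.-1)%N ->
    [set w | s ^+ 2 < gs_ratio (system b w) i] w]).
  apply: measurable_forall_nat => i /andP[i1 ip]; apply: measurable_lt_fun => //.
  by apply: measurable_gs_ratio; rewrite i1/=; case: (p) ip => [|q]; rewrite ?ltnS// leqNgt i1.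
by apply/seteqP; split => w /= h i; have := h i; rewrite size_system.
Qed.

Hypothesis pn : (p <= n)%N.

Lemma measurable_worst_index k : measurable [set w | worst_index (system b w) = k].
Proof.
rewrite /worst_index; under eq_set do rewrite size_system.
apply: (@measurable_head_filter _ _ (fun i w => gs_ratio (system b w) (n - i - 1) ==
  reduction_level (system b w))) => i.
rewrite mem_index_iota => /andP[i1 i2].
have hk : (1 <= n - i - 1 < p)%N by lia.
rewrite (_ : [set w | _] = [set w | gs_ratio (system b w) (n - i - 1) = reduction_level (system b w)]).
  apply: measurable_eq_fun; first exact: measurable_gs_ratio.
  rewrite /reduction_level; under eq_fun do rewrite size_system.
  have : {subset index_iota 1 p <= [pred j | (1 <= j < p)%N]} by move=> j; rewrite mem_index_iota.
  elim: index_iota => [|j r IH] hr.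
    by under eq_fun do rewrite big_nil; apply: measurable_gs_ratio; lia.
  under eq_fun do rewrite big_cons; apply: measurable_minr.
    by apply: measurable_gs_ratio; apply: hr; rewrite inE eqxx.
  by apply: IH => l lr; apply: hr; rewrite inE lr orbT.
by apply/seteqP; split => w /= /eqP.
Qed.

(** The entry [n - p + i] of the scanned list designates the ratio of [ladder i] to [ladder i.+1].
    The first hit is strictly below the ratios of smaller [i], and weakly below the others. *)
Lemma worst_index_ladder w : (forall i, (i < p)%N -> 0 < ladder i w) -> (1 < p)%N ->
  exists i, [/\ worst_index (system b w) = (n - p + i)%N, (i.+1 < p)%N,
    forall j, (j < i)%N -> ladder i w * ladder j.+1 w < ladder j w * ladder i.+1 w &
    forall j, (j.+1 < p)%N -> ladder i w * ladder j.+1 w <= ladder j w * ladder i.+1 w].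
Proof.
move=> pos p1; set B := system b w; set r := fun i => ladder i w / ladder i.+1 w.
have levelE : reduction_level B = \big[Num.min/gs_ratio B 1]_(i <- index_iota 1 p) gs_ratio B i.
  by rewrite /reduction_level size_system.
have [le_level att] := bigmin_seqP (index_iota 1 p) (gs_ratio B) (gs_ratio B 1).
rewrite -levelE in le_level att.
have {}le_level j : (j.+1 < p)%N -> reduction_level B <= r j.
  by move=> jp; rewrite /r -gs_ratio_ladder//; apply: le_level; rewrite mem_index_iota; lia.
have {att}[k kp attk] : exists2 k, (1 <= k < p)%N & reduction_level B = gs_ratio B k.
  by case: att => [->|[k]]; [exists 1%N|rewrite mem_index_iota; exists k].
pose c i := gs_ratio B (n - i - 1) == reduction_level B.
pose s := index_iota (n - p) n.-1.
have hs : has c s.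
  apply/hasP; exists (n - k.+1)%N; first by rewrite mem_index_iota; lia.
  by rewrite /c attk; apply/eqP; congr gs_ratio; lia.
have fs : (find c s < p.-1)%N by move: hs; rewrite has_find size_iota; lia.
have nths i : (i < p.-1)%N -> nth 0%N s i = (n - p + i)%N.
  by move=> ip; rewrite nth_iota//; lia.
have cE i : (i.+1 < p)%N -> c (n - p + i)%N = (r i == reduction_level B).
  by move=> ip; rewrite /c /r -gs_ratio_ladder//; congr (gs_ratio _ _ == _); lia.
have rcmp i j : (i.+1 < p)%N -> (j.+1 < p)%N ->
    ((r i < r j) = (ladder i w * ladder j.+1 w < ladder j w * ladder i.+1 w)) *
    ((r i <= r j) = (ladder i w * ladder j.+1 w <= ladder j w * ladder i.+1 w)).
  move=> ip jp; have i0 := pos _ ip; have j0 := pos _ jp.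
  by rewrite /r; split; rewrite ?ltr_pdivrMr ?ler_pdivrMr// mulrAC ?ltr_pdivlMr ?ler_pdivlMr.
set i := find c s; have ip : (i.+1 < p)%N by move: fs; lia.
have ri : r i = reduction_level B.
  by apply/eqP; rewrite -cE// -nths//; exact: nth_find.
exists i; split => //.
- by rewrite /worst_index [size B]size_system head_filter; exact: nths.
- move=> j ji; have jp : (j.+1 < p)%N by apply: ltn_trans ip; rewrite ltnS.
  rewrite -(rcmp i j ip jp).1 lt_neqAle ri le_level// andbT eq_sym -cE// -nths//; last by lia.
  by rewrite before_find.
- by move=> j jp; rewrite -(rcmp i j ip jp).2 ri; exact: le_level.
Qed.

Variable nu : probability 'rV[R]_n R.
Hypotheses (iidb : iid nu b) (inu : rotation_invariant nu) (nu0 : nu [set 0] = 0%E).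

(** Reversing the indices turns [gs_law] into a statement on the last [K] vectors; the other vectors
    receive [setT], of factor 1. *)
Lemma ladder_joint_law K (B : nat -> set R) : (K <= p)%N -> (forall i, measurable (B i)) ->
  P [set w | forall i : 'I_K, B i (ladder i w)] =
  (\prod_(i < K) nu [set x | B i (tsq (p - i.+1) x)])%E.
Proof.
move=> Kp mB.
pose B' j : set R := if (p - j.+1 < K)%N then B (p - j.+1)%N else setT.
have mB' j : measurable (B' j) by rewrite /B'; case: ifP.
have revK i : (i < p)%N -> (p - (p - i.+1).+1)%N = i by move=> ip; rewrite subnSK// subKn// ltnW.
rewrite (_ : [set w | _] = [set w | forall j : 'I_p, B' j (sqnorm (bhat (system b w) j.+1))]).
  rewrite (gs_law pn iidb inu nu0 mB') (reindex_inj rev_ord_inj) /=.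
  rewrite (big_ord_widen p (fun i => nu [set x | B i (tsq (p - i.+1) x)]) Kp) [RHS]big_mkcond /=.
  apply: eq_bigr => i _; rewrite /B' revK//; case: ifP => // _.
  by rewrite (_ : [set x | _] = setT) ?probability_setT//; apply/seteqP; split.
apply/seteqP; split => w /= h.
  move=> j; rewrite /B'; case: ifP => // jK.
  have := h (Ordinal jK); rewrite /= ladderE; last by lia.
  by rewrite (_ : (p - (p - j.+1).+1 = j)%N)//; have := ltn_ord j; lia.
move=> i; have ip : (i < p)%N by exact: leq_trans Kp.
have rp : (p - i.+1 < p)%N by lia.
by have := h (Ordinal rp); rewrite /B' /= revK// ltn_ord -ladderE.
Qed.

Lemma ladder_law i (B : set R) : (i < p)%N -> measurable B ->
  P [set w | B (ladder i w)] = nu [set x | B (tsq (p - i.+1) x)].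
Proof.
move=> ip mB; pose B' j : set R := if j == i then B else setT.
have mB' j : measurable (B' j) by rewrite /B'; case: ifP.
have := ladder_joint_law ip mB'; rewrite big_ord_recr /= big1 ?mul1e.
  rewrite /B' eqxx => <-; congr (P _); apply/seteqP; split => w /= h.
    by move=> j; case: ifP => // /eqP ->.
  by have := h ord_max; rewrite /= eqxx.
by move=> j _; rewrite /B' ltn_eqF//= (_ : [set x | _] = setT) ?probability_setT.
Qed.

Lemma ladder_null : P [set w | exists2 i, (i < p)%N & ladder i w <= 0] = 0%E.
Proof.
apply: null_exists_nat => i ip; first by apply: measurable_le_fun => //; exact: measurable_ladder.
rewrite (@ladder_law i [set x | x <= 0])//; last exact: measurable_le_set.
rewrite -(@rotation_tsq_eq0 _ n (p - i.+1) nu inu nu0); last by lia.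
congr (nu _); apply/seteqP; split => x /=; last by move=> ->.
by move=> h; apply/eqP; rewrite eq_le h tsq_ge0.
Qed.

End ladder.

Lemma cvg_prod_ord (R : realType) K (u : nat -> nat -> R) (l : nat -> R) :
  (forall k, (k < K)%N -> u k n @[n --> \oo] --> l k) ->
  \prod_(k < K) u k n @[n --> \oo] --> \prod_(k < K) l k.
Proof.
elim: K => [|K IH] ul.
  by rewrite big_ord0; apply: cvg_near_cst; near=> n; rewrite big_ord0.
rewrite big_ord_recr (_ : (fun n => _) = fun n => \prod_(k < K) u k n * u K n).
  by apply: cvgM; [apply: IH => k kK; apply: ul; exact: ltnW|exact: ul].
by apply/funext => n; rewrite big_ord_recr.
Unshelve. all: by end_near.
Qed.

Lemma fine_prod (R : realType) K (m : nat -> \bar R) : (forall i, m i \is a fin_num) ->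
  fine (\prod_(i < K) m i)%E = \prod_(i < K) fine (m i).
Proof.
move=> fm; rewrite (_ : (\prod_(i < K) m i)%E = (\prod_(i < K) fine (m i))%:E)//.
by rewrite -prodEFin; apply: eq_bigr => i _; rewrite fineK.
Qed.

(** * Random bases of growing dimension *)

Section spherical_basis.
Context {R : realType} (nu : forall n : nat, probability 'rV[R]_n R)
  (g : nat -> nat) (d : nat -> measure_display)
  (Omega : forall n : nat, measurableType (d n))
  (P : forall n : nat, probability (Omega n) R)
  (b : forall n : nat, 'I_(n - g n) -> {RV (P n) >-> 'rV[R]_n}).
Arguments b : clear implicits.
Hypotheses (snu : spherical_model nu) (cnu : norm_concentration nu).
Hypothesis gn : forall n : nat, (0 < n)%N -> (g n <= n.-1)%N.
Hypothesis iidb : forall n : nat, (0 < n)%N -> iid (nu n) (b n).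

Let p n := (n - g n)%N.

Let Z n : nat -> Omega n -> R := ladder (b n).
Arguments Z : clear implicits.

Let measurable_Z n i : measurable_fun setT (Z n i).
Proof. exact: measurable_ladder. Qed.

Let Z_law n i (B : set R) : (0 < n)%N -> (i < p n)%N -> measurable B ->
  P n [set w | B (Z n i w)] = nu n [set x | B (tsq (n - (g n + i).+1) x)].
Proof.
move=> n0 ip mB; rewrite (ladder_law _ (iidb n0) (spherical_rotation snu n0) (snu n0).2)//.
  by rewrite -subnDA addnS.
exact: leq_subr.
Qed.

Let nonpos n := [set w | exists2 i, (i < p n)%N & Z n i w <= 0].
Arguments nonpos : clear implicits.

Let measurable_nonpos n : measurable (nonpos n).
Proof. by apply: measurable_exists_nat => i _; exact: measurable_le_fun. Qed.

Let nonpos_null n : (0 < n)%N -> P n (nonpos n) = 0%E.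
Proof.
move=> n0; apply: ladder_null (iidb n0) (spherical_rotation snu n0) (snu n0).2.
exact: leq_subr.
Qed.

Let pr_reduced s n : (0 < n)%N -> pr (P n) [set w | s_reduced s (system (b n) w)] =
  pr (P n) [set w | forall i, (i.+1 < p n)%N -> s ^+ 2 * Z n i.+1 w < Z n i w].
Proof.
move=> n0.
have m1 : measurable [set w | s_reduced s (system (b n) w)] by exact: measurable_s_reduced.
have m2 : measurable [set w | forall i, (i.+1 < p n)%N -> s ^+ 2 * Z n i.+1 w < Z n i w].
  apply: measurable_forall_nat => i _; apply: measurable_lt_fun => //.
  exact: measurable_funM.
have pos w : ~ nonpos n w -> forall i, (i < p n)%N -> 0 < Z n i w.
  by move=> npw i ip; rewrite ltNge; apply/negP => h; apply: npw; exists i.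
have z : pr (P n) (nonpos n) = 0 by rewrite /pr nonpos_null.
apply/eqP; rewrite eq_le; apply/andP; split; rewrite -[leRHS]addr0 -z.
  apply: pr_le_setU => // w h; have [npw|npw] := pselect (nonpos n w); [by right|left].
  exact: (s_reduced_ladder s (pos w npw)).1.
apply: pr_le_setU => // w h; have [npw|npw] := pselect (nonpos n w); [by right|left].
exact: (s_reduced_ladder s (pos w npw)).2.
Qed.

(** The threshold [M] bears on [g n + i], the number of degrees of freedom less 1, and not on [i]:
    the estimate covers every ratio when [g n] tends to infinity, and all but finitely many when it
    is constant. The failure probabilities add up to at most
    [2 * q ^+ M / (1 - q) + 2 * n * del n]. *)
Lemma ladder_ratio_tails (t eps : R) : 0 < t < 1 -> 0 < eps -> exists M,
  \forall n \near \oo, pr (P n) [set w | exists2 i, (M <= g n + i)%N && (i.+1 < p n)%N &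
    Z n i w <= t * Z n i.+1 w] <= eps.
Proof.
move=> t01 eps0; have [a a_gt0 cmp] := concentration_compare snu cnu.
have [c [q [M0 [del [c0 q01 ndel del0 tails]]]]] := marginal_tails cmp t01.
move: (t01) (q01) => /andP[t0 t1] /andP[q0 q1].
have q1' : 0 < 1 - q by rewrite subr_gt0.
have e1 : 0 < eps / 4 * (1 - q) by rewrite mulr_gt0// divr_gt0.
have e2 : 0 < eps / 4 by rewrite divr_gt0.
have /cvgrPdist_le/(_ _ e1)[M1 _ hM1] : q ^+ n @[n --> \oo] --> (0 : R).
  by apply: cvg_geom0; rewrite (ltW q0).
pose M := maxn M0 M1.
have hM : q ^+ M / (1 - q) <= eps / 4.
  rewrite ler_pdivrMr//; have := hM1 M (leq_maxr _ _).
  by rewrite /= sub0r normrN ger0_norm// exprn_ge0// ltW.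
move/cvgrPdist_le/(_ _ e2) : ndel => ndel.
exists M; near=> n.
have n0 : (0 < n)%N by near: n; exact: nbhs_infty_gt.
have an : 0 < a n by near: n.
have dn : n%:R * del n <= eps / 4.
  by apply: (@le_trans _ _ `|0 - n%:R * del n|); [rewrite sub0r normrN ler_norm|near: n].
pose sc := n%:R / a n; have sc0 : 0 < sc by rewrite divr_gt0// ltr0n.
pose l i := (g n + i)%N.
pose F i := [set w | sc * Z n i w <= c * (l i).+1%:R] `|` [set w | c / t * (l i).+1%:R <= sc * Z n i.+1 w].
have m1 i : measurable [set w | sc * Z n i w <= c * (l i).+1%:R].
  by apply: measurable_le_fun => //; exact: measurable_funM.
have m2 i : measurable [set w | c / t * (l i).+1%:R <= sc * Z n i.+1 w].
  by apply: measurable_le_fun => //; exact: measurable_funM.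
(* Truncated subtraction: [lo] is 0 once [g n] is at least [M]. The bound [hi] leaves out the last
   index, which has no successor. *)
pose lo := (M - g n)%N; pose hi := (p n).-1.
have pF i : (lo <= i < hi)%N -> pr (P n) (F i) <= 2 * q ^+ g n * q ^+ i + 2 * del n.
  move=> /andP[loi ihi]; have ip : (i.+1 < p n)%N by rewrite -ltn_predRL.
  have Ml : (M0 <= l i)%N by rewrite (leq_trans (leq_maxl M0 M1))// -leq_subLR.
  have ln : ((l i).+1 < n)%N by rewrite -addnS -ltn_subRL.
  have [h1 h2] := tails n (l i) Ml ln.
  apply: (le_trans (pr_setU (P n) (m1 i) (m2 i))).
  rewrite (_ : 2 * q ^+ g n * q ^+ i + 2 * del n = (q ^+ l i + del n) + (q ^+ l i + del n)).
    apply: lerD.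
      apply: le_trans h1; rewrite /pr.
      rewrite (@Z_law n i [set x | sc * x <= c * (l i).+1%:R])//; first exact: ltnW.
      by apply: measurable_le_fun => //; exact: measurable_funM.
    apply: le_trans h2; rewrite /pr.
    rewrite (@Z_law n i.+1 [set x | c / t * (l i).+1%:R <= sc * x])//.
      by rewrite addnS.
    by apply: measurable_le_fun => //; exact: measurable_funM.
  by rewrite /l exprD; ring.
set E := [set w | _].
have mE : measurable E.
  by apply: measurable_exists_nat => i _; apply: measurable_le_fun => //; exact: measurable_funM.
have sub : E `<=` [set w | exists2 i, (lo <= i < hi)%N & F i w].
  move=> w [i /andP[Mi ip] h]; exists i; first by rewrite /lo leq_subLR Mi ltn_predRL.
  have [h1|h1] := leP (sc * Z n i w) (c * (l i).+1%:R); [by left|right => /=].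
  rewrite mulrAC ler_pdivrMr// ltW//; apply: (lt_le_trans h1).
  by rewrite [leRHS]mulrC mulrCA ler_pM2l.
have mF : measurable [set w | exists2 i, (lo <= i < hi)%N & F i w].
  by apply: measurable_exists_nat => i _; exact: measurableU.
apply: (le_trans (pr_le (P n) mE mF sub)).
apply: (le_trans (pr_exists_le (fun i _ => measurableU _ _ (m1 i) (m2 i)) pF)).
rewrite big_split /= -big_distrr /= big_const_nat iter_addr_0 -[_ *+ (hi - lo)]mulr_natr.
have s1 : q ^+ g n * (\sum_(lo <= i < hi) q ^+ i) <= eps / 4.
  have hq : 0 <= q < 1 by rewrite (ltW q0).
  apply: (le_trans (ler_wpM2l (exprn_ge0 _ (ltW q0)) (geom_sum_le lo hi hq))).
  apply: le_trans hM; rewrite mulrA ler_pM2r ?invr_gt0// -exprD.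
  by apply: ler_wiXn2l; [exact: ltW|exact: ltW|rewrite -leq_subLR].
have s2 : del n * (hi - lo)%:R <= eps / 4.
  apply: le_trans dn; rewrite mulrC ler_wpM2r// ler_nat.
  exact: leq_trans (leq_subr _ _) (leq_trans (leq_pred _) (leq_subr _ _)).
move: s1 s2; rewrite -!mulrA; move: (_ * \sum_(_ <= _ < _) _) (del n * _) => x y; lra.
Unshelve. all: by end_near.
Qed.

(** Once [g n] is at least [M], a basis that is not reduced lies in the tail event. *)
Lemma reduced_cvg1 (s : R) : 0 < s < 1 -> g n @[n --> \oo] --> \oo ->
  pr (P n) [set w | s_reduced s (system (b n) w)] @[n --> \oo] --> (1 : R).
Proof.
move=> /andP[s0 s1] goo; apply/cvgrPdist_le => eps eps0.
have s2 : 0 < s ^+ 2 < 1 by rewrite exprn_gt0// exprn_ilt1// ltW.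
have [M hM] := ladder_ratio_tails s2 eps0.
have gM : \forall n \near \oo, (M <= g n)%N by move/cvgnyPge : goo; apply.
near=> n.
have n0 : (0 < n)%N by near: n; exact: nbhs_infty_gt.
rewrite pr_reduced//.
set C := [set w | _].
have mC : measurable C.
  apply: measurable_forall_nat => i _; apply: measurable_lt_fun => //.
  exact: measurable_funM.
rewrite -pr_setC// ger0_norm ?pr_ge0//.
have hE : pr (P n) [set w | exists2 i, (M <= g n + i)%N && (i.+1 < p n)%N &
    Z n i w <= s ^+ 2 * Z n i.+1 w] <= eps by near: n.
apply: le_trans hE; apply: pr_le; first exact: measurableC.
  by apply: measurable_exists_nat => i _; apply: measurable_le_fun => //; exact: measurable_funM.
move=> w /= nC; apply: contrapT => h; apply: nC => i ip.
rewrite ltNge; apply/negP => h'; apply: h; exists i => //; rewrite ip andbT.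
by apply: leq_trans (leq_addr _ _); near: n.
Unshelve. all: by end_near.
Qed.

Section constant_codimension.
Variable g0 : nat.
Hypothesis g_const : forall n : nat, (g0 < n)%N -> g n = g0.

Let near_g : \forall n \near \oo, (0 < n)%N /\ g n = g0.
Proof.
near=> n; have gn0 : (g0 < n)%N by near: n; exact: nbhs_infty_gt.
by split; [exact: leq_ltn_trans gn0|exact: g_const].
Unshelve. all: by end_near.
Qed.

(** The lengths are independent for each [n], not only in the limit, so the probability of a box is
    a product and each factor converges separately. *)
Let box_cvg (a : nat -> R)
    (cmp : forall kap : R, 1 < kap -> exists del : nat -> R,
      [/\ n%:R * del n @[n --> \oo] --> 0, (forall n, 0 <= del n) &
      forall n k (A A' : set R), (0 < n)%N -> (k <= n)%N ->
       measurable A -> measurable A' ->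
       (forall t y, kap^-1 <= t <= kap -> 0 <= y -> A (t * y) -> A' y) ->
       pr (nu n) [set x | A (n%:R / a n * tsq k x)] <=
       pr (gam n) [set y | A' (tsq k y)] + del n]) K (ab : {ffun 'I_K -> R * R}) :
  pr (P n) [set w | forall i, `](ab i).1, (ab i).2]%classic (n%:R / a n * Z n i w)] @[n --> \oo] -->
  pr (prodP (limit_law g0) K) (box ab).
Proof.
pose ab' i : R * R := oapp ab (0, 0) (insub i).
have ab'E (i : 'I_K) : ab' i = ab i by rewrite /ab' valK.
pose I i : set R := `](ab' i).1, (ab' i).2]%classic.
have -> : pr (prodP (limit_law g0) K) (box ab) = \prod_(i < K) pr (limit_law g0 i) (I i).
  rewrite /pr (_ : box ab = [set x | forall i : 'I_K, I i (x ord0 i)]); last first.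
    by apply/seteqP; split => x /= h i; have := h i; rewrite /I ab'E.
  transitivity (fine (\prod_(i < K) limit_law g0 i (I i))%E); first by congr fine; apply: prodP_box => i; exact: measurable_itv.
  by apply: (@fine_prod _ _ (fun i => limit_law g0 i (I i))) => i; apply: fin_num_measure; exact: measurable_itv.
have := @cvg_prod_ord R K
  (fun i n => pr (nu n) [set z | I i (n%:R / a n * tsq (n - (g0 + i).+1) z)])
  (fun i => pr (limit_law g0 i) (I i))
  (fun i _ => @marginal_itv_cvg _ nu a cmp _ (ab' i).1 (ab' i).2 (ltn0Sn (g0 + i))).
apply: cvg_trans; apply: near_eq_cvg; near=> n.
have [n0 ng] : (0 < n)%N /\ g n = g0 by near: n.
have Kp : (K <= p n)%N.
  by rewrite /p ng leq_subRL; near: n; [exact: nbhs_infty_ge|exact: nbhs_infty_ge].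
have mI i : measurable [set x : R | I i (n%:R / a n * x)].
  by apply: (@measurable_preim _ _ _ _ (fun x : R => n%:R / a n * x) (I i)); [exact: measurable_funM|exact: measurable_itv].
rewrite /pr (_ : [set w | _] = [set w | forall i : 'I_K, [set x | I i (n%:R / a n * x)] (Z n i w)]); last first.
  by apply/seteqP; split => w /= h i; have := h i; rewrite /I ab'E.
rewrite (ladder_joint_law (leq_subr _ _) (iidb n0) (spherical_rotation snu n0) (snu n0).2 Kp
  (B := fun i => [set x | I i (n%:R / a n * x)]))//.
rewrite -(@fine_prod _ _ (fun i => nu n [set z | I i (n%:R / a n * tsq (n - (g0 + i).+1) z)])); last first.
  move=> i; apply: fin_num_measure.
  apply: (@measurable_preim _ _ _ _ (tsq (n - (g0 + i).+1)) [set x | I i (n%:R / a n * x)]) => //.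
  exact: measurable_tsq.
congr fine; apply: eq_bigr => i _; congr (nu n _); apply/seteqP; split => x /=;
  by rewrite -subnDA ng addnS.
Unshelve. all: by end_near.
Qed.

Let p_large K : \forall n \near \oo, (K <= n - g0)%N.
Proof.
by near=> n; rewrite leq_subRL; near: n; exact: nbhs_infty_ge.
Unshelve. all: by end_near.
Qed.

Let tails_const (t eps : R) : 0 < t < 1 -> 0 < eps -> exists M,
  \forall n \near \oo, pr (P n) [set w | exists2 i, (M <= i)%N && (i.+1 < n - g0)%N &
    Z n i w <= t * Z n i.+1 w] <= eps.
Proof.
move=> t01 eps0; have [M hM] := ladder_ratio_tails t01 eps0; exists M; near=> n.
have [n0 ng] : (0 < n)%N /\ g n = g0 by near: n.
have h : pr (P n) [set w | exists2 i, (M <= g n + i)%N && (i.+1 < p n)%N &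
    Z n i w <= t * Z n i.+1 w] <= eps by near: n.
apply: le_trans h; apply: pr_le.
- by apply: measurable_exists_nat => i _; apply: measurable_le_fun => //; exact: measurable_funM.
- by apply: measurable_exists_nat => i _; apply: measurable_le_fun => //; exact: measurable_funM.
move=> w [i /andP[Mi ip] h]; exists i => //; rewrite /p ng ip andbT.
exact: leq_trans (leq_addl _ _).
Unshelve. all: by end_near.
Qed.

Lemma reduced_cvg_const (s : R) : 0 < s < 1 ->
  pr (P n) [set w | s_reduced s (system (b n) w)] @[n --> \oo] --> reduced_limit (s ^+ 2) g0.
Proof.
move=> /andP[s0 s1]; have s2 : 0 < s ^+ 2 < 1 by rewrite exprn_gt0// exprn_ilt1// ltW.
have [a a_gt0 cmp] := concentration_compare snu cnu.
have sc0 : \forall n \near \oo, 0 < n%:R / a n.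
  near=> n; rewrite divr_gt0//; last by near: n.
  by rewrite ltr0n; near: n; exact: nbhs_infty_gt.
have := chain_limit measurable_Z sc0 p_large (box_cvg cmp) tails_const s2.
apply: cvg_trans; apply: near_eq_cvg; near=> n.
have [n0 ng] : (0 < n)%N /\ g n = g0 by near: n.
by rewrite pr_reduced// /p ng.
Unshelve. all: by end_near.
Qed.

Lemma worst_index_cvg : exists mu : probability (measurableTypeR R) R,
  cvg_in_distribution P (fun n w => (worst_index (system (b n) w))%:R) mu.
Proof.
have [a a_gt0 cmp] := concentration_compare snu cnu.
have sc0 : \forall n \near \oo, 0 < n%:R / a n.
  near=> n; rewrite divr_gt0//; last by near: n.
  by rewrite ltr0n; near: n; exact: nbhs_infty_gt.
apply: (argmin_cvg measurable_Z sc0 p_large (box_cvg cmp) tails_const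
  (W := fun n w => worst_index (system (b n) w))).
- by move=> n k; apply: measurable_worst_index; exact: leq_subr.
- near=> n; have [n0 ng] : (0 < n)%N /\ g n = g0 by near: n.
  by have := nonpos_null n0; rewrite /nonpos /p ng.
(* Having at least two vectors, [1 < n - g0], forces [g0 < n] and hence [g n = g0]. *)
move=> n w pos p1; have gn0 : (g0 < n)%N by lia.
have ng := g_const gn0; rewrite -ng in pos p1 *.
have [i] := @worst_index_ladder _ _ _ _ _ _ (b n) (leq_subr _ _) w pos p1.
rewrite subKn; first by exists i.
exact: leq_trans (gn (leq_ltn_trans (leq0n _) gn0)) (leq_pred n).
Unshelve. all: by end_near.
Qed.

End constant_codimension.
End spherical_basis.

(* c g0 is the limit in the constant codimension case: it depends on s and on
   the codimension g0 only, not on the spherical model.  As the codimension is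
   at most n - 1, a constant codimension g0 is only possible for n > g0. *)
Theorem theorem1p4 (R : realType) (s : R) (hs : 0 < s < 1) :
  exists c : nat -> R,
    (forall g0 : nat, 0 < c g0 < 1) /\
    forall (nu : forall n : nat, probability 'rV[R]_n R)
      (g : nat -> nat) (d : nat -> measure_display)
      (Omega : forall n : nat, measurableType (d n))
      (P : forall n : nat, probability (Omega n) R)
      (b : forall n : nat, 'I_(n - g n) -> {RV (P n) >-> 'rV[R]_n}),
    spherical_model nu ->
    norm_concentration nu ->
    (forall n : nat, (0 < n)%N -> (g n <= n.-1)%N) ->
    (forall n : nat, (0 < n)%N -> iid (nu n) (b n)) ->
    [/\ g n @[n --> \oo] --> \oo ->
          P n [set w | s_reduced s (system (b n) w)] @[n --> \oo] --> 1%E,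
        forall g0 : nat, (forall n : nat, (g0 < n)%N -> g n = g0) ->
          P n [set w | s_reduced s (system (b n) w)] @[n --> \oo]
            --> (c g0)%:E &
        forall g0 : nat, (forall n : nat, (g0 < n)%N -> g n = g0) ->
          exists mu : probability (measurableTypeR R) R,
            cvg_in_distribution P
              (fun n w => (worst_index (system (b n) w))%:R) mu].
Proof.
exists (reduced_limit (s ^+ 2)); move: (hs) => /andP[s0 s1].
have s2 : 0 < s ^+ 2 < 1 by rewrite exprn_gt0// exprn_ilt1// ltW.
split=> [g0|nu g d Omega P b snu cnu gn iidb].
  by rewrite reduced_limit_gt0// reduced_limit_lt1//; case/andP: s2.
have to_ereal (l : R) : pr (P n) [set w | s_reduced s (system (b n) w)] @[n --> \oo] --> l ->
    P n [set w | s_reduced s (system (b n) w)] @[n --> \oo] --> l%:E.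
  move=> h; rewrite (_ : (fun n => P n _) =
      fun n => (pr (P n) [set w | s_reduced s (system (b n) w)])%:E).
    by apply: cvg_EFin; [near=> n|exact: h].
  by apply/funext => n; rewrite prE//; exact: measurable_s_reduced.
split=> [goo|g0 hg|g0 hg].
- by apply: to_ereal; exact: (reduced_cvg1 snu cnu iidb hs goo).
- by apply: to_ereal; exact: (reduced_cvg_const snu cnu iidb hg hs).
- exact: (worst_index_cvg snu cnu gn iidb hg).
Unshelve. all: by end_near.
Qed.
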